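(* Let $f(z)$ be a transcendental entire function, let $k\ge 1$ be an integer and let $a_1,\ldots,a_k$ be complex constants. If $f(z)^3+a_1f'(z)+\cdots+a_kf^{(k)}(z)$ is a periodic function with period $c$ and $\Theta(0,f)>0$, then $f(z)$ is periodic with period $c$ or $3c$.
   Context: $\Theta(0,f):=1-\limsup_{r\to\infty}\frac{\overline{N}(r,1/f)}{T(r,f)}$, where $T(r,f)$ is the Nevanlinna characteristic function and $\overline{N}(r,1/f)$ is the integrated counting function of the zeros of $f$ in $|z|\le r$, ignoring multiplicities. An entire function $F$ is periodic of period $c$ ($c\in\mathbb{C}\setminus\{0\}$) if $F(z+c)=F(z)$ identically; $c$ need not be a minimal period. *)

(* Defs.v *)
From Stdlib Require Import Reals List ClassicalEpsilon.
From Coquelicot Require Import Coquelicot.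

Open Scope R_scope.

Definition entire (f : C -> C) : Prop :=
  forall z : C, ex_derive (K := C_AbsRing) (V := C_NormedModule) f z.

Definition polynomial_fun (f : C -> C) : Prop :=
  exists (n : nat) (b : nat -> C),
    forall z : C, f z = sum_n (fun i => (b i * z ^ i)%C) n.

Definition transcendental_entire (f : C -> C) : Prop :=
  entire f /\ ~ polynomial_fun f.

(* [C_derive] is a total operator; at a point of complex differentiability it
   is the complex derivative (lemma [C_derive_correct]). *)
Definition C_derive_n (n : nat) (f : C -> C) : C -> C := Nat.iter n C_derive f.

Definition periodic (c : C) (F : C -> C) : Prop :=
  c <> 0%C /\ forall z : C, F (z + c)%C = F z.

(* The sum of [w] over the finite set [E]; a junk value if [E] is infinite. *)
Definition is_sum_over (E : C -> Prop) (w : C -> nat) (n : nat) : Prop :=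
  exists l : list C,
    NoDup l /\ (forall z, In z l <-> E z) /\ n = list_sum (map w l).

Definition sum_over (E : C -> Prop) (w : C -> nat) : nat :=
  epsilon (inhabits 0%nat) (is_sum_over E w).

Definition integrated_counting (n : R -> nat) (r : R) : R :=
  RInt (fun t => (INR (n t) - INR (n 0)) / t) 0 r + INR (n 0) * ln r.

Definition is_pole_of_order (f : C -> C) (a : C) (m : nat) : Prop :=
  (1 <= m)%nat /\
  exists g : C -> C,
    locally a (fun z => ex_derive (K := C_AbsRing) (V := C_NormedModule) g z) /\
    g a <> 0%C /\
    locally' a (fun z => f z = (g z / (z - a) ^ m)%C).

Definition is_pole (f : C -> C) (a : C) : Prop :=
  exists m : nat, is_pole_of_order f a m.

Definition pole_order (f : C -> C) (a : C) : nat :=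
  epsilon (inhabits 0%nat) (is_pole_of_order f a).

(* n(t, f), N(r, f): poles of f, with multiplicity. *)
Definition n_poles (f : C -> C) (t : R) : nat :=
  sum_over (fun z => Cmod z <= t /\ is_pole f z) (pole_order f).

Definition N_poles (f : C -> C) (r : R) : R :=
  integrated_counting (n_poles f) r.

(* nbar(t, 1/f), Nbar(r, 1/f): distinct zeros of f. *)
Definition nbar_zeros (f : C -> C) (t : R) : nat :=
  sum_over (fun z => Cmod z <= t /\ f z = 0%C) (fun _ => 1%nat).

Definition Nbar_zeros (f : C -> C) (r : R) : R :=
  integrated_counting (nbar_zeros f) r.

(* [ln x = 0] for [x <= 0], so this is also right at [x = 0]. *)
Definition log_plus (x : R) : R := Rmax 0 (ln x).

(* m(r, f); a Riemann integral, so meaningful when f is continuous on the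
   circle |z| = r, which is always the case for entire f. *)
Definition proximity (f : C -> C) (r : R) : R :=
  / (2 * PI) *
  RInt (fun t => log_plus (Cmod (f (r * cos t, r * sin t)))) 0 (2 * PI).

Definition nevanlinna_T (f : C -> C) (r : R) : R :=
  proximity f r + N_poles f r.

Definition LimSup_p_infty (h : R -> R) : Rbar :=
  Rbar_glb (fun s => exists M : R,
    s = Lub_Rbar (fun y => exists r : R, M < r /\ y = h r)).

Definition Theta0 (f : C -> C) : Rbar :=
  Rbar_minus 1 (LimSup_p_infty (fun r => Nbar_zeros f r / nevanlinna_T f r)).

(* Main.v *)
(* With g(z) = f(z+c), w a primitive cube root of unity, u and v proportional to
   g - w f and g - w^2 f (normalised so that u - v = f), and h = g - f, the
   hypothesis says that 3uvh is a linear combination of the derivatives of h.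
   If h, u or v vanishes identically, f has period c or 3c.  Otherwise a growth
   lemma yields arbitrarily large circles on which the logarithmic derivatives
   of u, v, f, h are at most K, where log K is negligible against the mean T of
   log+ max(|u|,|v|).  There |uv| is at most a power of K, and the Wronskian W
   of u and v satisfies |u||W| = |uv||f||v'/v - f'/f|, so T is at most
   mean log|f| - mean log|W| + O(log K).  By Jensen's formula the difference of
   the means is at most Nbar(r,1/f) + O(1), whence T(r,f) <= (1+o(1)) Nbar(r,1/f)
   on these circles and Theta(0,f) <= 0. *)

Require Import Defs.
From Stdlib Require Import Reals List ClassicalEpsilon Lra Lia Psatz Permutation.
From Coquelicot Require Import Coquelicot.

Open Scope R_scope.

(** * Complex continuity and differentiability *)

(** Dividing the equation by h bounds uv once all quotients of derivatives of h by h are bounded.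
    Only first logarithmic derivatives are estimated, but on an annulus around the circle: on a disk
    of radius 1/K, Gronwall's inequality keeps |h| below e times its central value, and Cauchy's
    estimates then give all orders. The same W serves for u and for v, because f = u - v makes the
    Wronskians of (f,v), (f,u) and (u,v) agree. Hence the bound on |W| can always be taken with the
    smaller of |u| and |v|. If W vanished identically, u and v would be proportional, the bound on
    uv would bound both, and T would be O(log K), against the growth lemma. In that lemma a is
    essentially the supremum of log+ max(|u|,|v|) on a disk. Borel's argument finds a disk where a
    is at most squared when the radius is multiplied by exp(1/log a). Then K is a constant times a
    power of a, while T is at least of order a/(log a)^2. A holomorphic logarithm of a Blaschke
    quotient does the work of the Poisson-Jensen formula: at the centre it gives Jensen's formula,
    and its derivative gives the interior bounds. *)

Lemma Cminus_diag (a : C) : (a - a)%C = 0%C.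
Proof. ring. Qed.

Lemma Cmod_sub_sym (a b : C) : Cmod (a - b) = Cmod (b - a).
Proof. rewrite <- Cmod_opp. f_equal. ring. Qed.

Lemma Cmod_triangle_sub (a b : C) : Cmod (a - b) <= Cmod a + Cmod b.
Proof. rewrite <- (Cmod_opp b). apply Cmod_triangle. Qed.

Lemma Cmod_triangle_rev (a b : C) : Cmod a - Cmod b <= Cmod (a - b).
Proof.
  pose proof (Cmod_triangle (a - b) b) as H.
  replace (a - b + b)%C with a in H by ring. lra.
Qed.

Lemma Cmod_le_sum (x y : R) : Cmod (x, y) <= Rabs x + Rabs y.
Proof.
  replace ((x, y) : C) with (RtoC x + Ci * RtoC y)%C
    by (apply injective_projections; simpl; ring).
  eapply Rle_trans; [apply Cmod_triangle|].
  rewrite Cmod_mult, Cmod_Ci, !Cmod_R. lra.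
Qed.

Lemma Cmod_fst (z : C) : Rabs (fst z) <= Cmod z.
Proof. eapply Rle_trans; [apply Rmax_l | apply Rmax_Cmod]. Qed.

Lemma Cmod_snd (z : C) : Rabs (snd z) <= Cmod z.
Proof. eapply Rle_trans; [apply Rmax_r | apply Rmax_Cmod]. Qed.

Lemma ball_Cmod (x y : C) (e : R) : Cmod (y - x) < e -> ball x e y.
Proof. apply C_NormedModule_mixin_compat1. Qed.

(** The uniform structure of [C] is that of a product, so balls are squares and the modulus can
    exceed their radius; the factor 2 comes from adding the two coordinates. *)
Lemma Cmod_ball (x y : C) (e : R) : ball x e y -> Cmod (y - x) < 2 * e.
Proof.
  intros [H1 H2].
  unfold ball in H1, H2; simpl in H1, H2;
    unfold AbsRing_ball, abs, minus, plus, opp in H1, H2; simpl in H1, H2.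
  replace (y - x)%C with ((fst y + - fst x, snd y + - snd x) : C)
    by (apply injective_projections; simpl; ring).
  eapply Rle_lt_trans; [apply Cmod_le_sum | lra].
Qed.

Lemma locally_Cmod (z : C) (P : C -> Prop) :
  locally z P <-> exists d, 0 < d /\ forall w, Cmod (w - z) < d -> P w.
Proof.
  split.
  - intros [d Hd]. exists d; split; [apply cond_pos|].
    intros w Hw. apply Hd. now apply ball_Cmod.
  - intros [d [Hd H]]. exists (mkposreal (d / 2) ltac:(lra)). intros w Hw.
    apply H. apply Cmod_ball in Hw. simpl in Hw. lra.
Qed.

Lemma continuous_into_C {U : UniformSpace} (f : U -> C) (x : U) :
  continuous f x <-> forall e, 0 < e -> locally x (fun y => Cmod (f y - f x) < e).
Proof.
  split.
  - intros H e He. apply (H (fun w => Cmod (w - f x) < e)).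
    apply locally_Cmod. exists e; split; auto.
  - intros H P HP. apply locally_Cmod in HP. destruct HP as [d [Hd HP]].
    unfold filtermap. generalize (H d Hd). apply filter_imp. intros; auto.
Qed.

Lemma continuous_C_eps (f : C -> C) (z : C) :
  continuous f z <-> forall e, 0 < e -> exists d, 0 < d /\
    forall w, Cmod (w - z) < d -> Cmod (f w - f z) < e.
Proof.
  rewrite continuous_into_C. split; intros H e He.
  - now apply locally_Cmod, H.
  - now apply locally_Cmod, H.
Qed.

Lemma continuous_pair {U : UniformSpace} (f g : U -> R) (x : U) :
  continuous f x -> continuous g x -> continuous (fun t => (f t, g t) : C) x.
Proof.
  intros Hf Hg. apply continuous_into_C. intros e He.
  assert (He2 : 0 < e / 2) by lra.
  pose proof (proj1 (filterlim_locally f (f x)) Hf (mkposreal _ He2)) as H1.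
  pose proof (proj1 (filterlim_locally g (g x)) Hg (mkposreal _ He2)) as H2.
  generalize (filter_and _ _ H1 H2). apply filter_imp.
  intros y [Ha Hb].
  unfold ball in Ha, Hb; simpl in Ha, Hb;
    unfold AbsRing_ball, abs, minus, plus, opp in Ha, Hb; simpl in Ha, Hb.
  replace ((f y, g y) - (f x, g x))%C with ((f y + - f x, g y + - g x) : C)
    by (apply injective_projections; simpl; ring).
  eapply Rle_lt_trans; [apply Cmod_le_sum | lra].
Qed.

Lemma continuous_Re {U : UniformSpace} (f : U -> C) (x : U) :
  continuous f x -> continuous (fun t => fst (f t)) x.
Proof. intros H. apply (continuous_comp f fst); [exact H | apply continuous_fst]. Qed.

Lemma continuous_Im {U : UniformSpace} (f : U -> C) (x : U) :
  continuous f x -> continuous (fun t => snd (f t)) x.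
Proof. intros H. apply (continuous_comp f snd); [exact H | apply continuous_snd]. Qed.

Lemma continuous_Rplus {U : UniformSpace} (f g : U -> R) (x : U) :
  continuous f x -> continuous g x -> continuous (fun t => f t + g t) x.
Proof. apply (@continuous_plus U R_AbsRing R_NormedModule). Qed.

Lemma continuous_Ropp {U : UniformSpace} (f : U -> R) (x : U) :
  continuous f x -> continuous (fun t => - f t) x.
Proof. apply (@continuous_opp U R_AbsRing R_NormedModule). Qed.

Lemma continuous_Rmult {U : UniformSpace} (f g : U -> R) (x : U) :
  continuous f x -> continuous g x -> continuous (fun t => f t * g t) x.
Proof. apply (@continuous_mult U R_AbsRing). Qed.

Lemma continuous_Cplus {U : UniformSpace} (f g : U -> C) (x : U) :
  continuous f x -> continuous g x -> continuous (fun t => (f t + g t)%C) x.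
Proof.
  intros Hf Hg. apply continuous_pair; apply continuous_Rplus;
  first [now apply continuous_Re | now apply continuous_Im].
Qed.

Lemma continuous_Copp {U : UniformSpace} (f : U -> C) (x : U) :
  continuous f x -> continuous (fun t => (- f t)%C) x.
Proof.
  intros Hf. apply continuous_pair; apply continuous_Ropp;
  first [now apply continuous_Re | now apply continuous_Im].
Qed.

Lemma continuous_Cminus {U : UniformSpace} (f g : U -> C) (x : U) :
  continuous f x -> continuous g x -> continuous (fun t => (f t - g t)%C) x.
Proof. intros. apply continuous_Cplus; [|apply continuous_Copp]; assumption. Qed.

Lemma continuous_Cmult {U : UniformSpace} (f g : U -> C) (x : U) :
  continuous f x -> continuous g x -> continuous (fun t => (f t * g t)%C) x.
Proof.
  intros Hf Hg. pose proof (continuous_Re _ _ Hf). pose proof (continuous_Im _ _ Hf).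
  pose proof (continuous_Re _ _ Hg). pose proof (continuous_Im _ _ Hg).
  apply continuous_pair; apply continuous_Rplus; try apply continuous_Ropp;
  now apply continuous_Rmult.
Qed.

Lemma continuous_Cpow {U : UniformSpace} (f : U -> C) (n : nat) (x : U) :
  continuous f x -> continuous (fun t => (f t ^ n)%C) x.
Proof.
  intros Hf. induction n as [|n IH]; simpl.
  - apply continuous_const.
  - now apply continuous_Cmult.
Qed.

Lemma continuous_Rinv_comp {U : UniformSpace} (f : U -> R) (x : U) :
  continuous f x -> f x <> 0 -> continuous (fun t => / f t) x.
Proof. intros H H0. apply (continuous_comp f Rinv); [exact H | now apply continuous_Rinv]. Qed.

Lemma continuous_Cinv {U : UniformSpace} (f : U -> C) (x : U) :
  continuous f x -> f x <> 0%C -> continuous (fun t => (/ f t)%C) x.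
Proof.
  intros Hf H0. pose proof (continuous_Re _ _ Hf) as H1.
  pose proof (continuous_Im _ _ Hf) as H2.
  assert (Hd : fst (f x) ^ 2 + snd (f x) ^ 2 <> 0).
  { intros E. apply H0. destruct (f x) as [p q]. simpl in *.
    assert (E1 : p = 0) by nra. assert (E2 : q = 0) by nra. now rewrite E1, E2. }
  assert (Hc : continuous (fun t => / (fst (f t) ^ 2 + snd (f t) ^ 2)) x).
  { apply continuous_Rinv_comp; [|exact Hd]. simpl.
    apply continuous_Rplus; apply continuous_Rmult; trivial;
      apply continuous_Rmult; trivial; apply continuous_const. }
  apply continuous_pair; apply continuous_Rmult; trivial. now apply continuous_Ropp.
Qed.

Lemma continuous_Cdiv {U : UniformSpace} (f g : U -> C) (x : U) :
  continuous f x -> continuous g x -> g x <> 0%C ->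
  continuous (fun t => (f t / g t)%C) x.
Proof. intros. apply continuous_Cmult; [|apply continuous_Cinv]; assumption. Qed.

Lemma continuous_RtoC {U : UniformSpace} (f : U -> R) (x : U) :
  continuous f x -> continuous (fun t => RtoC (f t)) x.
Proof. intros H. apply continuous_pair; [exact H | apply continuous_const]. Qed.

Lemma continuous_Cmod_comp {U : UniformSpace} (f : U -> C) (x : U) :
  continuous f x -> continuous (fun t => Cmod (f t)) x.
Proof.
  intros H. apply filterlim_locally. intros e.
  generalize (proj1 (continuous_into_C f x) H e (cond_pos e)). apply filter_imp.
  intros y Hy. unfold ball; simpl; unfold AbsRing_ball, abs, minus, plus, opp; simpl.
  pose proof (Cmod_triangle_rev (f y) (f x)). pose proof (Cmod_triangle_rev (f x) (f y)).
  rewrite (Cmod_sub_sym (f x)) in *. apply Rabs_def1; lra.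
Qed.

(* Caratheodory's form of complex differentiability: products, inverses and
   compositions need no estimates. *)
Definition Cd (f : C -> C) (z l : C) : Prop :=
  exists p : C -> C, continuous p z /\ p z = l /\
    forall w, f w = (f z + (w - z) * p w)%C.

Lemma Cd_intro (f : C -> C) (z l : C) :
  (forall e, 0 < e -> exists d, 0 < d /\ forall w, Cmod (w - z) < d ->
     Cmod (f w - f z - l * (w - z)) <= e * Cmod (w - z)) -> Cd f z l.
Proof.
  intros H.
  exists (fun w => if Ceq_dec w z then l else ((f w - f z) / (w - z))%C).
  assert (Hz : (if Ceq_dec z z then l else ((f z - f z) / (z - z))%C) = l).
  { destruct (Ceq_dec z z); [reflexivity | congruence]. }
  split; [|split; [exact Hz|]].
  - apply continuous_C_eps. intros e He.
    destruct (H (e / 2)) as [d [Hd Hb]]; [lra|].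
    exists d; split; [exact Hd|]. intros w Hw. rewrite Hz.
    destruct (Ceq_dec w z) as [E|E].
    + now rewrite Cminus_diag, Cmod_0.
    + assert (E' : (w - z)%C <> 0%C).
      { intros E0. apply E. replace w with (w - z + z)%C by ring. rewrite E0; ring. }
      replace ((f w - f z) / (w - z) - l)%C
        with ((f w - f z - l * (w - z)) / (w - z))%C by (field; exact E').
      rewrite Cmod_div by exact E'.
      pose proof (proj1 (Cmod_gt_0 _) E') as Hp.
      apply Rle_lt_trans with (e / 2); [|lra].
      apply Rmult_le_reg_r with (Cmod (w - z)); [exact Hp|].
      unfold Rdiv at 1. rewrite Rmult_assoc, Rinv_l, Rmult_1_r by lra.
      now apply Hb.
  - intros w. destruct (Ceq_dec w z) as [E|E].
    + subst. ring.
    + field. intros E0. apply E. replace w with (w - z + z)%C by ring. rewrite E0; ring.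
Qed.

Lemma Cd_eps (f : C -> C) (z l : C) :
  Cd f z l ->
  forall e, 0 < e -> exists d, 0 < d /\ forall w, Cmod (w - z) < d ->
     Cmod (f w - f z - l * (w - z)) <= e * Cmod (w - z).
Proof.
  intros [p [Hc [Hl Hp]]] e He.
  destruct (proj1 (continuous_C_eps p z) Hc e He) as [d [Hd Hb]].
  exists d; split; [exact Hd|]. intros w Hw. rewrite (Hp w), <- Hl.
  replace (f z + (w - z) * p w - f z - p z * (w - z))%C
    with ((p w - p z) * (w - z))%C by ring.
  rewrite Cmod_mult. apply Rmult_le_compat_r; [apply Cmod_ge_0|].
  apply Rlt_le. now apply Hb.
Qed.

Lemma Cd_continuous (f : C -> C) (z l : C) : Cd f z l -> continuous f z.
Proof.
  intros [p [Hc [Hl Hp]]].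
  apply (continuous_ext (fun w => (f z + (w - z) * p w)%C)); [intros; now rewrite <- Hp|].
  apply continuous_Cplus; [apply continuous_const|].
  apply continuous_Cmult; [|exact Hc].
  apply continuous_Cminus; [apply continuous_id | apply continuous_const].
Qed.

Lemma Cd_ext_loc (f g : C -> C) (z l : C) :
  locally z (fun w => f w = g w) -> Cd f z l -> Cd g z l.
Proof.
  intros Hl Hf. apply locally_Cmod in Hl. destruct Hl as [d0 [Hd0 Heq]].
  apply Cd_intro. intros e He. destruct (Cd_eps _ _ _ Hf e He) as [d [Hd H]].
  exists (Rmin d d0). split; [now apply Rmin_glb_lt|]. intros w Hw.
  rewrite <- !Heq.
  - apply H. eapply Rlt_le_trans; [exact Hw | apply Rmin_l].
  - now rewrite Cminus_diag, Cmod_0.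
  - eapply Rlt_le_trans; [exact Hw | apply Rmin_r].
Qed.

Lemma Cd_ext (f g : C -> C) (z l : C) :
  (forall w, f w = g w) -> Cd f z l -> Cd g z l.
Proof. intros H. apply Cd_ext_loc. now apply filter_forall. Qed.

Lemma Cd_eq (f : C -> C) (z l l' : C) : Cd f z l -> l = l' -> Cd f z l'.
Proof. now intros H <-. Qed.

Lemma Cd_const (c z : C) : Cd (fun _ => c) z 0%C.
Proof.
  exists (fun _ => 0%C). split; [apply continuous_const | split; [reflexivity|]].
  intros; ring.
Qed.

Lemma Cd_id (z : C) : Cd (fun w => w) z 1%C.
Proof.
  exists (fun _ => 1%C). split; [apply continuous_const | split; [reflexivity|]].
  intros; ring.
Qed.

Lemma Cd_plus (f g : C -> C) (z l m : C) :
  Cd f z l -> Cd g z m -> Cd (fun w => (f w + g w)%C) z (l + m)%C.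
Proof.
  intros [p [Hp [Hl Hf]]] [q [Hq [Hm Hg]]].
  exists (fun w => (p w + q w)%C).
  split; [now apply continuous_Cplus | split; [now rewrite Hl, Hm|]].
  intros w. rewrite Hf, Hg. ring.
Qed.

Lemma Cd_mult (f g : C -> C) (z l m : C) :
  Cd f z l -> Cd g z m -> Cd (fun w => (f w * g w)%C) z (l * g z + f z * m)%C.
Proof.
  intros [p [Hp [Hl Hf]]] [q [Hq [Hm Hg]]].
  exists (fun w => (p w * g w + f z * q w)%C). split.
  - apply continuous_Cplus; apply continuous_Cmult; trivial.
    + apply Cd_continuous with m. now exists q.
    + apply continuous_const.
  - split; [now rewrite Hl, Hm|]. intros w. rewrite Hf.
    rewrite (Hg w). ring.
Qed.

Lemma Cd_scal (c : C) (f : C -> C) (z l : C) :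
  Cd f z l -> Cd (fun w => (c * f w)%C) z (c * l)%C.
Proof.
  intros H. eapply Cd_eq; [apply (Cd_mult _ _ _ _ _ (Cd_const c z) H) | ring].
Qed.

Lemma Cd_opp (f : C -> C) (z l : C) : Cd f z l -> Cd (fun w => (- f w)%C) z (- l)%C.
Proof.
  intros H. apply Cd_ext with (fun w => (- (1) * f w)%C); [intros; ring|].
  eapply Cd_eq; [apply (Cd_scal _ _ _ _ H) | ring].
Qed.

Lemma Cd_minus (f g : C -> C) (z l m : C) :
  Cd f z l -> Cd g z m -> Cd (fun w => (f w - g w)%C) z (l - m)%C.
Proof. intros Hf Hg. apply (Cd_plus _ _ _ _ _ Hf (Cd_opp _ _ _ Hg)). Qed.

Lemma Cd_inv (f : C -> C) (z l : C) :
  Cd f z l -> f z <> 0%C -> Cd (fun w => (/ f w)%C) z (- l / (f z * f z))%C.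
Proof.
  intros Hf H0. pose proof (Cd_continuous _ _ _ Hf) as Hcf.
  assert (Hn : locally z (fun w => f w <> 0%C)).
  { apply locally_Cmod.
    destruct (proj1 (continuous_C_eps f z) Hcf (Cmod (f z))) as [d [Hd H]].
    { now apply Cmod_gt_0. }
    exists d; split; [exact Hd|]. intros w Hw E. specialize (H w Hw). rewrite E in H.
    rewrite Cmod_sub_sym in H. replace (f z - 0)%C with (f z) in H by ring. lra. }
  destruct Hf as [p [Hp [Hl Hf]]].
  (* The slope identity for [/ f] needs [f w <> 0], which holds only near [z]. The function defined
     everywhere by that identity is differentiated instead. *)
  apply Cd_ext_loc with (fun w => (/ f z + (w - z) * (- p w / (f w * f z)))%C).
  { generalize Hn. apply filter_imp. intros w Hw.
    replace (/ f z + (w - z) * (- p w / (f w * f z)))%C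
      with ((f w - (w - z) * p w) / (f w * f z))%C by (field; now split).
    rewrite (Hf w) at 1. rewrite (Hf w) in Hw |- *. field. now split. }
  exists (fun w => (- p w / (f w * f z))%C). split; [|split].
  - apply continuous_Cdiv.
    + now apply continuous_Copp.
    + apply continuous_Cmult; [exact Hcf | apply continuous_const].
    + now apply Cmult_neq_0.
  - now rewrite Hl.
  - intros w. rewrite Cminus_diag. ring.
Qed.

Lemma Cd_comp (f g : C -> C) (z l m : C) :
  Cd g z m -> Cd f (g z) l -> Cd (fun w => f (g w)) z (l * m)%C.
Proof.
  intros Hg [p [Hp [Hl Hf]]]. pose proof (Cd_continuous _ _ _ Hg) as Hcg.
  destruct Hg as [q [Hq [Hm Hg]]].
  exists (fun w => (p (g w) * q w)%C). split; [|split].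
  - apply continuous_Cmult; [|exact Hq]. now apply (continuous_comp g p).
  - now rewrite Hl, Hm.
  - intros w. rewrite (Hf (g w)). rewrite (Hg w) at 1. ring.
Qed.

Lemma Cd_pow (n : nat) (z : C) : Cd (fun w => (w ^ S n)%C) z (INR (S n) * z ^ n)%C.
Proof.
  induction n as [|n IH].
  - apply Cd_ext with (fun w => w); [intros; simpl; ring|].
    eapply Cd_eq; [apply Cd_id | simpl; ring].
  - eapply Cd_eq; [apply (Cd_mult _ _ _ _ _ (Cd_id z) IH)|].
    rewrite (S_INR (S n)), RtoC_plus. change (z ^ S n)%C with (z * z ^ n)%C. ring.
Qed.

Lemma Cd_unique (f : C -> C) (z l m : C) : Cd f z l -> Cd f z m -> l = m.
Proof.
  intros H1 H2. apply Ceq_minus. apply Cmod_eq_0.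
  apply Rle_antisym; [|apply Cmod_ge_0]. apply Rnot_lt_le. intros H.
  set (e := Cmod (l - m)) in *.
  destruct (Cd_eps _ _ _ H1 (e / 3)) as [d1 [Hd1 B1]]; [lra|].
  destruct (Cd_eps _ _ _ H2 (e / 3)) as [d2 [Hd2 B2]]; [lra|].
  pose proof (Rmin_glb_lt _ _ _ Hd1 Hd2) as Hd.
  set (d := Rmin d1 d2) in *.
  assert (Ew : Cmod (z + RtoC (d / 2) - z) = d / 2).
  { replace (z + RtoC (d / 2) - z)%C with (RtoC (d / 2)) by ring.
    rewrite Cmod_R, Rabs_pos_eq; lra. }
  assert (d <= d1) by apply Rmin_l. assert (d <= d2) by apply Rmin_r.
  specialize (B1 (z + RtoC (d / 2))%C ltac:(lra)).
  specialize (B2 (z + RtoC (d / 2))%C ltac:(lra)).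
  set (w := (z + RtoC (d / 2))%C) in *.
  assert (E : Cmod ((l - m) * (w - z)) <= 2 * (e / 3) * Cmod (w - z)).
  { replace ((l - m) * (w - z))%C with
      ((f w - f z - m * (w - z)) - (f w - f z - l * (w - z)))%C by ring.
    eapply Rle_trans; [apply Cmod_triangle_sub | lra]. }
  rewrite Cmod_mult, Ew in E. fold e in E. nra.
Qed.

(** [C] carries two uniform structures, the product one and the one of its absolute value;
    [locally_C] moves between them. *)
Lemma is_derive_Cd (f : C -> C) (z l : C) :
  is_derive (K := C_AbsRing) (V := C_NormedModule) f z l <-> Cd f z l.
Proof.
  split.
  - intros [_ H]. apply Cd_intro. intros e He.
    specialize (H z (fun P HP => HP) (mkposreal e He)).
    apply locally_C in H. apply locally_Cmod in H. destruct H as [d [Hd H]].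
    exists d; split; [exact Hd|]. intros w Hw. specialize (H w Hw).
    unfold minus, plus, opp, scal, norm in H; simpl in H.
    unfold mult in H; simpl in H.
    replace (f w - f z - l * (w - z))%C
      with (f w + - f z + - ((w + - z) * l))%C by ring.
    exact H.
  - intros H. split; [apply is_linear_scal_l|].
    intros x Hx.
    apply (@is_filter_lim_locally_unique C_AbsRing (AbsRing_NormedModule C_AbsRing)) in Hx.
    subst x.
    intros e. apply locally_C. apply locally_Cmod.
    destruct (Cd_eps _ _ _ H e (cond_pos e)) as [d [Hd B]].
    exists d; split; [exact Hd|]. intros w Hw. specialize (B w Hw).
    unfold minus, plus, opp, scal, norm; simpl. unfold mult; simpl.
    replace (f w + - f z + - ((w + - z) * l))%C
      with (f w - f z - l * (w - z))%C by ring.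
    exact B.
Qed.

Lemma Cd_C_derive (f : C -> C) (z l : C) : Cd f z l -> C_derive f z = l.
Proof. intros H. apply is_C_derive_unique. now apply is_derive_Cd. Qed.

(** * Integrals of complex-valued functions *)

(** Caratheodory's form again, now for paths: the chain rule [Rd_Cd] is then a substitution of one
    slope function into the other. *)
Definition Rd (g : R -> C) (t : R) (v : C) : Prop :=
  exists p : R -> C, continuous p t /\ p t = v /\
    forall s, g s = (g t + RtoC (s - t) * p s)%C.

Lemma is_derive_caratheodory (x : R -> R) (t l : R) :
  is_derive x t l -> exists p : R -> R, continuous p t /\ p t = l /\
    forall s, x s = x t + (s - t) * p s.
Proof.
  intros H. apply is_derive_Reals in H.
  exists (fun s => if Req_EM_T s t then l else (x s - x t) / (s - t)).
  assert (Ht : (if Req_EM_T t t then l else (x t - x t) / (t - t)) = l).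
  { destruct (Req_EM_T t t); [reflexivity | congruence]. }
  split; [|split; [exact Ht|]].
  - apply filterlim_locally. intros e. destruct (H e (cond_pos e)) as [d Hd].
    exists d. intros s Hs. rewrite Ht.
    unfold ball in *; simpl in *. unfold AbsRing_ball, abs, minus, plus, opp in *; simpl in *.
    destruct (Req_EM_T s t) as [E|E].
    + rewrite Rplus_opp_r, Rabs_R0. apply cond_pos.
    + specialize (Hd (s - t) ltac:(lra) Hs).
      replace (t + (s - t)) with s in Hd by ring. exact Hd.
  - intros s. destruct (Req_EM_T s t) as [E|E]; [subst; ring | field; lra].
Qed.

Lemma caratheodory_is_derive (x p : R -> R) (t : R) :
  continuous p t -> (forall s, x s = x t + (s - t) * p s) -> is_derive x t (p t).
Proof.
  intros Hc Hx. apply is_derive_Reals. intros e He.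
  pose proof (proj1 (filterlim_locally p (p t)) Hc (mkposreal e He)) as [d Hd].
  exists d. intros h Hh0 Hh. specialize (Hd (t + h)).
  rewrite (Hx (t + h)).
  replace ((x t + (t + h - t) * p (t + h) - x t) / h) with (p (t + h)) by (field; exact Hh0).
  unfold ball in Hd; simpl in Hd. unfold AbsRing_ball, abs, minus, plus, opp in Hd; simpl in Hd.
  apply Hd. now replace (t + h + - t) with h by ring.
Qed.

Lemma Rd_pair (x y : R -> R) (t a b : R) :
  is_derive x t a -> is_derive y t b -> Rd (fun s => (x s, y s)) t (a, b).
Proof.
  intros Hx Hy.
  destruct (is_derive_caratheodory _ _ _ Hx) as [p [Hp [Ep Fp]]].
  destruct (is_derive_caratheodory _ _ _ Hy) as [q [Hq [Eq Fq]]].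
  exists (fun s => (p s, q s)). split; [now apply continuous_pair|].
  split; [now rewrite Ep, Eq|]. intros s. rewrite (Fp s), (Fq s).
  apply injective_projections; simpl; ring.
Qed.

Lemma Rd_Re (g : R -> C) (t : R) (v : C) : Rd g t v -> is_derive (fun s => fst (g s)) t (fst v).
Proof.
  intros [p [Hp [<- Hg]]].
  apply (caratheodory_is_derive (fun s => fst (g s)) (fun s => fst (p s))).
  - now apply continuous_Re.
  - intros s. rewrite (Hg s). simpl. ring.
Qed.

Lemma Rd_Im (g : R -> C) (t : R) (v : C) : Rd g t v -> is_derive (fun s => snd (g s)) t (snd v).
Proof.
  intros [p [Hp [<- Hg]]].
  apply (caratheodory_is_derive (fun s => snd (g s)) (fun s => snd (p s))).
  - now apply continuous_Im.
  - intros s. rewrite (Hg s). simpl. ring.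
Qed.

Lemma Rd_eq (g : R -> C) (t : R) (v v' : C) : Rd g t v -> v = v' -> Rd g t v'.
Proof. now intros H <-. Qed.

Lemma Rd_continuous (g : R -> C) (t : R) (v : C) : Rd g t v -> continuous g t.
Proof.
  intros [p [Hc [Hl Hp]]].
  apply (continuous_ext (fun s => (g t + RtoC (s - t) * p s)%C)); [intros; now rewrite <- Hp|].
  apply continuous_Cplus; [apply continuous_const|].
  apply continuous_Cmult; [|exact Hc]. apply continuous_RtoC.
  apply (@continuous_minus _ R_AbsRing R_NormedModule);
    [apply continuous_id | apply continuous_const].
Qed.

Lemma Rd_const (c : C) (t : R) : Rd (fun _ => c) t 0%C.
Proof.
  exists (fun _ => 0%C). split; [apply continuous_const | split; [reflexivity|]].
  intros; ring.
Qed.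

Lemma Rd_RtoC (t : R) : Rd RtoC t 1%C.
Proof.
  exists (fun _ => 1%C). split; [apply continuous_const | split; [reflexivity|]].
  intros s. rewrite RtoC_minus. ring.
Qed.

Lemma Rd_plus (f g : R -> C) (t : R) (v w : C) :
  Rd f t v -> Rd g t w -> Rd (fun s => (f s + g s)%C) t (v + w)%C.
Proof.
  intros [p [Hp [Hl Hf]]] [q [Hq [Hm Hg]]].
  exists (fun w => (p w + q w)%C).
  split; [now apply continuous_Cplus | split; [now rewrite Hl, Hm|]].
  intros s. rewrite Hf, Hg. ring.
Qed.

Lemma Rd_mult (f g : R -> C) (t : R) (v w : C) :
  Rd f t v -> Rd g t w -> Rd (fun s => (f s * g s)%C) t (v * g t + f t * w)%C.
Proof.
  intros [p [Hp [Hl Hf]]] [q [Hq [Hm Hg]]].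
  exists (fun s => (p s * g s + f t * q s)%C). split.
  - apply continuous_Cplus; apply continuous_Cmult; trivial.
    + apply Rd_continuous with w. now exists q.
    + apply continuous_const.
  - split; [now rewrite Hl, Hm|]. intros s. rewrite Hf.
    rewrite (Hg s). ring.
Qed.

Lemma Rd_Cd (f : C -> C) (g : R -> C) (t : R) (l v : C) :
  Cd f (g t) l -> Rd g t v -> Rd (fun s => f (g s)) t (l * v)%C.
Proof.
  intros [p [Hp [Hl Hf]]] Hg. pose proof (Rd_continuous _ _ _ Hg) as Hcg.
  destruct Hg as [q [Hq [Hm Hg]]].
  exists (fun s => (p (g s) * q s)%C). split; [|split].
  - apply continuous_Cmult; [|exact Hq]. now apply (continuous_comp g p).
  - now rewrite Hl, Hm.
  - intros s. rewrite (Hf (g s)). rewrite (Hg s) at 1. ring.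
Qed.

Lemma Rd_segment (z w : C) (t : R) : Rd (fun s => (z + RtoC s * w)%C) t w.
Proof.
  eapply Rd_eq; [apply Rd_plus; [apply Rd_const |
    apply Rd_mult; [apply Rd_RtoC | apply Rd_const]] | cbv beta; ring].
Qed.

(** Real and imaginary parts are integrated separately, so that linearity, Chasles' relation and the
    fundamental theorem are inherited from real integrals. *)
Definition CInt (f : R -> C) (a b : R) : C :=
  (RInt (fun t => fst (f t)) a b, RInt (fun t => snd (f t)) a b).

Definition cont_on (f : R -> C) (a b : R) : Prop :=
  forall t, Rmin a b <= t <= Rmax a b -> continuous f t.

Lemma cont_on_Re (f : R -> C) (a b : R) :
  cont_on f a b -> ex_RInt (fun t => fst (f t)) a b.
Proof.
  intros H. apply (@ex_RInt_continuous R_CompleteNormedModule).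
  intros t Ht. now apply continuous_Re, H.
Qed.

Lemma cont_on_Im (f : R -> C) (a b : R) :
  cont_on f a b -> ex_RInt (fun t => snd (f t)) a b.
Proof.
  intros H. apply (@ex_RInt_continuous R_CompleteNormedModule).
  intros t Ht. now apply continuous_Im, H.
Qed.

(** The link to the vector-valued integral, whose norm inequality bounds the modulus with constant
    1; bounds on the two components would lose a factor. *)
Lemma is_RInt_CInt (f : R -> C) (a b : R) :
  cont_on f a b -> is_RInt (V := C_R_NormedModule) f a b (CInt f a b).
Proof.
  intros H. apply (@is_RInt_fct_extend_pair R_NormedModule R_NormedModule).
  - apply (@RInt_correct R_CompleteNormedModule). now apply cont_on_Re.
  - apply (@RInt_correct R_CompleteNormedModule). now apply cont_on_Im.
Qed.

Lemma CInt_ext (f g : R -> C) (a b : R) :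
  (forall t, Rmin a b < t < Rmax a b -> f t = g t) -> CInt f a b = CInt g a b.
Proof.
  intros H. unfold CInt.
  f_equal; apply (@RInt_ext R_CompleteNormedModule); intros t Ht; now rewrite H.
Qed.

Lemma CInt_plus (f g : R -> C) (a b : R) :
  cont_on f a b -> cont_on g a b ->
  CInt (fun t => (f t + g t)%C) a b = (CInt f a b + CInt g a b)%C.
Proof.
  intros Hf Hg. unfold CInt, Cplus. simpl. f_equal.
  - apply (@RInt_plus R_CompleteNormedModule); now apply cont_on_Re.
  - apply (@RInt_plus R_CompleteNormedModule); now apply cont_on_Im.
Qed.

Lemma CInt_scal (c : C) (f : R -> C) (a b : R) :
  cont_on f a b -> CInt (fun t => (c * f t)%C) a b = (c * CInt f a b)%C.
Proof.
  intros Hf. pose proof (cont_on_Re _ _ _ Hf) as H1. pose proof (cont_on_Im _ _ _ Hf) as H2.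
  assert (S : forall k (x : R -> R), ex_RInt x a b -> RInt (fun t => k * x t) a b = k * RInt x a b).
  { intros k x Hx. apply (@RInt_scal R_CompleteNormedModule). exact Hx. }
  assert (E : forall k (x : R -> R), ex_RInt x a b -> ex_RInt (fun t => k * x t) a b).
  { intros k x Hx. apply (@ex_RInt_scal R_CompleteNormedModule). exact Hx. }
  destruct c as [c1 c2]. unfold CInt, Cmult; simpl. f_equal.
  - rewrite <- !S by assumption.
    apply (@RInt_minus R_CompleteNormedModule (fun t => c1 * fst (f t)) (fun t => c2 * snd (f t)));
      now apply E.
  - rewrite <- !S by assumption.
    apply (@RInt_plus R_CompleteNormedModule (fun t => c1 * snd (f t)) (fun t => c2 * fst (f t)));
      now apply E.
Qed.

Lemma cont_on_scal (c : C) (f : R -> C) (a b : R) :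
  cont_on f a b -> cont_on (fun t => (c * f t)%C) a b.
Proof.
  intros H t Ht. apply continuous_Cmult; [apply continuous_const | now apply H].
Qed.

Lemma CInt_minus (f g : R -> C) (a b : R) :
  cont_on f a b -> cont_on g a b ->
  CInt (fun t => (f t - g t)%C) a b = (CInt f a b - CInt g a b)%C.
Proof.
  intros Hf Hg. rewrite (CInt_ext _ (fun t => (f t + (-(1)) * g t)%C)) by (intros; ring).
  rewrite CInt_plus, CInt_scal; trivial; [ring | now apply cont_on_scal].
Qed.

Lemma CInt_Chasles (f : R -> C) (a b c : R) :
  cont_on f a b -> cont_on f b c -> CInt f a c = (CInt f a b + CInt f b c)%C.
Proof.
  intros H1 H2. unfold CInt, Cplus; simpl. f_equal; symmetry.
  - apply (@RInt_Chasles R_CompleteNormedModule (fun t => fst (f t))); now apply cont_on_Re.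
  - apply (@RInt_Chasles R_CompleteNormedModule (fun t => snd (f t))); now apply cont_on_Im.
Qed.

Lemma CInt_swap (f : R -> C) (a b : R) : cont_on f a b -> CInt f b a = (- CInt f a b)%C.
Proof.
  intros H. unfold CInt, Copp; simpl.
  f_equal; symmetry.
  - apply (@opp_RInt_swap R_CompleteNormedModule (fun t => fst (f t))); now apply cont_on_Re.
  - apply (@opp_RInt_swap R_CompleteNormedModule (fun t => snd (f t))); now apply cont_on_Im.
Qed.

Lemma CInt_norm_RInt (f : R -> C) (g : R -> R) (a b : R) :
  a <= b -> cont_on f a b -> ex_RInt g a b ->
  (forall t, a <= t <= b -> Cmod (f t) <= g t) -> Cmod (CInt f a b) <= RInt g a b.
Proof.
  intros Hab Hf Hg H. rewrite Cmod_norm.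
  apply (@norm_RInt_le C_R_NormedModule f g a b).
  - exact Hab.
  - intros t Ht. specialize (H t Ht). now rewrite Cmod_norm in H.
  - now apply is_RInt_CInt.
  - now apply (@RInt_correct R_CompleteNormedModule).
Qed.

Lemma CInt_bound (f : R -> C) (a b M : R) :
  a <= b -> cont_on f a b -> (forall t, a <= t <= b -> Cmod (f t) <= M) ->
  Cmod (CInt f a b) <= M * (b - a).
Proof.
  intros Hab Hf H. replace (M * (b - a)) with (RInt (fun _ => M) a b).
  - apply CInt_norm_RInt; trivial. apply ex_RInt_const.
  - rewrite (@RInt_const R_CompleteNormedModule). unfold scal; simpl. unfold mult; simpl. ring.
Qed.

Lemma CInt_bound_abs (f : R -> C) (a b M : R) :
  cont_on f a b -> (forall t, Rmin a b <= t <= Rmax a b -> Cmod (f t) <= M) ->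
  Cmod (CInt f a b) <= M * Rabs (b - a).
Proof.
  intros Hf H. destruct (Rle_dec a b) as [Hab|Hab].
  - rewrite Rabs_pos_eq by lra. apply CInt_bound; trivial.
    intros t Ht. apply H. now rewrite Rmin_left, Rmax_right.
  - assert (Hba : b <= a) by lra.
    assert (Hf' : cont_on f b a).
    { intros t. rewrite Rmin_comm, Rmax_comm. apply Hf. }
    rewrite CInt_swap by exact Hf'. rewrite Cmod_opp, Rabs_minus_sym, Rabs_pos_eq by lra.
    apply CInt_bound; trivial.
    intros t Ht. apply H. now rewrite Rmin_right, Rmax_left.
Qed.

Lemma CInt_FTC (g g' : R -> C) (a b : R) :
  (forall t, Rmin a b <= t <= Rmax a b -> Rd g t (g' t)) -> cont_on g' a b ->
  CInt g' a b = (g b - g a)%C.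
Proof.
  intros Hd Hc. unfold CInt.
  replace (g b - g a)%C with
    (minus (fst (g b)) (fst (g a)), minus (snd (g b)) (snd (g a)))
    by (apply injective_projections; reflexivity).
  f_equal; apply (@is_RInt_unique R_CompleteNormedModule).
  - apply (is_RInt_derive (V := R_CompleteNormedModule) (fun t => fst (g t)) (fun t => fst (g' t)));
      intros t Ht; [now apply Rd_Re, Hd | now apply continuous_Re, Hc].
  - apply (is_RInt_derive (V := R_CompleteNormedModule) (fun t => snd (g t)) (fun t => snd (g' t)));
      intros t Ht; [now apply Rd_Im, Hd | now apply continuous_Im, Hc].
Qed.

Lemma Rd_zero_const (g : R -> C) (a b : R) :
  a < b -> (forall t, a <= t <= b -> Rd g t 0%C) -> g a = g b.
Proof.
  intros Hab H. apply injective_projections.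
  - apply (@eq_is_derive R_NormedModule (fun t => fst (g t))); trivial.
    intros t Ht. apply (Rd_Re g t 0%C). now apply H.
  - apply (@eq_is_derive R_NormedModule (fun t => snd (g t))); trivial.
    intros t Ht. apply (Rd_Im g t 0%C). now apply H.
Qed.

(** Subtracting [l] times the variable leaves a function with small derivative on the segment from
    [z] to [w]. The real mean value bound is applied to its real and to its imaginary part, whence
    the factor 2. *)
Lemma Cd_mean_value (g g' : C -> C) (z l : C) (rho e : R) :
  (forall w, Cmod (w - z) < rho -> Cd g w (g' w) /\ Cmod (g' w - l) <= e) ->
  forall w, Cmod (w - z) < rho -> Cmod (g w - g z - l * (w - z)) <= 2 * e * Cmod (w - z).
Proof.
  intros H w Hw.
  set (k := fun s : R => (g (z + RtoC s * (w - z)) + - l * (z + RtoC s * (w - z)))%C).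
  assert (Hk : forall t, Rabs (t - 0) <= Rabs (1 - 0) ->
    Rd k t ((g' (z + RtoC t * (w - z)) - l) * (w - z))%C /\
    Cmod ((g' (z + RtoC t * (w - z)) - l) * (w - z))%C <= e * Cmod (w - z)).
  { intros t Ht. replace (1 - 0) with 1 in Ht by ring. rewrite Rabs_R1, Rminus_0_r in Ht.
    assert (Hb : Cmod (z + RtoC t * (w - z) - z) < rho).
    { replace (z + RtoC t * (w - z) - z)%C with (RtoC t * (w - z))%C by ring.
      rewrite Cmod_mult, Cmod_R. pose proof (Cmod_ge_0 (w - z)). nra. }
    destruct (H _ Hb) as [Hd He]. split.
    - eapply Rd_eq; [apply Rd_plus|].
      + apply (Rd_Cd g); [exact Hd | apply Rd_segment].
      + apply Rd_mult; [apply Rd_const | apply Rd_segment].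
      + cbv beta. ring.
    - rewrite Cmod_mult. apply Rmult_le_compat_r; [apply Cmod_ge_0 | exact He]. }
  replace (g w - g z - l * (w - z))%C with (k 1 - k 0)%C.
  2:{ unfold k. replace (z + 1 * (w - z))%C with w by ring.
      replace (z + 0 * (w - z))%C with z by ring. ring. }
  set (D := e * Cmod (w - z)) in *.
  assert (H1 : Rabs (fst (k 1) - fst (k 0)) <= D * Rabs (1 - 0)).
  { apply (bounded_variation (fun s => fst (k s)) (fun t => fst ((g' (z + RtoC t * (w - z)) - l) * (w - z))%C)).
    intros t Ht. destruct (Hk t Ht) as [Ha Hb]. split; [now apply Rd_Re|].
    eapply Rle_trans; [apply Cmod_fst | exact Hb]. }
  assert (H2 : Rabs (snd (k 1) - snd (k 0)) <= D * Rabs (1 - 0)).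
  { apply (bounded_variation (fun s => snd (k s)) (fun t => snd ((g' (z + RtoC t * (w - z)) - l) * (w - z))%C)).
    intros t Ht. destruct (Hk t Ht) as [Ha Hb]. split; [now apply Rd_Im|].
    eapply Rle_trans; [apply Cmod_snd | exact Hb]. }
  replace (Rabs (1 - 0)) with 1 in H1, H2 by (rewrite Rminus_0_r, Rabs_R1; reflexivity).
  replace (k 1 - k 0)%C with ((fst (k 1) - fst (k 0), snd (k 1) - snd (k 0)) : C)
    by (apply injective_projections; simpl; ring).
  eapply Rle_trans; [apply Cmod_le_sum | unfold D in *; lra].
Qed.

(** A tube lemma: each [t] has its own radius, and compactness of the interval provides a common
    one. *)
Lemma joint_continuity_uniform (P : R -> C -> C) (a b : R) (z : C) :
  (forall t, a <= t <= b -> continuous (fun p : R * C => P (fst p) (snd p)) (t, z)) ->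
  forall e, 0 < e -> exists d, 0 < d /\ forall t w, a <= t <= b -> Cmod (w - z) < d ->
    Cmod (P t w - P t z) < e.
Proof.
  intros Hc e He.
  assert (Hl : forall t, exists d : posreal, a <= t <= b ->
     forall s w, Rabs (s - t) < d -> Cmod (w - z) < d -> Cmod (P s w - P t z) < e / 2).
  { intros t. destruct (Rle_dec a t) as [H1|H1].
    2:{ exists (mkposreal 1 Rlt_0_1). intros; lra. }
    destruct (Rle_dec t b) as [H2|H2].
    2:{ exists (mkposreal 1 Rlt_0_1). intros; lra. }
    pose proof (proj1 (continuous_into_C _ _) (Hc t (conj H1 H2)) (e / 2) ltac:(lra)) as [d Hd].
    exists d. intros _ s w Hs Hw. apply (Hd (s, w)). split; simpl.
    - exact Hs.
    - now apply ball_Cmod. }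
  set (del := fun t => proj1_sig (constructive_indefinite_description _ (Hl t))).
  assert (Hdel : forall t, a <= t <= b ->
     forall s w, Rabs (s - t) < del t -> Cmod (w - z) < del t -> Cmod (P s w - P t z) < e / 2).
  { intros t. unfold del. now destruct (constructive_indefinite_description _ (Hl t)). }
  destruct (compactness_value_1d a b del) as [d Hd].
  exists d. split; [apply cond_pos|]. intros s w Hs Hw.
  (* The compactness principle gives the nearby centre [t] only under a double negation, which is
     harmless for an inequality. *)
  apply Rnot_le_lt. intros Hn. apply (Hd s Hs). intros [t [Ht [H1 H2]]].
  assert (A1 : Cmod (P s w - P t z) < e / 2) by (apply Hdel; trivial; lra).
  assert (A2 : Cmod (P s z - P t z) < e / 2).
  { apply Hdel; trivial. rewrite Cminus_diag, Cmod_0. apply cond_pos. }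
  assert (Cmod (P s w - P s z) < e); [|lra].
  replace (P s w - P s z)%C with ((P s w - P t z) - (P s z - P t z))%C by ring.
  eapply Rle_lt_trans; [apply Cmod_triangle_sub | lra].
Qed.

Lemma continuous_section {U : UniformSpace} (P : R -> C -> U) (t : R) (z : C) :
  continuous (fun p : R * C => P (fst p) (snd p)) (t, z) -> continuous (fun s => P s z) t.
Proof.
  intros H. apply (continuous_comp (fun s : R => (s, z)) (fun p => P (fst p) (snd p))); [|exact H].
  apply filterlim_locally. intros e. exists e. intros s Hs. split; [exact Hs | apply ball_center].
Qed.

(** Differentiation under the integral sign: the remainder of the integrand is small by
    [Cd_mean_value], uniformly in [t] because [P'] is jointly continuous along the slice at [z]. *)
Lemma Cd_CInt_param (P P' : R -> C -> C) (a b rho : R) (z : C) :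
  a <= b -> 0 < rho ->
  (forall t w, a <= t <= b -> Cmod (w - z) < rho -> Cd (P t) w (P' t w)) ->
  (forall t w, a <= t <= b -> Cmod (w - z) < rho -> continuous (fun s => P s w) t) ->
  (forall t, a <= t <= b -> continuous (fun p : R * C => P' (fst p) (snd p)) (t, z)) ->
  Cd (fun w => CInt (fun t => P t w) a b) z (CInt (fun t => P' t z) a b).
Proof.
  intros Hab Hrho Hd Hc Hj. apply Cd_intro. intros e He.
  assert (HD : 0 < b - a + 1) by lra.
  (* The 2 absorbs the factor of [Cd_mean_value]; the [+ 1] keeps the denominator positive when
     [a = b]. *)
  assert (He' : 0 < e / (2 * (b - a + 1))) by (apply Rdiv_lt_0_compat; lra).
  destruct (joint_continuity_uniform _ _ _ _ Hj _ He') as [d [Hd0 Hu]].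
  exists (Rmin d rho). split; [now apply Rmin_glb_lt|]. intros w Hw.
  assert (Hw1 : Cmod (w - z) < d) by (eapply Rlt_le_trans; [exact Hw | apply Rmin_l]).
  assert (Hw2 : Cmod (w - z) < rho) by (eapply Rlt_le_trans; [exact Hw | apply Rmin_r]).
  assert (Hz : Cmod (z - z) < rho) by (rewrite Cminus_diag, Cmod_0; exact Hrho).
  assert (C1 : cont_on (fun t => P t w) a b).
  { intros t Ht. rewrite Rmin_left, Rmax_right in Ht by lra. now apply Hc. }
  assert (C2 : cont_on (fun t => P t z) a b).
  { intros t Ht. rewrite Rmin_left, Rmax_right in Ht by lra. now apply Hc. }
  assert (C3 : cont_on (fun t => P' t z) a b).
  { intros t Ht. rewrite Rmin_left, Rmax_right in Ht by lra.
    apply (continuous_section P'). now apply Hj. }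
  assert (C4 : cont_on (fun t => (- (w - z)) * P' t z)%C a b) by now apply cont_on_scal.
  assert (E : (CInt (fun t => P t w) a b - CInt (fun t => P t z) a b
               - CInt (fun t => P' t z) a b * (w - z))%C
    = CInt (fun t => ((P t w - P t z) + (- (w - z)) * P' t z)%C) a b).
  { rewrite CInt_plus, CInt_minus, CInt_scal; trivial; [ring|].
    intros t Ht. apply continuous_Cminus; [now apply C1 | now apply C2]. }
  rewrite E. clear E.
  eapply Rle_trans.
  - apply (CInt_bound _ a b (2 * (e / (2 * (b - a + 1))) * Cmod (w - z))); trivial.
    + intros t Ht. apply continuous_Cplus; [|now apply C4].
      apply continuous_Cminus; [now apply C1 | now apply C2].
    + intros t Ht.
      replace (P t w - P t z + - (w - z) * P' t z)%C
        with (P t w - P t z - P' t z * (w - z))%C by ring.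
      apply (Cd_mean_value (P t) (P' t) z (P' t z) (Rmin d rho)); trivial.
      intros x Hx. split.
      * apply Hd; trivial. eapply Rlt_le_trans; [exact Hx | apply Rmin_r].
      * apply Rlt_le, Hu; trivial. eapply Rlt_le_trans; [exact Hx | apply Rmin_l].
  - pose proof (Cmod_ge_0 (w - z)) as Hm.
    replace (2 * (e / (2 * (b - a + 1))) * Cmod (w - z) * (b - a))
      with (e * Cmod (w - z) * ((b - a) / (b - a + 1))) by (field; lra).
    rewrite <- (Rmult_1_r (e * Cmod (w - z))) at 2.
    apply Rmult_le_compat_l; [nra|].
    apply Rmult_le_reg_r with (b - a + 1); [exact HD|].
    unfold Rdiv. rewrite Rmult_assoc, Rinv_l by lra. lra.
Qed.

(** * Goursat's theorem *)

(** The integral of f(z) dz counterclockwise around the rectangle; [Ci] is dz/dt on the vertical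
    sides. *)
Definition rect (f : C -> C) (x0 x1 y0 y1 : R) : C :=
  (CInt (fun s => f (s, y0)) x0 x1 + Ci * CInt (fun t => f (x1, t)) y0 y1
   - CInt (fun s => f (s, y1)) x0 x1 - Ci * CInt (fun t => f (x0, t)) y0 y1)%C.

Lemma continuous_horizontal (f : C -> C) (y s : R) :
  (forall z, continuous f z) -> continuous (fun s => f (s, y)) s.
Proof.
  intros H. apply (continuous_comp (fun s => (s, y) : C) f); [|apply H].
  apply continuous_pair; [apply continuous_id | apply continuous_const].
Qed.

Lemma continuous_vertical (f : C -> C) (x t : R) :
  (forall z, continuous f z) -> continuous (fun t => f (x, t)) t.
Proof.
  intros H. apply (continuous_comp (fun t => (x, t) : C) f); [|apply H].
  apply continuous_pair; [apply continuous_const | apply continuous_id].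
Qed.

Lemma rect_ext (f g : C -> C) (x0 x1 y0 y1 : R) :
  (forall z, f z = g z) -> rect f x0 x1 y0 y1 = rect g x0 x1 y0 y1.
Proof.
  intros E. unfold rect.
  rewrite (CInt_ext (fun s => f (s, y0)) (fun s => g (s, y0))),
    (CInt_ext (fun s => f (s, y1)) (fun s => g (s, y1))),
    (CInt_ext (fun s => f (x0, s)) (fun s => g (x0, s))),
    (CInt_ext (fun s => f (x1, s)) (fun s => g (x1, s)));
    [reflexivity | intros; apply E ..].
Qed.

Lemma rect_plus (f g : C -> C) (x0 x1 y0 y1 : R) :
  (forall z, continuous f z) -> (forall z, continuous g z) ->
  rect (fun z => (f z + g z)%C) x0 x1 y0 y1 = (rect f x0 x1 y0 y1 + rect g x0 x1 y0 y1)%C.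
Proof.
  intros Hf Hg. unfold rect.
  rewrite !CInt_plus by (intros t _;
    first [now apply continuous_horizontal | now apply continuous_vertical]).
  ring.
Qed.

Lemma rect_split_x (f : C -> C) (x0 x1 x2 y0 y1 : R) :
  (forall z, continuous f z) ->
  rect f x0 x2 y0 y1 = (rect f x0 x1 y0 y1 + rect f x1 x2 y0 y1)%C.
Proof.
  intros Hf. unfold rect.
  rewrite (CInt_Chasles (fun s => f (s, y0)) x0 x1 x2),
    (CInt_Chasles (fun s => f (s, y1)) x0 x1 x2)
    by (intros t _; now apply continuous_horizontal).
  ring.
Qed.

Lemma rect_split_y (f : C -> C) (x0 x1 y0 y1 y2 : R) :
  (forall z, continuous f z) ->
  rect f x0 x1 y0 y2 = (rect f x0 x1 y0 y1 + rect f x0 x1 y1 y2)%C.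
Proof.
  intros Hf. unfold rect.
  rewrite (CInt_Chasles (fun s => f (x0, s)) y0 y1 y2),
    (CInt_Chasles (fun s => f (x1, s)) y0 y1 y2)
    by (intros t _; now apply continuous_vertical).
  ring.
Qed.

Lemma rect_derivative (f g : C -> C) (x0 x1 y0 y1 : R) :
  (forall z, continuous f z) -> (forall z, Cd g z (f z)) -> rect f x0 x1 y0 y1 = 0%C.
Proof.
  intros Hf Hg. unfold rect.
  assert (Hh : forall y a b, CInt (fun s => f (s, y)) a b = (g (b, y) - g (a, y))%C).
  { intros y a b. apply (CInt_FTC (fun s => g (s, y))).
    - intros t _. eapply Rd_eq.
      + apply (Rd_Cd g (fun s => (s, y) : C)); [apply Hg|].
        apply Rd_pair; [apply (@is_derive_id R_AbsRing) | apply (@is_derive_const R_AbsRing R_NormedModule)].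
      + apply injective_projections; simpl; unfold zero, one; simpl; ring.
    - intros t _. now apply continuous_horizontal. }
  assert (Hv : forall x a b, (Ci * CInt (fun t => f (x, t)) a b)%C = (g (x, b) - g (x, a))%C).
  { intros x a b. rewrite <- CInt_scal by (intros t _; now apply continuous_vertical).
    apply (CInt_FTC (fun s => g (x, s))).
    - intros t _. eapply Rd_eq.
      + apply (Rd_Cd g (fun s => (x, s) : C)); [apply Hg|].
        apply Rd_pair; [apply (@is_derive_const R_AbsRing R_NormedModule) | apply (@is_derive_id R_AbsRing)].
      + apply injective_projections; simpl; unfold zero, one; simpl; ring.
    - intros t _. apply continuous_Cmult; [apply continuous_const | now apply continuous_vertical]. }
  rewrite !Hh, !Hv. ring.
Qed.

Lemma rect_bound (f : C -> C) (x y a b M : R) :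
  0 <= a -> 0 <= b -> (forall z, continuous f z) ->
  (forall s t, x <= s <= x + a -> y <= t <= y + b -> Cmod (f (s, t)) <= M) ->
  Cmod (rect f x (x + a) y (y + b)) <= 2 * M * (a + b).
Proof.
  intros Ha Hb Hc HM. unfold rect.
  assert (Hh : forall t, y <= t <= y + b -> Cmod (CInt (fun s => f (s, t)) x (x + a)) <= M * (x + a - x)).
  { intros t Ht. apply CInt_bound; [lra | intros s _; now apply continuous_horizontal |].
    intros s Hs. now apply HM. }
  assert (Hv : forall s, x <= s <= x + a -> Cmod (Ci * CInt (fun t => f (s, t)) y (y + b)) <= M * (y + b - y)).
  { intros s Hs. rewrite Cmod_mult, Cmod_Ci, Rmult_1_l.
    apply CInt_bound; [lra | intros t _; now apply continuous_vertical |].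
    intros t Ht. now apply HM. }
  pose proof (Hh y ltac:(lra)). pose proof (Hh (y + b) ltac:(lra)).
  pose proof (Hv x ltac:(lra)). pose proof (Hv (x + a) ltac:(lra)).
  eapply Rle_trans; [apply Cmod_triangle_sub|].
  eapply Rle_trans; [apply Rplus_le_compat_r, Cmod_triangle_sub|].
  eapply Rle_trans; [do 2 apply Rplus_le_compat_r; apply Cmod_triangle|].
  nra.
Qed.

(** The affine approximation at [p] has a primitive, so its boundary integral vanishes. The
    remainder is at most [e * (a + b)] on a boundary of length [2 * (a + b)]. *)
Lemma rect_small (f : C -> C) (p l : C) (e d x y a b : R) :
  (forall z, continuous f z) -> 0 <= e -> 0 <= a -> 0 <= b -> a + b < d ->
  x <= fst p <= x + a -> y <= snd p <= y + b ->
  (forall w, Cmod (w - p) < d -> Cmod (f w - f p - l * (w - p)) <= e * Cmod (w - p)) ->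
  Cmod (rect f x (x + a) y (y + b)) <= 2 * e * (a + b) ^ 2.
Proof.
  intros Hc He Ha Hb Hd Hx Hy H.
  set (aff := fun z : C => (f p + l * (z - p))%C).
  assert (Haff : forall z, continuous aff z).
  { intros z. apply continuous_Cplus; [apply continuous_const|].
    apply continuous_Cmult; [apply continuous_const|].
    apply continuous_Cminus; [apply continuous_id | apply continuous_const]. }
  assert (Hrem : forall z, continuous (fun z => f z - aff z)%C z).
  { intros z. now apply continuous_Cminus. }
  assert (E : rect f x (x + a) y (y + b) = rect (fun z => (f z - aff z)%C) x (x + a) y (y + b)).
  { transitivity (rect (fun z => ((f z - aff z) + aff z)%C) x (x + a) y (y + b)).
    - apply rect_ext. intros; ring.
    - pose proof (rect_plus (fun z => f z - aff z)%C aff x (x + a) y (y + b) Hrem Haff) as Hp.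
      cbv beta in Hp. rewrite Hp.
      rewrite (rect_derivative aff (fun z => (f p - l * p) * z + l / 2 * (z ^ 2))%C); [ring | exact Haff|].
      intros z. eapply Cd_eq.
      + apply Cd_plus; [apply Cd_scal, Cd_id | apply Cd_scal, Cd_pow].
      + unfold aff. simpl. rewrite RtoC_plus. field. }
  rewrite E. eapply Rle_trans.
  - apply (rect_bound _ _ _ _ _ (e * (a + b))); trivial.
    intros s t Hs Ht. unfold aff.
    replace (f (s, t) - (f p + l * ((s, t) - p)))%C
      with (f (s, t) - f p - l * ((s, t) - p))%C by ring.
    assert (Hm : Cmod ((s, t) - p) <= a + b).
    { replace ((s, t) - p)%C with ((s - fst p, t - snd p) : C)
        by (apply injective_projections; simpl; ring).
      eapply Rle_trans; [apply Cmod_le_sum|].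
      apply Rplus_le_compat; apply Rabs_le; lra. }
    eapply Rle_trans; [apply H; lra|].
    now apply Rmult_le_compat_l.
  - nra.
Qed.

(** Dependent choice for the bisection of rectangles; [Q] records how each rectangle lies in the
    preceding one. *)
Lemma dependent_sequence {A : Type} (P : nat -> A -> Prop) (Q : nat -> A -> A -> Prop) (a0 : A) :
  P 0%nat a0 -> (forall n x, P n x -> exists y, P (S n) y /\ Q n x y) ->
  exists u : nat -> A, u 0%nat = a0 /\ forall n, P n (u n) /\ Q n (u n) (u (S n)).
Proof.
  intros H0 H.
  set (nxt := fun n x => epsilon (inhabits a0) (fun y => P (S n) y /\ Q n x y)).
  set (u := fix u n := match n with O => a0 | S n => nxt n (u n) end).
  assert (Hu : forall n, P n (u n)).
  { induction n as [|n IH]; [exact H0|].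
    apply (epsilon_spec (inhabits a0) (fun y => P (S n) y /\ Q n (u n) y) (H n _ IH)). }
  exists u. split; [reflexivity|]. intros n. split; [apply Hu|].
  apply (epsilon_spec (inhabits a0) (fun y => P (S n) y /\ Q n (u n) y) (H n _ (Hu n))).
Qed.

Lemma nested_dyadic (x : nat -> R) (a : R) :
  (forall n, x n <= x (S n) <= x n + a / 2 ^ S n) ->
  exists p, forall n, x n <= p <= x n + a / 2 ^ n.
Proof.
  intros H.
  assert (Hinc : forall n k, x n <= x (n + k)%nat).
  { intros n k. induction k as [|k IH]; [rewrite Nat.add_0_r; lra|].
    rewrite Nat.add_succ_r. specialize (H (n + k)%nat). lra. }
  assert (Hdec : forall n k, x (n + k)%nat + a / 2 ^ (n + k) <= x n + a / 2 ^ n).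
  { intros n k. induction k as [|k IH]; [rewrite Nat.add_0_r; lra|].
    rewrite Nat.add_succ_r. specialize (H (n + k)%nat). simpl in H |- *.
    assert (0 < 2 ^ (n + k)) by (apply pow_lt; lra).
    replace (a / 2 ^ (n + k)) with (2 * (a / (2 * 2 ^ (n + k)))) in IH by (field; lra). lra. }
  assert (Ha : forall n, 0 <= a / 2 ^ n).
  { intros [|n]; [|specialize (H n); lra]. specialize (H 0%nat). simpl in *. lra. }
  assert (Hub : forall n m, x m <= x n + a / 2 ^ n).
  { intros n m. destruct (Nat.le_ge_cases n m) as [E|E].
    - replace m with (n + (m - n))%nat by lia. pose proof (Hdec n (m - n)%nat).
      pose proof (Ha (n + (m - n))%nat). lra.
    - replace n with (m + (n - m))%nat by lia. pose proof (Hinc m (n - m)%nat).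
      pose proof (Ha (m + (n - m))%nat). lra. }
  destruct (completeness (fun y => exists n, y = x n)) as [p [Hp1 Hp2]].
  - exists (x 0%nat + a / 2 ^ 0). intros y [n ->]. apply Hub.
  - exists (x 0%nat). now exists 0%nat.
  - exists p. intros n. split.
    + apply Hp1. now exists n.
    + apply Hp2. intros y [m ->]. apply Hub.
Qed.

Lemma pow_half_small (K d : R) : 0 < d -> exists n, K / 2 ^ n < d.
Proof.
  intros Hd. destruct (Rle_dec K 0) as [HK|HK].
  { exists 0%nat. simpl. lra. }
  destruct (pow_lt_1_zero (1 / 2) ltac:(rewrite Rabs_pos_eq; lra) (d / K)) as [n Hn].
  { apply Rdiv_lt_0_compat; lra. }
  exists n. specialize (Hn n (Nat.le_refl n)).
  rewrite Rabs_pos_eq in Hn by (apply pow_le; lra).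
  replace (1 / 2) with (/ 2) in Hn by field. rewrite pow_inv in Hn.
  apply Rmult_lt_reg_r with (/ K); [apply Rinv_0_lt_compat; lra|].
  unfold Rdiv. replace (K * / 2 ^ n * / K) with (/ 2 ^ n); [exact Hn|].
  field. split; [lra|]. apply pow_nonzero; lra.
Qed.

(** Goursat's bisection: one of four quarters keeps at least a quarter of the integral. The nested
    rectangles meet in a point, where [rect_small] gives a bound that also decays like [4 ^ n], but
    with an arbitrarily small factor. *)
Lemma goursat_rectangle (f : C -> C) (x y a b : R) :
  (forall z, exists l, Cd f z l) -> 0 <= a -> 0 <= b -> rect f x (x + a) y (y + b) = 0%C.
Proof.
  intros Hf Ha Hb.
  assert (Hc : forall z, continuous f z).
  { intros z. destruct (Hf z) as [l Hl]. now apply Cd_continuous with l. }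
  apply Cmod_eq_0. apply Rle_antisym; [|apply Cmod_ge_0]. apply Rnot_lt_le. intros H0.
  set (K := Cmod (rect f x (x + a) y (y + b))) in *.
  set (P := fun (n : nat) (q : R * R) =>
    K / 4 ^ n <= Cmod (rect f (fst q) (fst q + a / 2 ^ n) (snd q) (snd q + b / 2 ^ n))).
  set (Q := fun (n : nat) (q q' : R * R) =>
    (fst q <= fst q' <= fst q + a / 2 ^ S n) /\ (snd q <= snd q' <= snd q + b / 2 ^ S n)).
  destruct (dependent_sequence P Q (x, y)) as [u [Hu0 Hu]].
  - unfold P, K; simpl. rewrite !Rdiv_1_r. apply Rle_refl.
  - intros n [s t] Hn. unfold P, Q in *; simpl fst in *; simpl snd in *.
    assert (H2 : 0 < 2 ^ n) by (apply pow_lt; lra).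
    assert (Ea : s + a / 2 ^ n = s + a / 2 ^ S n + a / 2 ^ S n) by (simpl; field; lra).
    assert (Eb : t + b / 2 ^ n = t + b / 2 ^ S n + b / 2 ^ S n) by (simpl; field; lra).
    assert (Pa : 0 <= a / 2 ^ S n).
    { unfold Rdiv. apply Rmult_le_pos; [lra|]. apply Rlt_le, Rinv_0_lt_compat, pow_lt; lra. }
    assert (Pb : 0 <= b / 2 ^ S n).
    { unfold Rdiv. apply Rmult_le_pos; [lra|]. apply Rlt_le, Rinv_0_lt_compat, pow_lt; lra. }
    assert (E4 : K / 4 ^ n = 4 * (K / 4 ^ S n)).
    { simpl. field. apply pow_nonzero. lra. }
    rewrite Ea, Eb in Hn.
    set (a' := a / 2 ^ S n) in *. set (b' := b / 2 ^ S n) in *.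
    rewrite (rect_split_x f s (s + a')) in Hn by exact Hc.
    rewrite (rect_split_y f s (s + a') t (t + b') (t + b' + b')),
      (rect_split_y f (s + a') (s + a' + a') t (t + b') (t + b' + b')) in Hn by exact Hc.
    destruct (Rle_dec (K / 4 ^ S n) (Cmod (rect f s (s + a') t (t + b')))) as [C1|C1].
    { exists (s, t). simpl fst; simpl snd. split; [exact C1|]. split; lra. }
    destruct (Rle_dec (K / 4 ^ S n) (Cmod (rect f s (s + a') (t + b') (t + b' + b')))) as [C2|C2].
    { exists (s, t + b'). simpl fst; simpl snd. split; [exact C2|]. split; lra. }
    destruct (Rle_dec (K / 4 ^ S n) (Cmod (rect f (s + a') (s + a' + a') t (t + b')))) as [C3|C3].
    { exists (s + a', t). simpl fst; simpl snd. split; [exact C3|]. split; lra. }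
    exists (s + a', t + b'). simpl fst; simpl snd. split; [|split; lra].
    apply Rnot_lt_le. intros C4.
    set (A1 := rect f s (s + a') t (t + b')) in *.
    set (A2 := rect f s (s + a') (t + b') (t + b' + b')) in *.
    set (A3 := rect f (s + a') (s + a' + a') t (t + b')) in *.
    set (A4 := rect f (s + a') (s + a' + a') (t + b') (t + b' + b')) in *.
    pose proof (Cmod_triangle (A1 + A2) (A3 + A4)).
    pose proof (Cmod_triangle A1 A2). pose proof (Cmod_triangle A3 A4). lra.
  - destruct (nested_dyadic (fun n => fst (u n)) a) as [p1 Hp1].
    { intros n. apply Hu. }
    destruct (nested_dyadic (fun n => snd (u n)) b) as [p2 Hp2].
    { intros n. apply Hu. }
    destruct (Hf (p1, p2)) as [l Hl].
    (* This makes [2 * e * (a + b) ^ 2] at most [K / 2]; the [+ 1] keeps the denominator positive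
       for a degenerate rectangle. *)
    set (e := K / (4 * (a + b + 1) ^ 2)).
    assert (He : 0 < e).
    { apply Rdiv_lt_0_compat; [exact H0|]. apply Rmult_lt_0_compat; [lra|]. apply pow_lt; lra. }
    destruct (Cd_eps _ _ _ Hl e He) as [d [Hd Hb']].
    destruct (pow_half_small (a + b) d Hd) as [n Hn].
    assert (H2 : 0 < 2 ^ n) by (apply pow_lt; lra).
    assert (H2' : 0 <= / 2 ^ n) by (apply Rlt_le, Rinv_0_lt_compat, H2).
    destruct (Hu n) as [HP _]. unfold P in HP.
    pose proof (rect_small f (p1, p2) l e d (fst (u n)) (snd (u n)) (a / 2 ^ n) (b / 2 ^ n) Hc
      (Rlt_le _ _ He) ltac:(unfold Rdiv; nra) ltac:(unfold Rdiv; nra)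
      ltac:(unfold Rdiv in *; lra) (Hp1 n) (Hp2 n) Hb') as HS.
    pose proof (Rle_trans _ _ _ HP HS) as HC.
    replace (2 * e * (a / 2 ^ n + b / 2 ^ n) ^ 2)
      with (2 * e * (a + b) ^ 2 / 4 ^ n) in HC.
    2:{ replace 4 with (2 * 2) by ring. rewrite Rpow_mult_distr. field. lra. }
    assert (H4 : 0 < 4 ^ n) by (apply pow_lt; lra).
    apply Rmult_le_compat_r with (r := 4 ^ n) in HC; [|lra].
    unfold Rdiv in HC at 1 2. rewrite !Rmult_assoc, Rinv_l, !Rmult_1_r in HC by lra.
    assert (HK : 2 * (e * (a + b + 1) ^ 2) = K / 2).
    { unfold e. field. lra. }
    assert (e * (a + b) ^ 2 <= e * (a + b + 1) ^ 2) by (apply Rmult_le_compat_l; nra).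
    lra.
Qed.

Lemma goursat (f : C -> C) (x0 x1 y0 y1 : R) :
  (forall z, exists l, Cd f z l) -> rect f x0 x1 y0 y1 = 0%C.
Proof.
  intros Hf.
  assert (Hc : forall z, continuous f z).
  { intros z. destruct (Hf z) as [l Hl]. now apply Cd_continuous with l. }
  assert (Hh : forall y a b, CInt (fun s => f (s, y)) b a = (- CInt (fun s => f (s, y)) a b)%C).
  { intros. apply CInt_swap. intros t _. now apply continuous_horizontal. }
  assert (Hv : forall x a b, CInt (fun s => f (x, s)) b a = (- CInt (fun s => f (x, s)) a b)%C).
  { intros. apply CInt_swap. intros t _. now apply continuous_vertical. }
  assert (H1 : forall x0 x1 y0 y1, x0 <= x1 -> y0 <= y1 -> rect f x0 x1 y0 y1 = 0%C).
  { intros a0 a1 b0 b1 Ha Hb. replace a1 with (a0 + (a1 - a0)) by ring.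
    replace b1 with (b0 + (b1 - b0)) by ring. apply goursat_rectangle; trivial; lra. }
  assert (H2 : forall x0 x1 y0 y1, x0 <= x1 -> rect f x0 x1 y0 y1 = 0%C).
  { intros a0 a1 b0 b1 Ha. destruct (Rle_dec b0 b1) as [Hb|Hb]; [now apply H1|].
    transitivity (- rect f a0 a1 b1 b0)%C.
    - unfold rect. rewrite (Hv a1 b1 b0), (Hv a0 b1 b0). ring.
    - rewrite H1 by lra. ring. }
  destruct (Rle_dec x0 x1) as [Ha|Ha]; [now apply H2|].
  transitivity (- rect f x1 x0 y0 y1)%C.
  - unfold rect. rewrite (Hh y0 x1 x0), (Hh y1 x1 x0). ring.
  - rewrite H2 by lra. ring.
Qed.

(** The primitive integrates along the real axis and then vertically. By [goursat] the increment
    from [z] to [w] equals the integral over a horizontal and a vertical segment close to [z], where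
    [f] is nearly [f z]. *)
Lemma goursat_primitive (f : C -> C) :
  (forall z, exists l, Cd f z l) -> exists F : C -> C, forall z, Cd F z (f z).
Proof.
  intros Hf.
  assert (Hc : forall z, continuous f z).
  { intros z. destruct (Hf z) as [l Hl]. now apply Cd_continuous with l. }
  exists (fun z => CInt (fun s => f (s, 0)) 0 (fst z) + Ci * CInt (fun t => f (fst z, t)) 0 (snd z))%C.
  intros z. apply Cd_intro. intros e He.
  destruct (proj1 (continuous_C_eps f z) (Hc z) (e / 2) ltac:(lra)) as [d [Hd Hcz]].
  exists (d / 2). split; [lra|]. intros w Hw.
  destruct z as [x y]. destruct w as [x' y']. simpl fst; simpl snd.
  set (z := (x, y) : C) in *. set (w := (x', y') : C) in *.
  assert (Hh : forall y a b, cont_on (fun s => f (s, y)) a b).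
  { intros yy aa bb t _. now apply continuous_horizontal. }
  assert (Hv : forall x a b, cont_on (fun s => f (x, s)) a b).
  { intros xx aa bb t _. now apply continuous_vertical. }
  pose proof (goursat f x x' 0 y Hf) as G. unfold rect in G.
  assert (E : (CInt (fun s => f (s, 0%R)) 0 x' + Ci * CInt (fun t => f (x', t)) 0 y'
     - (CInt (fun s => f (s, 0%R)) 0 x + Ci * CInt (fun t => f (x, t)) 0 y))%C
    = (CInt (fun s => f (s, y)) x x' + Ci * CInt (fun t => f (x', t)) y y')%C).
  { rewrite (CInt_Chasles (fun s => f (s, 0%R)) 0 x x') by apply Hh.
    rewrite (CInt_Chasles (fun t => f (x', t)) 0 y y') by apply Hv.
    match type of G with ?a = _ => transitivity
      (a + (CInt (fun s => f (s, y)) x x' + Ci * CInt (fun t => f (x', t)) y y'))%C end.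
    - ring.
    - rewrite G. ring. }
  rewrite E. clear E G.
  assert (E1 : CInt (fun s => (f (s, y) - f z)%C) x x' = (CInt (fun s => f (s, y)) x x' - f z * RtoC (x' - x))%C).
  { rewrite CInt_minus; [|apply Hh | intros t _; apply continuous_const]. f_equal.
    rewrite (CInt_FTC (fun s => (f z * RtoC s)%C)).
    - rewrite RtoC_minus. ring.
    - intros t _. eapply Rd_eq; [apply Rd_mult; [apply Rd_const | apply Rd_RtoC]|]. cbv beta. ring.
    - intros t _. apply continuous_const. }
  assert (E2 : CInt (fun s => (f (x', s) - f z)%C) y y' = (CInt (fun s => f (x', s)) y y' - f z * RtoC (y' - y))%C).
  { rewrite CInt_minus; [|apply Hv | intros t _; apply continuous_const]. f_equal.
    rewrite (CInt_FTC (fun s => (f z * RtoC s)%C)).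
    - rewrite RtoC_minus. ring.
    - intros t _. eapply Rd_eq; [apply Rd_mult; [apply Rd_const | apply Rd_RtoC]|]. cbv beta. ring.
    - intros t _. apply continuous_const. }
  replace (CInt (fun s => f (s, y)) x x' + Ci * CInt (fun t => f (x', t)) y y' - f z * (w - z))%C
    with (CInt (fun s => (f (s, y) - f z)%C) x x' + Ci * CInt (fun s => (f (x', s) - f z)%C) y y')%C.
  2:{ rewrite E1, E2. replace (w - z)%C with (RtoC (x' - x) + Ci * RtoC (y' - y))%C.
      - ring.
      - apply injective_projections; simpl; ring. }
  assert (Hx : Rabs (x' - x) <= Cmod (w - z)).
  { replace (x' - x) with (fst (w - z)%C) by (simpl; ring). apply Cmod_fst. }
  assert (Hy : Rabs (y' - y) <= Cmod (w - z)).
  { replace (y' - y) with (snd (w - z)%C) by (simpl; ring). apply Cmod_snd. }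
  assert (Hseg : forall s t, Rabs (s - x) <= Rabs (x' - x) -> Rabs (t - y) <= Rabs (y' - y) ->
     Cmod (f (s, t) - f z) <= e / 2).
  { intros s t Hs Ht. apply Rlt_le, Hcz.
    replace ((s, t) - z)%C with ((s - x, t - y) : C) by (apply injective_projections; simpl; ring).
    eapply Rle_lt_trans; [apply Cmod_le_sum | lra]. }
  assert (Hbetw : forall a b t, Rmin a b <= t <= Rmax a b -> Rabs (t - a) <= Rabs (b - a)).
  { intros a0 b0 t Ht. unfold Rmin, Rmax in Ht. unfold Rabs.
    destruct (Rle_dec a0 b0); destruct (Rcase_abs (t - a0)); destruct (Rcase_abs (b0 - a0)); lra. }
  eapply Rle_trans; [apply Cmod_triangle|]. rewrite Cmod_mult, Cmod_Ci, Rmult_1_l.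
  assert (B1 : Cmod (CInt (fun s => (f (s, y) - f z)%C) x x') <= e / 2 * Rabs (x' - x)).
  { apply CInt_bound_abs.
    - intros t Ht. apply continuous_Cminus; [now apply Hh with x x' | apply continuous_const].
    - intros t Ht. apply Hseg; [now apply Hbetw|]. rewrite Rminus_diag, Rabs_R0. apply Rabs_pos. }
  assert (B2 : Cmod (CInt (fun s => (f (x', s) - f z)%C) y y') <= e / 2 * Rabs (y' - y)).
  { apply CInt_bound_abs.
    - intros t Ht. apply continuous_Cminus; [now apply Hv with y y' | apply continuous_const].
    - intros t Ht. apply Hseg; [apply Rle_refl | now apply Hbetw]. }
  nra.
Qed.

(** * Cauchy's formula *)

Definition cir (r t : R) : C := (r * cos t, r * sin t).

Lemma Cmod_cir (r t : R) : 0 <= r -> Cmod (cir r t) = r.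
Proof.
  intros Hr. unfold Cmod, cir; simpl fst; simpl snd.
  replace ((r * cos t) ^ 2 + (r * sin t) ^ 2) with (r ^ 2 * (Rsqr (sin t) + Rsqr (cos t)))
    by (unfold Rsqr; ring).
  rewrite sin2_cos2, Rmult_1_r. now apply sqrt_pow2.
Qed.

Lemma cir_2PI (r : R) : cir r (2 * PI) = cir r 0.
Proof. unfold cir. now rewrite cos_2PI, sin_2PI, cos_0, sin_0. Qed.

Lemma Rd_cir (r t : R) : Rd (cir r) t (Ci * cir r t)%C.
Proof.
  assert (H1 : is_derive (fun t => r * cos t) t (- r * sin t)) by (auto_derive; trivial; ring).
  assert (H2 : is_derive (fun t => r * sin t) t (r * cos t)) by (auto_derive; trivial; ring).
  eapply Rd_eq; [apply (Rd_pair _ _ _ _ _ H1 H2)|].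
  apply injective_projections; simpl; ring.
Qed.

Lemma continuous_cir (r t : R) : continuous (cir r) t.
Proof. eapply Rd_continuous, Rd_cir. Qed.

Lemma continuous_cir_comp (f : C -> C) (r t : R) :
  continuous f (cir r t) -> continuous (fun t => f (cir r t)) t.
Proof. intros H. apply (continuous_comp (cir r) f); [apply continuous_cir | exact H]. Qed.

Lemma cir_sub_neq_0 (r t : R) (w : C) : 0 <= r -> Cmod w < r -> (cir r t - w)%C <> 0%C.
Proof.
  intros Hr Hw E. assert (E' : cir r t = w) by (rewrite <- (Cplus_0_l w), <- E; ring).
  rewrite <- E', Cmod_cir in Hw; lra.
Qed.

Lemma cir_sub_ge (r t : R) (w : C) : 0 <= r -> r - Cmod w <= Cmod (cir r t - w).
Proof.
  intros Hr. pose proof (Cmod_triangle_rev (cir r t) w) as H. rewrite Cmod_cir in H; lra.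
Qed.

Lemma Rlt_0_2PI : 0 < 2 * PI.
Proof. pose proof PI_RGT_0. lra. Qed.

Lemma RtoC_neq_0 (x : R) : x <> 0 -> RtoC x <> 0%C.
Proof. intros Hx E. apply Hx. now injection E. Qed.

Lemma C2PI_neq_0 : RtoC (2 * PI) <> 0%C.
Proof. apply RtoC_neq_0. pose proof Rlt_0_2PI. lra. Qed.

Lemma CInt_const (c : C) (a b : R) : CInt (fun _ => c) a b = (RtoC (b - a) * c)%C.
Proof.
  rewrite (CInt_FTC (fun s => (RtoC s * c)%C)).
  - rewrite RtoC_minus. ring.
  - intros t _. eapply Rd_eq; [apply Rd_mult; [apply Rd_RtoC | apply Rd_const]|]. cbv beta. ring.
  - intros t _. apply continuous_const.
Qed.

(** The parameter ranges over a complex neighbourhood of the unit interval so that [Cd_CInt_param]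
    applies; along real [s] the derivative is zero. *)
Lemma CInt_param_const (P P' : R -> C -> C) (rho : R) :
  0 < rho ->
  (forall s t w, 0 <= s <= 1 -> 0 <= t <= 2 * PI -> Cmod (w - RtoC s) < rho -> Cd (P t) w (P' t w)) ->
  (forall s t w, 0 <= s <= 1 -> 0 <= t <= 2 * PI -> Cmod (w - RtoC s) < rho ->
     continuous (fun s => P s w) t) ->
  (forall s t, 0 <= s <= 1 -> 0 <= t <= 2 * PI ->
     continuous (fun p : R * C => P' (fst p) (snd p)) (t, RtoC s)) ->
  (forall s, 0 <= s <= 1 -> CInt (fun t => P' t (RtoC s)) 0 (2 * PI) = 0%C) ->
  CInt (fun t => P t 0%C) 0 (2 * PI) = CInt (fun t => P t 1%C) 0 (2 * PI).
Proof.
  intros Hrho Hd Hc Hj H0. pose proof Rlt_0_2PI.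
  apply (Rd_zero_const (fun s => CInt (fun t => P t (RtoC s)) 0 (2 * PI)) 0 1); [lra|].
  intros s Hs. eapply Rd_eq.
  - apply (Rd_Cd (fun w => CInt (fun t => P t w) 0 (2 * PI)) RtoC); [|apply Rd_RtoC].
    apply (Cd_CInt_param P P' _ _ rho); [lra | exact Hrho | | |].
    + intros t w Ht Hw. now apply (Hd s).
    + intros t w Ht Hw. now apply (Hc s).
    + intros t Ht. now apply Hj.
  - rewrite H0 by exact Hs. ring.
Qed.

Lemma continuous_fst_RC (p : R * C) : continuous (fun p : R * C => fst p) p.
Proof. apply continuous_fst. Qed.

Lemma continuous_snd_RC (p : R * C) : continuous (fun p : R * C => snd p) p.
Proof. apply continuous_snd. Qed.

Lemma continuous_cir_fst (r : R) (p : R * C) : continuous (fun p : R * C => cir r (fst p)) p.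
Proof.
  apply (continuous_comp (fun p : R * C => fst p) (cir r)); [apply continuous_fst_RC | apply continuous_cir].
Qed.

Lemma Cmod_segment_le (z w : C) (r s : R) :
  0 <= s <= 1 -> Cmod z <= r -> Cmod w <= r -> Cmod (z + RtoC s * (w - z)) <= r.
Proof.
  intros Hs Hz Hw. replace (z + RtoC s * (w - z))%C with (RtoC (1 - s) * z + RtoC s * w)%C
    by (rewrite RtoC_minus; ring).
  eapply Rle_trans; [apply Cmod_triangle|].
  rewrite !Cmod_mult, !Cmod_R, !Rabs_pos_eq by lra. nra.
Qed.

Lemma Cd_cauchy_transform (G : R -> C) (r : R) (n : nat) (z : C) :
  Cmod z < r -> (forall t, continuous G t) ->
  Cd (fun w => CInt (fun t => (G t / (cir r t - w) ^ S n)%C) 0 (2 * PI)) z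
     (RtoC (INR (S n)) * CInt (fun t => (G t / (cir r t - z) ^ S (S n))%C) 0 (2 * PI))%C.
Proof.
  intros Hz HG. pose proof (Cmod_ge_0 z) as Hz0. assert (Hr : 0 < r) by lra.
  assert (Hn : forall w, Cmod (w - z) < r - Cmod z -> forall t, (cir r t - w)%C <> 0%C).
  { intros w Hw t. apply cir_sub_neq_0; [lra|]. pose proof (Cmod_triangle_rev w z). lra. }
  assert (Hzz : Cmod (z - z) < r - Cmod z) by (rewrite Cminus_diag, Cmod_0; lra).
  assert (Hcirw : forall w t, continuous (fun t => (cir r t - w)%C) t).
  { intros w t. apply continuous_Cminus; [apply continuous_cir | apply continuous_const]. }
  rewrite <- CInt_scal.
  2:{ intros t _. apply continuous_Cdiv; [apply HG | apply continuous_Cpow, Hcirw|].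
      apply Cpow_nz. now apply Hn. }
  pose proof Rlt_0_2PI.
  apply (Cd_CInt_param (fun t w => (G t / (cir r t - w) ^ S n)%C)
    (fun t w => (RtoC (INR (S n)) * (G t / (cir r t - w) ^ S (S n)))%C) _ _ (r - Cmod z)); try lra.
  - intros t w _ Hw. specialize (Hn w Hw t). eapply Cd_eq.
    + apply Cd_scal. apply (Cd_inv (fun w => (cir r t - w) ^ S n)%C); [|now apply Cpow_nz].
      apply (Cd_comp (fun x => (x ^ S n)%C) (fun w => (cir r t - w)%C)); [|apply Cd_pow].
      apply Cd_minus; [apply Cd_const | apply Cd_id].
    + cbv beta. change ((cir r t - w) ^ S (S n))%C with ((cir r t - w) * ((cir r t - w) * (cir r t - w) ^ n))%C.
      change ((cir r t - w) ^ S n)%C with ((cir r t - w) * (cir r t - w) ^ n)%C.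
      field. split; [now apply Cpow_nz | exact Hn].
  - intros t w _ Hw. apply continuous_Cdiv; [apply HG | apply continuous_Cpow, Hcirw|].
    apply Cpow_nz. now apply Hn.
  - intros t _. apply continuous_Cmult; [apply continuous_const|]. apply continuous_Cdiv.
    + apply (continuous_comp (fun p : R * C => fst p) G); [apply continuous_fst_RC | apply HG].
    + apply continuous_Cpow, continuous_Cminus; [apply continuous_cir_fst | apply continuous_snd_RC].
    + simpl fst; simpl snd. apply Cpow_nz. now apply Hn.
Qed.

(** The derivative in [z] integrates, over a full period, the derivative of the closed path
    [Ci / (cir r t - w)]. So the integral does not depend on [z], and at the centre the integrand is
    1. *)
Lemma cauchy_kernel (r : R) (z : C) :
  Cmod z < r -> CInt (fun t => (cir r t / (cir r t - z))%C) 0 (2 * PI) = RtoC (2 * PI).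
Proof.
  intros Hz. pose proof (Cmod_ge_0 z) as Hz0. assert (Hr : 0 < r) by lra.
  set (psi := fun w => CInt (fun t => (cir r t / (cir r t - w) ^ 1)%C) 0 (2 * PI)).
  assert (Hpsi : forall w, Cmod w < r -> Cd psi w 0%C).
  { intros w Hw. eapply Cd_eq; [apply (Cd_cauchy_transform (cir r) r 0 w Hw (continuous_cir r))|].
    assert (Hne : forall t, (cir r t - w)%C <> 0%C) by (intros t; apply cir_sub_neq_0; lra).
    rewrite (CInt_FTC (fun t => (Ci * / (cir r t - w))%C)).
    - rewrite cir_2PI. ring.
    - intros t _. eapply Rd_eq.
      + apply Rd_mult; [apply Rd_const|].
        apply (Rd_Cd (fun x => / (x - w))%C (cir r)); [|apply Rd_cir].
        apply Cd_inv; [apply Cd_minus; [apply Cd_id | apply Cd_const] | apply Hne].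
      + cbv beta. transitivity (- (Ci * Ci) * (cir r t / (cir r t - w) ^ 2))%C.
        * field. apply Hne.
        * replace (Ci * Ci)%C with (- (1))%C by (apply injective_projections; simpl; ring). ring.
    - intros t _. apply continuous_Cdiv; [apply continuous_cir | | now apply Cpow_nz].
      apply continuous_Cpow, continuous_Cminus; [apply continuous_cir | apply continuous_const]. }
  assert (Hdiff : psi z = psi 0%C).
  { apply Ceq_minus. apply Cmod_eq_0. apply Rle_antisym; [|apply Cmod_ge_0].
    pose proof (Cd_mean_value psi (fun _ => 0%C) 0%C 0%C r 0) as H.
    specialize (H ltac:(intros w Hw; split; [apply Hpsi; now replace w with (w - 0)%C by ring
      | rewrite Cminus_diag, Cmod_0; lra]) z).
    replace (z - 0)%C with z in H by ring. specialize (H Hz).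
    replace (psi z - psi 0 - 0 * z)%C with (psi z - psi 0)%C in H by ring. lra. }
  transitivity (psi z).
  { apply CInt_ext. intros t _. simpl. field. apply cir_sub_neq_0; lra. }
  rewrite Hdiff. transitivity (CInt (fun _ => 1%C) 0 (2 * PI)).
  - apply CInt_ext. intros t _. simpl.
    assert (Hne : (cir r t - 0)%C <> 0%C) by (apply cir_sub_neq_0; [lra | rewrite Cmod_0; lra]).
    assert (E : (cir r t - 0)%C = cir r t) by ring. rewrite E in *. field. exact Hne.
  - rewrite CInt_const, Cmult_1_r. f_equal. ring.
Qed.

(* Shrinking the circle about [z] to the point [z] does not change the
   integral, because its derivative in the scaling factor is the integral of
   a derivative over a period. *)
Lemma cauchy_formula (H H' : C -> C) (r0 r : R) (z : C) :
  Cmod z < r -> r < r0 ->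
  (forall w, Cmod w < r0 -> Cd H w (H' w)) -> (forall w, Cmod w < r0 -> continuous H' w) ->
  CInt (fun t => (H (cir r t) * (cir r t / (cir r t - z)))%C) 0 (2 * PI) = (RtoC (2 * PI) * H z)%C.
Proof.
  intros Hz Hr0 Hd Hc. pose proof (Cmod_ge_0 z) as Hz0. assert (Hr : 0 < r) by lra.
  assert (Hne : forall t, (cir r t - z)%C <> 0%C) by (intros t; apply cir_sub_neq_0; lra).
  (* Points of the circle are at distance at most [2 * r] from [z], so this perturbation of the
     scaling factor moves a point by less than [r0 - r]. *)
  assert (Hn : forall s t w, 0 <= s <= 1 -> Cmod (w - RtoC s) < (r0 - r) / (2 * r) ->
    Cmod (z + w * (cir r t - z)) < r0).
  { intros s t w Hs Hw.
    replace (z + w * (cir r t - z))%C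
      with ((z + RtoC s * (cir r t - z)) + (w - RtoC s) * (cir r t - z))%C by ring.
    eapply Rle_lt_trans; [apply Cmod_triangle|].
    assert (H1 : Cmod (z + RtoC s * (cir r t - z)) <= r)
      by (apply Cmod_segment_le; [exact Hs | lra | rewrite Cmod_cir; lra]).
    assert (H2 : Cmod (cir r t - z) <= 2 * r).
    { eapply Rle_trans; [apply Cmod_triangle_sub|]. rewrite Cmod_cir; lra. }
    rewrite Cmod_mult. pose proof (Cmod_ge_0 (cir r t - z)) as H3.
    assert (H4 : Cmod (w - RtoC s) * (2 * r) < r0 - r).
    { apply Rmult_lt_compat_r with (r := 2 * r) in Hw; [|lra].
      unfold Rdiv in Hw. rewrite Rmult_assoc, Rinv_l in Hw; lra. }
    pose proof (Cmod_ge_0 (w - RtoC s)). nra. }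
  transitivity (CInt (fun t => (H (z + 1 * (cir r t - z)) * (cir r t / (cir r t - z)))%C) 0 (2 * PI)).
  { apply CInt_ext. intros t _. f_equal. f_equal. ring. }
  assert (Hp : 0 < (r0 - r) / (2 * r)) by (apply Rdiv_lt_0_compat; lra).
  assert (Hn' : forall s t, 0 <= s <= 1 -> Cmod (z + RtoC s * (cir r t - z)) < r0).
  { intros s t Hs. apply (Hn s); trivial. now rewrite Cminus_diag, Cmod_0. }
  assert (Hcirz : forall t, continuous (fun t => (cir r t - z)%C) t).
  { intros t. apply continuous_Cminus; [apply continuous_cir | apply continuous_const]. }
  rewrite <- (CInt_param_const (fun t w => (H (z + w * (cir r t - z)) * (cir r t / (cir r t - z)))%C)
    (fun t w => (H' (z + w * (cir r t - z)) * cir r t)%C) ((r0 - r) / (2 * r))).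
  - transitivity (CInt (fun t => (H z * (cir r t / (cir r t - z)))%C) 0 (2 * PI)).
    + apply CInt_ext. intros t _. f_equal. f_equal. ring.
    + rewrite CInt_scal, cauchy_kernel by
        first [exact Hz | intros t _; apply continuous_Cdiv; [apply continuous_cir | apply Hcirz | apply Hne]].
      ring.
  - exact Hp.
  - intros s t w Hs Ht Hw. eapply Cd_eq.
    + apply Cd_mult; [|apply Cd_const].
      apply (Cd_comp H (fun w => (z + w * (cir r t - z))%C)).
      * apply Cd_plus; [apply Cd_const | apply Cd_mult; [apply Cd_id | apply Cd_const]].
      * apply Hd. now apply (Hn s).
    + cbv beta. field. apply Hne.
  - intros s t w Hs Ht Hw. apply continuous_Cmult.
    + apply (continuous_comp (fun t => (z + w * (cir r t - z))%C) H).
      * apply continuous_Cplus; [apply continuous_const|].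
        apply continuous_Cmult; [apply continuous_const | apply Hcirz].
      * eapply Cd_continuous, Hd. now apply (Hn s).
    + apply continuous_Cdiv; [apply continuous_cir | apply Hcirz | apply Hne].
  - intros s t Hs Ht. apply continuous_Cmult; [|apply continuous_cir_fst].
    apply (continuous_comp (fun p : R * C => (z + snd p * (cir r (fst p) - z))%C) H').
    + apply continuous_Cplus; [apply continuous_const|].
      apply continuous_Cmult; [apply continuous_snd_RC|].
      apply continuous_Cminus; [apply continuous_cir_fst | apply continuous_const].
    + simpl. apply Hc. now apply Hn'.
  - intros s Hs.
    assert (Hcs : cont_on (fun t => (H' (z + RtoC s * (cir r t - z)) * cir r t)%C) 0 (2 * PI)).
    { intros t _. apply continuous_Cmult; [|apply continuous_cir].
      apply (continuous_comp (fun t => (z + RtoC s * (cir r t - z))%C) H').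
      - apply continuous_Cplus; [apply continuous_const|].
        apply continuous_Cmult; [apply continuous_const | apply Hcirz].
      - apply Hc. now apply Hn'. }
    (* For [s <> 0] the integrand times [Ci * s] is the derivative of [H] along the shrunken circle.
       For [s = 0] that factor vanishes, but the integrand is then a constant multiple of [cir r]
       and has a periodic primitive. *)
    destruct (Req_EM_T s 0) as [Es|Es].
    + subst s. transitivity (CInt (fun t => (H' z * cir r t)%C) 0 (2 * PI)).
      { apply CInt_ext. intros t _. f_equal. f_equal. ring. }
      rewrite (CInt_FTC (fun t => (- Ci * H' z * cir r t)%C)).
      * rewrite cir_2PI. ring.
      * intros t _. eapply Rd_eq; [apply Rd_mult; [apply Rd_const | apply Rd_cir]|].
        cbv beta. replace (0 * cir r t + - Ci * H' z * (Ci * cir r t))%C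
          with (- (Ci * Ci) * (H' z * cir r t))%C by ring.
        replace (Ci * Ci)%C with (- (1))%C by (apply injective_projections; simpl; ring).
        ring.
      * intros t _. apply continuous_Cmult; [apply continuous_const | apply continuous_cir].
    + assert (E0 : (Ci * RtoC s * CInt (fun t => (H' (z + RtoC s * (cir r t - z)) * cir r t)%C) 0 (2 * PI))%C = 0%C).
      { rewrite <- CInt_scal by exact Hcs.
        rewrite (CInt_FTC (fun t => H (z + RtoC s * (cir r t - z))%C)).
        - rewrite cir_2PI. apply Cminus_diag.
        - intros t _. eapply Rd_eq.
          + apply (Rd_Cd (fun w => H (z + RtoC s * (w - z))%C) (cir r)); [|apply Rd_cir].
            apply (Cd_comp H (fun w => (z + RtoC s * (w - z))%C)); [|apply Hd; now apply Hn'].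
            apply Cd_plus; [apply Cd_const|]. apply Cd_scal.
            apply Cd_minus; [apply Cd_id | apply Cd_const].
          + cbv beta. ring.
        - now apply cont_on_scal. }
      destruct (Ceq_dec (CInt (fun t => (H' (z + RtoC s * (cir r t - z)) * cir r t)%C) 0 (2 * PI)) 0%C)
        as [E|E]; [exact E|]. exfalso. revert E0. apply Cmult_neq_0; [|exact E].
      apply Cmult_neq_0; [|now apply RtoC_neq_0]. intros E'. injection E'. lra.
Qed.

Lemma locally_Cmod_lt (z : C) (r : R) : Cmod z < r -> locally z (fun w => Cmod w < r).
Proof.
  intros Hz. apply locally_Cmod. exists (r - Cmod z). split; [lra|].
  intros w Hw. pose proof (Cmod_triangle_rev w z). lra.
Qed.

Lemma cauchy_formula_derive (H H' : C -> C) (r0 r : R) (z : C) :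
  Cmod z < r -> r < r0 ->
  (forall w, Cmod w < r0 -> Cd H w (H' w)) -> (forall w, Cmod w < r0 -> continuous H' w) ->
  CInt (fun t => (H (cir r t) * cir r t / (cir r t - z) ^ 2)%C) 0 (2 * PI) = (RtoC (2 * PI) * H' z)%C.
Proof.
  intros Hz Hr Hd Hc. pose proof (Cmod_ge_0 z).
  assert (Hc' : forall t, continuous (fun t => (H (cir r t) * cir r t)%C) t).
  { intros t. apply continuous_Cmult; [|apply continuous_cir].
    apply continuous_cir_comp. eapply Cd_continuous, Hd. rewrite Cmod_cir; lra. }
  pose proof (Cd_cauchy_transform (fun t => (H (cir r t) * cir r t)%C) r 0 z Hz Hc') as D.
  rewrite Cmult_1_l in D.
  apply (Cd_unique _ _ _ _ D). clear D.
  apply Cd_ext_loc with (fun w => (RtoC (2 * PI) * H w)%C).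
  - generalize (locally_Cmod_lt z r Hz). apply filter_imp. intros w Hw.
    rewrite <- (cauchy_formula H H' r0 r w Hw Hr Hd Hc). apply CInt_ext. intros t _.
    simpl. field. apply cir_sub_neq_0; lra.
  - apply Cd_scal, Hd. lra.
Qed.

(** * Entire functions: derivatives, division by a linear factor, primitives on disks *)

Definition ent (f : C -> C) : Prop := forall z, exists l, Cd f z l.

Lemma ent_Cd (f : C -> C) (z : C) : ent f -> Cd f z (C_derive f z).
Proof. intros Hf. destruct (Hf z) as [l Hl]. now rewrite (Cd_C_derive _ _ _ Hl). Qed.

Lemma ent_continuous (f : C -> C) (z : C) : ent f -> continuous f z.
Proof. intros Hf. destruct (Hf z) as [l Hl]. now apply Cd_continuous with l. Qed.

Lemma entire_ent (f : C -> C) : entire f -> ent f.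
Proof.
  intros H z. destruct (H z) as [l Hl]. exists l. now apply is_derive_Cd.
Qed.

(** Cauchy's formula was proved for a continuous derivative. This is not yet known of [f], but it
    holds for a primitive [F], whose derivative is [f]. So [f] is a Cauchy type integral of the
    values of [F], and such an integral can be differentiated again and again. *)
Lemma ent_C_derive (f : C -> C) : ent f -> ent (C_derive f).
Proof.
  intros Hf z. destruct (goursat_primitive f Hf) as [F HF].
  set (r := Cmod z + 1). assert (Hz : Cmod z < r) by (unfold r; lra).
  pose proof (Cmod_ge_0 z).
  set (G := fun t => (F (cir r t) * cir r t)%C).
  assert (HG : forall t, continuous G t).
  { intros t. apply continuous_Cmult; [|apply continuous_cir].
    apply continuous_cir_comp. eapply Cd_continuous, HF. }
  set (k := (2 / RtoC (2 * PI))%C).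
  set (T := fun n w => CInt (fun t => (G t / (cir r t - w) ^ n)%C) 0 (2 * PI)).
  assert (E1 : forall w, Cmod w < r -> f w = (/ RtoC (2 * PI) * T 2%nat w)%C).
  { intros w Hw. unfold T, G.
    rewrite (cauchy_formula_derive F f (r + 1) r w); [|exact Hw | lra | |].
    - field. apply C2PI_neq_0.
    - intros; apply HF.
    - intros; now apply ent_continuous. }
  assert (E2 : forall w, Cmod w < r -> C_derive f w = (k * T 3%nat w)%C).
  { intros w Hw. apply Cd_C_derive.
    apply Cd_ext_loc with (fun w => (/ RtoC (2 * PI) * T 2%nat w)%C).
    - generalize (locally_Cmod_lt w r Hw). apply filter_imp. intros; symmetry; now apply E1.
    - eapply Cd_eq; [apply Cd_scal, (Cd_cauchy_transform G r 1 w Hw HG)|].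
      unfold k, T. simpl (INR 2). rewrite RtoC_plus. field. apply C2PI_neq_0. }
  eexists. apply Cd_ext_loc with (fun w => (k * T 3%nat w)%C).
  - generalize (locally_Cmod_lt z r Hz). apply filter_imp. intros; symmetry; now apply E2.
  - apply Cd_scal, (Cd_cauchy_transform G r 2 z Hz HG).
Qed.

Lemma ent_const (c : C) : ent (fun _ => c).
Proof. intros z. eexists. apply Cd_const. Qed.

Lemma ent_id : ent (fun z => z).
Proof. intros z. eexists. apply Cd_id. Qed.

Lemma ent_plus (f g : C -> C) : ent f -> ent g -> ent (fun z => (f z + g z)%C).
Proof. intros Hf Hg z. destruct (Hf z), (Hg z). eexists. apply Cd_plus; eassumption. Qed.

Lemma ent_minus (f g : C -> C) : ent f -> ent g -> ent (fun z => (f z - g z)%C).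
Proof. intros Hf Hg z. destruct (Hf z), (Hg z). eexists. apply Cd_minus; eassumption. Qed.

Lemma ent_mult (f g : C -> C) : ent f -> ent g -> ent (fun z => (f z * g z)%C).
Proof. intros Hf Hg z. destruct (Hf z), (Hg z). eexists. apply Cd_mult; eassumption. Qed.

Lemma ent_comp (f g : C -> C) : ent f -> ent g -> ent (fun z => f (g z)).
Proof. intros Hf Hg z. destruct (Hg z), (Hf (g z)). eexists. eapply Cd_comp; eassumption. Qed.

Lemma ent_cauchy (f : C -> C) (r : R) (z : C) :
  ent f -> Cmod z < r ->
  CInt (fun t => (f (cir r t) * (cir r t / (cir r t - z)))%C) 0 (2 * PI) = (RtoC (2 * PI) * f z)%C.
Proof.
  intros Hf Hz. apply (cauchy_formula f (C_derive f) (r + 1)); [exact Hz | lra | |].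
  - intros w _. now apply ent_Cd.
  - intros w _. now apply ent_continuous, ent_C_derive.
Qed.

Lemma ent_cauchy_derive (f : C -> C) (r : R) (z : C) :
  ent f -> Cmod z < r ->
  CInt (fun t => (f (cir r t) * cir r t / (cir r t - z) ^ 2)%C) 0 (2 * PI)
  = (RtoC (2 * PI) * C_derive f z)%C.
Proof.
  intros Hf Hz. apply (cauchy_formula_derive f (C_derive f) (r + 1)); [exact Hz | lra | |].
  - intros w _. now apply ent_Cd.
  - intros w _. now apply ent_continuous, ent_C_derive.
Qed.

(** Hadamard's formula: the quotient is the mean of [C_derive f] over the segment from [a] to [z],
    which is entire by differentiation under the integral, so no removable singularity arises. *)
Lemma ent_divide (f : C -> C) (a : C) :
  ent f -> exists f1, ent f1 /\ forall z, f z = (f a + (z - a) * f1 z)%C.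
Proof.
  intros Hf. pose proof (ent_C_derive f Hf) as Hf'. pose proof (ent_C_derive _ Hf') as Hf''.
  set (g := fun (t : R) (z : C) => (a + RtoC t * (z - a))%C).
  exists (fun z => CInt (fun t => C_derive f (g t z)) 0 1). split.
  - intros z. eexists.
    apply (Cd_CInt_param (fun t z => C_derive f (g t z))
      (fun t z => (C_derive (C_derive f) (g t z) * RtoC t)%C) 0 1 1); try lra.
    + intros t w _ _. eapply Cd_eq.
      * apply (Cd_comp (C_derive f) (g t)); [|now apply ent_Cd].
        apply Cd_plus; [apply Cd_const|]. apply Cd_scal, Cd_minus; [apply Cd_id | apply Cd_const].
      * ring.
    + intros t w _ _. apply (continuous_comp (fun s => g s w) (C_derive f)).
      * eapply Rd_continuous, Rd_segment.
      * now apply ent_continuous.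
    + intros t _. apply continuous_Cmult.
      * apply (continuous_comp (fun p : R * C => g (fst p) (snd p)) (C_derive (C_derive f)));
          [|now apply ent_continuous].
        apply continuous_Cplus; [apply continuous_const|].
        apply continuous_Cmult; [apply continuous_RtoC, continuous_fst_RC|].
        apply continuous_Cminus; [apply continuous_snd_RC | apply continuous_const].
      * apply continuous_RtoC, continuous_fst_RC.
  - intros z.
    assert (Hcg : cont_on (fun t => C_derive f (g t z)) 0 1).
    { intros t _. apply (continuous_comp (fun s => g s z) (C_derive f)).
      - eapply Rd_continuous, Rd_segment.
      - now apply ent_continuous. }
    rewrite <- CInt_scal by exact Hcg.
    rewrite (CInt_FTC (fun t => f (g t z))).
    + unfold g. replace (a + 1 * (z - a))%C with z by ring.
      replace (a + 0 * (z - a))%C with a by ring. ring.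
    + intros t _. eapply Rd_eq.
      * apply (Rd_Cd f (fun t => g t z)); [now apply ent_Cd | apply Rd_segment].
      * cbv beta. ring.
    + now apply cont_on_scal.
Qed.

(** Radial integration: differentiating [z * k (t * z)] in [z] yields the derivative of
    [t * k (t * z)] in [t], which integrates to [k z]. It is applied to G'/G, which is holomorphic
    only on a disk. *)
Lemma disk_primitive (k k' : C -> C) (r0 : R) :
  (forall w, Cmod w < r0 -> Cd k w (k' w)) -> (forall w, Cmod w < r0 -> continuous k' w) ->
  exists q : C -> C, q 0%C = 0%C /\ forall w, Cmod w < r0 -> Cd q w (k w).
Proof.
  intros Hd Hc.
  assert (Hm : forall t w, 0 <= t <= 1 -> Cmod w < r0 -> Cmod (RtoC t * w) < r0).
  { intros t w Ht Hw. rewrite Cmod_mult, Cmod_R, Rabs_pos_eq by lra.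
    pose proof (Cmod_ge_0 w). nra. }
  assert (Hline : forall w t, Rd (fun s => RtoC s * w)%C t w).
  { intros w t. eapply Rd_eq; [apply Rd_mult; [apply Rd_RtoC | apply Rd_const]|]. cbv beta. ring. }
  exists (fun z => CInt (fun t => (z * k (RtoC t * z))%C) 0 1). split.
  { rewrite (CInt_ext _ (fun _ => 0%C)) by (intros; ring). rewrite CInt_const. ring. }
  intros z Hz.
  assert (Hb : forall w, Cmod (w - z) < r0 - Cmod z -> Cmod w < r0).
  { intros w Hw. pose proof (Cmod_triangle_rev w z). lra. }
  eapply Cd_eq.
  - apply (Cd_CInt_param (fun t z => (z * k (RtoC t * z))%C)
      (fun t z => (k (RtoC t * z) + z * (k' (RtoC t * z) * RtoC t))%C) 0 1 (r0 - Cmod z)); try lra.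
    + intros t w Ht Hw. eapply Cd_eq.
      * apply Cd_mult; [apply Cd_id|]. apply (Cd_comp k (fun w => RtoC t * w)%C).
        -- apply Cd_scal, Cd_id.
        -- apply Hd, Hm; auto.
      * cbv beta. ring.
    + intros t w Ht Hw. apply continuous_Cmult; [apply continuous_const|].
      apply (continuous_comp (fun s => RtoC s * w)%C k).
      * eapply Rd_continuous, Hline.
      * eapply Cd_continuous, Hd, Hm; auto.
    + intros t Ht.
      assert (Ci1 : continuous (fun p : R * C => (RtoC (fst p) * snd p)%C) (t, z)).
      { apply continuous_Cmult; [apply continuous_RtoC, continuous_fst_RC | apply continuous_snd_RC]. }
      apply continuous_Cplus.
      * apply (continuous_comp (fun p : R * C => (RtoC (fst p) * snd p)%C) k); [exact Ci1|].
        eapply Cd_continuous, Hd, Hm; auto.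
      * apply continuous_Cmult; [apply continuous_snd_RC|].
        apply continuous_Cmult; [|apply continuous_RtoC, continuous_fst_RC].
        apply (continuous_comp (fun p : R * C => (RtoC (fst p) * snd p)%C) k'); [exact Ci1|].
        apply Hc, Hm; auto.
  - cbv beta. rewrite (CInt_FTC (fun t => (RtoC t * k (RtoC t * z))%C)).
    + rewrite !Cmult_1_l. ring.
    + intros t Ht. rewrite Rmin_left, Rmax_right in Ht by lra. eapply Rd_eq.
      * apply Rd_mult; [apply Rd_RtoC|].
        apply (Rd_Cd k (fun t => RtoC t * z)%C); [apply Hd, Hm; auto | apply Hline].
      * cbv beta. ring.
    + intros t Ht. rewrite Rmin_left, Rmax_right in Ht by lra.
      apply continuous_Cplus.
      * apply (continuous_comp (fun s => RtoC s * z)%C k).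
        -- eapply Rd_continuous, Hline.
        -- eapply Cd_continuous, Hd, Hm; auto.
      * apply continuous_Cmult; [apply continuous_const|]. apply continuous_Cmult.
        -- apply (continuous_comp (fun s => RtoC s * z)%C k').
           ++ eapply Rd_continuous, Hline.
           ++ apply Hc, Hm; auto.
        -- apply continuous_RtoC, continuous_id.
Qed.

(** * Holomorphic logarithms and the Schwarz bound *)

Definition cmean (h : R -> R) : R := / (2 * PI) * RInt h 0 (2 * PI).

Lemma ex_RInt_cont (h : R -> R) (a b : R) : (forall t, continuous h t) -> ex_RInt h a b.
Proof. intros H. apply (@ex_RInt_continuous R_CompleteNormedModule). intros; apply H. Qed.

Lemma cmean_plus (g h : R -> R) :
  (forall t, continuous g t) -> (forall t, continuous h t) ->
  cmean (fun t => g t + h t) = cmean g + cmean h.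
Proof.
  intros Hg Hh. unfold cmean. rewrite <- Rmult_plus_distr_l. f_equal.
  apply (@RInt_plus R_CompleteNormedModule g h); now apply ex_RInt_cont.
Qed.

Lemma cmean_scal (k : R) (h : R -> R) :
  (forall t, continuous h t) -> cmean (fun t => k * h t) = k * cmean h.
Proof.
  intros Hh. unfold cmean.
  replace (RInt (fun t => k * h t) 0 (2 * PI)) with (k * RInt h 0 (2 * PI)).
  - ring.
  - symmetry. apply (@RInt_scal R_CompleteNormedModule h). now apply ex_RInt_cont.
Qed.

Lemma cmean_const (k : R) : cmean (fun _ => k) = k.
Proof.
  unfold cmean. rewrite (@RInt_const R_CompleteNormedModule).
  unfold scal; simpl. unfold mult; simpl. field. pose proof PI_RGT_0. lra.
Qed.

Lemma cmean_ext (g h : R -> R) : (forall t, g t = h t) -> cmean g = cmean h.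
Proof.
  intros H. unfold cmean. f_equal. apply (@RInt_ext R_CompleteNormedModule). intros; apply H.
Qed.

Lemma cmean_le (g h : R -> R) :
  (forall t, continuous g t) -> (forall t, continuous h t) -> (forall t, g t <= h t) ->
  cmean g <= cmean h.
Proof.
  intros Hg Hh H. pose proof Rlt_0_2PI. unfold cmean. apply Rmult_le_compat_l.
  - apply Rlt_le, Rinv_0_lt_compat. lra.
  - apply RInt_le; [lra | now apply ex_RInt_cont | now apply ex_RInt_cont | intros; apply H].
Qed.

Lemma CInt_cmean (h : R -> C) (c : C) :
  CInt h 0 (2 * PI) = (RtoC (2 * PI) * c)%C -> cmean (fun t => fst (h t)) = fst c.
Proof.
  intros H. apply (f_equal fst) in H. simpl in H. unfold cmean. rewrite H.
  field. pose proof PI_RGT_0. lra.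
Qed.

Lemma CInt_cmean_bound (h : R -> C) (g : R -> R) (c : C) :
  (forall t, continuous h t) -> (forall t, continuous g t) ->
  (forall t, 0 <= t <= 2 * PI -> Cmod (h t) <= g t) ->
  CInt h 0 (2 * PI) = (RtoC (2 * PI) * c)%C -> Cmod c <= cmean g.
Proof.
  intros Hh Hg Hb E. pose proof Rlt_0_2PI as Hp. unfold cmean.
  apply Rmult_le_reg_l with (2 * PI); [exact Hp|].
  rewrite <- Rmult_assoc, Rinv_r, Rmult_1_l by lra.
  replace (2 * PI * Cmod c) with (Cmod (CInt h 0 (2 * PI))).
  - apply CInt_norm_RInt; [lra | | now apply ex_RInt_cont | auto].
    intros t _; apply Hh.
  - rewrite E, Cmod_mult, Cmod_R, Rabs_pos_eq; lra.
Qed.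

Lemma CInt_conj (h : R -> C) (a b : R) :
  cont_on h a b -> CInt (fun t => Cconj (h t)) a b = Cconj (CInt h a b).
Proof.
  intros H. unfold CInt, Cconj; simpl. f_equal.
  apply (@RInt_opp R_CompleteNormedModule (fun t => snd (h t))). now apply cont_on_Im.
Qed.

Lemma continuous_Cconj {U : UniformSpace} (h : U -> C) (x : U) :
  continuous h x -> continuous (fun t => Cconj (h t)) x.
Proof.
  intros H. apply continuous_pair; [now apply continuous_Re|].
  apply continuous_Ropp. now apply continuous_Im.
Qed.

Lemma continuous_Rabs_of {U : UniformSpace} (h : U -> R) (x : U) :
  continuous h x -> continuous (fun t => Rabs (h t)) x.
Proof. intros H. apply (continuous_comp h Rabs); [exact H | apply continuous_Rabs]. Qed.

Lemma Cconj_cir (r t : R) : r <> 0 -> Cconj (cir r t) = (RtoC (r ^ 2) / cir r t)%C.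
Proof.
  intros Hr.
  assert (E : (Cconj (cir r t) * cir r t)%C = RtoC (r ^ 2)).
  { unfold cir, Cconj, Cmult, RtoC; simpl. apply injective_projections; simpl; [|ring].
    pose proof (sin2_cos2 t) as E. unfold Rsqr in E.
    transitivity (r * r * (sin t * sin t + cos t * cos t)); [ring | rewrite E; ring]. }
  rewrite <- E. field. intros E0. rewrite E0 in E. rewrite Cmult_0_r in E.
  apply (RtoC_neq_0 (r ^ 2)); [now apply pow_nonzero | now symmetry].
Qed.

Lemma Cconj_RtoC (x : R) : Cconj (RtoC x) = RtoC x.
Proof. unfold Cconj, RtoC; simpl. now rewrite Ropp_0. Qed.

Lemma Cmod_conj_mult (a z : C) : Cmod (Cconj a * z) = Cmod a * Cmod z.
Proof. now rewrite Cmod_mult, Cmod_conj. Qed.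

Lemma Cminus_neq_0_Cmod (x y : C) : Cmod y < Cmod x -> (x - y)%C <> 0%C.
Proof.
  intros H E. pose proof (Cmod_triangle_rev x y) as H1. rewrite E, Cmod_0 in H1. lra.
Qed.

(* The conjugate of [q] integrates to zero against the Cauchy kernel, so the
   derivative is controlled by the real part alone. *)
Lemma derive_bound_by_real_part (q q' : C -> C) (r0 r : R) (z : C) :
  Cmod z < r -> r < r0 ->
  (forall w, Cmod w < r0 -> Cd q w (q' w)) -> (forall w, Cmod w < r0 -> continuous q' w) ->
  Cmod (q' z) <= 2 * r / (r - Cmod z) ^ 2 * cmean (fun t => Rabs (fst (q (cir r t)))).
Proof.
  intros Hz Hr0 Hd Hc. pose proof (Cmod_ge_0 z) as Hz0. assert (Hr : 0 < r) by lra.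
  assert (Hne : forall t, (cir r t - z)%C <> 0%C) by (intros t; apply cir_sub_neq_0; lra).
  assert (Hcq : forall t, continuous (fun t => q (cir r t)) t).
  { intros t. apply continuous_cir_comp. eapply Cd_continuous, Hd. rewrite Cmod_cir; lra. }
  assert (Hck : forall t, continuous (fun t => (cir r t / (cir r t - z) ^ 2)%C) t).
  { intros t. apply continuous_Cdiv; [apply continuous_cir | | now apply Cpow_nz].
    apply continuous_Cpow, continuous_Cminus; [apply continuous_cir | apply continuous_const]. }
  assert (I1 : CInt (fun t => (q (cir r t) * (cir r t / (cir r t - z) ^ 2))%C) 0 (2 * PI)
     = (RtoC (2 * PI) * q' z)%C).
  { rewrite <- (cauchy_formula_derive q q' r0 r z Hz Hr0 Hd Hc).
    apply CInt_ext. intros t _. field. now apply Hne. }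
  assert (I2 : CInt (fun t => (Cconj (q (cir r t)) * (cir r t / (cir r t - z) ^ 2))%C) 0 (2 * PI) = 0%C).
  { rewrite <- (Cconj_conj (CInt _ _ _)). rewrite <- CInt_conj.
    2:{ intros t _. apply continuous_Cmult; [apply continuous_Cconj, Hcq | apply Hck]. }
    (* On the circle the conjugate of w is r^2/w, so the conjugated integrand is the boundary value
       of this function. It is holomorphic past the circle and vanishes at 0, hence has mean 0. *)
    set (K := fun w => (q w * (RtoC (r ^ 2) * w / (RtoC (r ^ 2) - Cconj z * w) ^ 2))%C).
    set (K' := fun w => (q' w * (RtoC (r ^ 2) * w / (RtoC (r ^ 2) - Cconj z * w) ^ 2)
       + q w * (RtoC (r ^ 2) * ((RtoC (r ^ 2) - Cconj z * w) + 2 * w * Cconj z)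
           / (RtoC (r ^ 2) - Cconj z * w) ^ 3))%C).
    (* Since [Cmod z * (2 * r - Cmod z) <= r ^ 2], the denominator of [K] has no zero in the disk of
       radius [r1]. *)
    set (r1 := Rmin r0 (2 * r - Cmod z)).
    assert (Hr1 : r < r1) by (apply Rmin_glb_lt; lra).
    assert (Hden : forall w, Cmod w < r1 -> (RtoC (r ^ 2) - Cconj z * w)%C <> 0%C).
    { intros w Hw. apply Cminus_neq_0_Cmod.
      rewrite Cmod_conj_mult, Cmod_R, Rabs_pos_eq by (apply pow_le; lra).
      assert (Cmod w < 2 * r - Cmod z) by (eapply Rlt_le_trans; [exact Hw | apply Rmin_r]).
      pose proof (Cmod_ge_0 w). nra. }
    assert (Hr1r0 : r1 <= r0) by apply Rmin_l.
    assert (IK : CInt (fun t => (K (cir r t) * (cir r t / (cir r t - 0)))%C) 0 (2 * PI)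
      = (RtoC (2 * PI) * K 0)%C).
    { apply (cauchy_formula K K' r1 r 0%C).
      - now rewrite Cmod_0.
      - exact Hr1.
      - intros w Hw. eapply Cd_eq.
        + apply Cd_mult; [apply Hd; lra|]. unfold Cdiv. apply Cd_mult.
          * apply Cd_scal, Cd_id.
          * apply (Cd_inv (fun w => (RtoC (r ^ 2) - Cconj z * w) ^ 2)%C).
            -- apply (Cd_comp (fun x => (x ^ 2)%C) (fun w => (RtoC (r ^ 2) - Cconj z * w)%C)); [|apply Cd_pow].
               apply Cd_minus; [apply Cd_const | apply Cd_scal, Cd_id].
            -- apply Cpow_nz. now apply Hden.
        + unfold K'. simpl INR. rewrite RtoC_plus. simpl. field. now apply Hden.
      - intros w Hw. specialize (Hden w Hw).
        assert (C1 : continuous (fun w => RtoC (r ^ 2) - Cconj z * w)%C w).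
        { apply continuous_Cminus; [apply continuous_const|].
          apply continuous_Cmult; [apply continuous_const | apply continuous_id]. }
        assert (C2 : continuous q w) by (eapply Cd_continuous, Hd; lra).
        assert (C3 : continuous q' w) by (apply Hc; lra).
        apply continuous_Cplus; (apply continuous_Cmult; [assumption|]);
          (apply continuous_Cdiv; [| now apply continuous_Cpow | now apply Cpow_nz]).
        + apply continuous_Cmult; [apply continuous_const | apply continuous_id].
        + apply continuous_Cmult; [apply continuous_const|]. apply continuous_Cplus; [exact C1|].
          apply continuous_Cmult; [|apply continuous_const].
          apply continuous_Cmult; [apply continuous_const | apply continuous_id]. }
    assert (K0 : K 0%C = 0%C).
    { unfold K, Cdiv. rewrite (Cmult_0_r (RtoC (r ^ 2))), Cmult_0_l. apply Cmult_0_r. }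
    rewrite K0, Cmult_0_r in IK.
    transitivity (Cconj 0%C); [|apply Cconj_RtoC].
    f_equal. rewrite <- IK. apply CInt_ext. intros t _.
    assert (Hc0 : cir r t <> 0%C).
    { intros E. pose proof (Cmod_cir r t (Rlt_le _ _ Hr)) as E1. rewrite E, Cmod_0 in E1. lra. }
    assert (Hd0 : (RtoC (r ^ 2) - Cconj z * cir r t)%C <> 0%C).
    { apply Hden. rewrite Cmod_cir; lra. }
    assert (Ek : Cconj (cir r t / (cir r t - z) ^ 2) = (RtoC (r ^ 2) * cir r t / (RtoC (r ^ 2) - Cconj z * cir r t) ^ 2)%C).
    { assert (Hz2 : (cir r t - z)%C <> 0%C) by apply Hne.
      rewrite Cdiv_conj by now apply Cpow_nz.
      rewrite Cpow_conj, Cminus_conj, Cconj_cir by lra.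
      set (R2 := RtoC (r ^ 2)) in *. field. now split. }
    rewrite Cmult_conj, Cconj_conj, Ek. unfold K.
    replace (cir r t - 0)%C with (cir r t) by ring.
    set (R2 := RtoC (r ^ 2)) in *. field. now split. }
  rewrite <- cmean_scal by (intros t; apply continuous_Rabs_of, continuous_Re, Hcq).
  apply (CInt_cmean_bound (fun t => (RtoC (2 * fst (q (cir r t))) * (cir r t / (cir r t - z) ^ 2))%C)).
  - intros t. apply continuous_Cmult; [|apply Hck]. apply continuous_RtoC.
    apply continuous_Rmult; [apply continuous_const | apply continuous_Re, Hcq].
  - intros t. apply continuous_Rmult; [apply continuous_const|].
    apply continuous_Rabs_of, continuous_Re, Hcq.
  - intros t _. rewrite Cmod_mult, Cmod_R, Cmod_div by now apply Cpow_nz.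
    rewrite Cmod_pow, Cmod_cir by lra. rewrite Rabs_mult, (Rabs_pos_eq 2) by lra.
    pose proof (cir_sub_ge r t z (Rlt_le _ _ Hr)) as Hge.
    assert (Hi : r / Cmod (cir r t - z) ^ 2 <= r / (r - Cmod z) ^ 2).
    { apply Rmult_le_compat_l; [lra|]. apply Rinv_le_contravar; [apply pow_lt; lra|].
      apply pow_incr. lra. }
    pose proof (Rabs_pos (fst (q (cir r t)))).
    replace (2 * r / (r - Cmod z) ^ 2 * Rabs (fst (q (cir r t))))
      with (2 * Rabs (fst (q (cir r t))) * (r / (r - Cmod z) ^ 2)) by (field; lra).
    apply Rmult_le_compat_l; [lra | exact Hi].
  - rewrite <- I1.
    transitivity (CInt (fun t => (q (cir r t) * (cir r t / (cir r t - z) ^ 2))%C) 0 (2 * PI)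
       + CInt (fun t => (Cconj (q (cir r t)) * (cir r t / (cir r t - z) ^ 2))%C) 0 (2 * PI))%C.
    + rewrite <- CInt_plus.
      * apply CInt_ext. intros t _. rewrite <- Cmult_plus_distr_r. f_equal.
        apply injective_projections; simpl; ring.
      * intros t _. apply continuous_Cmult; [apply Hcq | apply Hck].
      * intros t _. apply continuous_Cmult; [apply continuous_Cconj, Hcq | apply Hck].
    + rewrite I2. ring.
Qed.

Lemma is_derive_ln_Cmod (g : R -> C) (t : R) (v : C) :
  Rd g t v -> g t <> 0%C -> is_derive (fun s => ln (Cmod (g s))) t (fst (v / g t)%C).
Proof.
  intros Hg H0. pose proof (Rd_Re _ _ _ Hg) as H1. pose proof (Rd_Im _ _ _ Hg) as H2.
  set (x := fun s => fst (g s)) in *. set (y := fun s => snd (g s)) in *.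
  assert (Hp : 0 < x t ^ 2 + y t ^ 2).
  { unfold x, y. destruct (Req_EM_T (fst (g t)) 0) as [E1|E1].
    - destruct (Req_EM_T (snd (g t)) 0) as [E2|E2]; [|nra].
      exfalso. apply H0. now apply injective_projections.
    - nra. }
  assert (D : is_derive (fun s => / 2 * ln (x s ^ 2 + y s ^ 2)) t
    ((x t * fst v + y t * snd v) / (x t ^ 2 + y t ^ 2))).
  { auto_derive.
    - split; [eexists; exact H1|]. split; [eexists; exact H2|]. split; [|trivial].
      simpl in Hp; rewrite !Rmult_1_r in *. lra.
    - replace (Derive (fun x0 => x x0) t) with (fst v) by (symmetry; now apply is_derive_unique).
      replace (Derive (fun x0 => y x0) t) with (snd v) by (symmetry; now apply is_derive_unique).
      field. simpl in *. lra. }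
  replace (fst (v / g t)%C) with ((x t * fst v + y t * snd v) / (x t ^ 2 + y t ^ 2)).
  2:{ unfold x, y in *. destruct (g t) as [p q]. destruct v as [v1 v2]. simpl in *. field. lra. }
  apply (is_derive_ext_loc (fun s => / 2 * ln (x s ^ 2 + y s ^ 2))); [|exact D].
  assert (Hl : locally t (fun s => 0 < Cmod (g s))).
  { pose proof (continuous_Cmod_comp g t (Rd_continuous _ _ _ Hg)) as Hc.
    apply (Hc (fun u => 0 < u)). apply locally_open with (D := fun u => 0 < u).
    - apply open_gt.
    - auto.
    - now apply Cmod_gt_0. }
  generalize Hl. apply filter_imp. intros s Hs. unfold x, y.
  assert (E : fst (g s) ^ 2 + snd (g s) ^ 2 = Cmod (g s) * Cmod (g s)).
  { unfold Cmod. rewrite sqrt_sqrt; [reflexivity|]. nra. }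
  rewrite E, ln_mult by assumption. lra.
Qed.

(** Only the real part of the logarithm is wanted: along each ray from 0, the real part of a
    primitive of G'/G and ln |G| have the same derivative, and the additive constant matches them at
    0. *)
Lemma log_branch (G : C -> C) (r0 : R) :
  0 < r0 -> ent G -> (forall w, Cmod w < r0 -> G w <> 0%C) ->
  exists q, (forall w, Cmod w < r0 -> Cd q w (C_derive G w / G w)%C) /\
    (forall w, Cmod w < r0 -> continuous (fun w => C_derive G w / G w)%C w) /\
    (forall w, Cmod w < r0 -> fst (q w) = ln (Cmod (G w))).
Proof.
  intros Hr0 HG Hn. pose proof (ent_C_derive G HG) as HG1. pose proof (ent_C_derive _ HG1) as HG2.
  assert (Hcont : forall w, Cmod w < r0 -> continuous (fun w => C_derive G w / G w)%C w).
  { intros w Hw. apply continuous_Cdiv; [now apply ent_continuous | now apply ent_continuous | now apply Hn]. }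
  destruct (disk_primitive (fun w => C_derive G w / G w)%C
    (fun w => (C_derive (C_derive G) w * G w - C_derive G w * C_derive G w) / (G w * G w))%C r0)
    as [q0 [Hq0 Hq]].
  - intros w Hw. eapply Cd_eq.
    + unfold Cdiv. apply Cd_mult; [now apply ent_Cd|]. apply Cd_inv; [now apply ent_Cd | now apply Hn].
    + cbv beta. field. now apply Hn.
  - intros w Hw. apply continuous_Cdiv.
    + apply continuous_Cminus; apply continuous_Cmult; now apply ent_continuous.
    + apply continuous_Cmult; now apply ent_continuous.
    + apply Cmult_neq_0; now apply Hn.
  - exists (fun w => (q0 w + RtoC (ln (Cmod (G 0%C))))%C). split; [|split].
    + intros w Hw. eapply Cd_eq; [apply Cd_plus; [now apply Hq | apply Cd_const] | ring].
    + exact Hcont.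
    + intros w Hw. simpl.
      assert (Hline : forall t, Rd (fun s => RtoC s * w)%C t w).
      { intros t. eapply Rd_eq; [apply Rd_mult; [apply Rd_RtoC | apply Rd_const]|]. cbv beta. ring. }
      assert (Hm : forall t, 0 <= t <= 1 -> Cmod (RtoC t * w) < r0).
      { intros t Ht. rewrite Cmod_mult, Cmod_R, Rabs_pos_eq by lra. pose proof (Cmod_ge_0 w). nra. }
      assert (E : ln (Cmod (G (RtoC 0 * w)%C)) - fst (q0 (RtoC 0 * w)%C)
         = ln (Cmod (G (RtoC 1 * w)%C)) - fst (q0 (RtoC 1 * w)%C)).
      { apply (@eq_is_derive R_NormedModule (fun t => ln (Cmod (G (RtoC t * w)%C)) - fst (q0 (RtoC t * w)%C))); [|lra].
        intros t Ht.
        replace (@zero R_NormedModule) with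
          (minus (fst ((C_derive G (RtoC t * w) * w) / G (RtoC t * w))%C)
                 (fst ((C_derive G (RtoC t * w) / G (RtoC t * w)) * w)%C) : R).
        - apply (@is_derive_minus R_AbsRing R_NormedModule).
          + apply (is_derive_ln_Cmod (fun t => G (RtoC t * w)%C)).
            * apply (Rd_Cd G (fun t => RtoC t * w)%C); [now apply ent_Cd | apply Hline].
            * now apply Hn, Hm.
          + apply (Rd_Re (fun t => q0 (RtoC t * w)%C)).
            apply (Rd_Cd q0 (fun t => RtoC t * w)%C); [now apply Hq, Hm | apply Hline].
        - replace (C_derive G (RtoC t * w) * w / G (RtoC t * w))%C
            with (C_derive G (RtoC t * w) / G (RtoC t * w) * w)%C by (field; now apply Hn, Hm).
          apply (@minus_eq_zero R_AbelianGroup). }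
      rewrite Cmult_0_l, Cmult_1_l, Hq0 in E. simpl in E. lra.
Qed.

(** * Zeros and Blaschke factors *)

(** Lists of zeros may repeat an entry; repetition encodes multiplicity. *)
Fixpoint prodl (l : list C) (z : C) : C :=
  match l with nil => 1%C | a :: l => ((z - a) * prodl l z)%C end.

Fixpoint sumR (g : C -> R) (l : list C) : R :=
  match l with nil => 0 | a :: l => g a + sumR g l end.

Lemma prodl_app (l m : list C) (z : C) : prodl (l ++ m) z = (prodl l z * prodl m z)%C.
Proof. induction l as [|a l IH]; simpl; [ring | rewrite IH; ring]. Qed.

Lemma sumR_app (g : C -> R) (l m : list C) : sumR g (l ++ m) = sumR g l + sumR g m.
Proof. induction l as [|a l IH]; simpl; [ring | rewrite IH; ring]. Qed.

Lemma sumR_le (g h : C -> R) (l : list C) :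
  (forall a, In a l -> g a <= h a) -> sumR g l <= sumR h l.
Proof.
  induction l as [|a l IH]; simpl; intros H; [lra|].
  pose proof (H a (or_introl eq_refl)). specialize (IH (fun b Hb => H b (or_intror Hb))). lra.
Qed.

Lemma sumR_const (k : R) (l : list C) : sumR (fun _ => k) l = INR (length l) * k.
Proof.
  induction l as [|a l IH]; [simpl; ring|]. simpl sumR. simpl length.
  rewrite IH, S_INR. ring.
Qed.

Lemma sumR_minus (g h : C -> R) (l : list C) :
  sumR (fun a => g a - h a) l = sumR g l - sumR h l.
Proof. induction l as [|a l IH]; simpl; [ring | rewrite IH; ring]. Qed.

Lemma ent_prodl (l : list C) : ent (prodl l).
Proof.
  induction l as [|a l IH]; simpl; [apply ent_const|].
  apply (ent_mult (fun z => z - a)%C); [|exact IH].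
  apply ent_minus; [apply ent_id | apply ent_const].
Qed.

Lemma prodl_eq_0 (l : list C) (z : C) : prodl l z = 0%C <-> In z l.
Proof.
  induction l as [|a l IH]; simpl.
  - split; [apply C1_nz | tauto].
  - split.
    + intros E. destruct (Ceq_dec z a) as [H|H]; [now left|]. right. apply IH.
      destruct (Ceq_dec (prodl l z) 0%C) as [E0|E0]; [exact E0|].
      exfalso. revert E. apply Cmult_neq_0; [|exact E0]. now apply Cminus_eq_contra.
    + intros [->|H]; [rewrite Cminus_diag; ring|]. apply IH in H. rewrite H. ring.
Qed.

Lemma circle_bound (f : C -> C) (r : R) : ent f ->
  exists M, 0 < M /\ forall t, 0 <= t <= 2 * PI -> Cmod (f (cir r t)) <= M.
Proof.
  intros Hf.
  destruct (@bounded_continuity R_AbsRing R_NormedModule (fun t => Cmod (f (cir r t))) 0 (2 * PI)) as [M HM].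
  - intros t _. apply (continuous_Cmod_comp (fun t => f (cir r t))), continuous_cir_comp.
    now apply ent_continuous.
  - exists (Rmax M 1). split; [eapply Rlt_le_trans; [apply Rlt_0_1 | apply Rmax_r]|].
    intros t Ht. specialize (HM t Ht). apply Rle_trans with M; [|apply Rmax_l].
    unfold norm in HM; simpl in HM. unfold abs in HM; simpl in HM.
    rewrite Rabs_pos_eq in HM by apply Cmod_ge_0. lra.
Qed.

Lemma ent_bound_inside (f : C -> C) (r M : R) (z : C) :
  ent f -> Cmod z < r -> (forall t, 0 <= t <= 2 * PI -> Cmod (f (cir r t)) <= M) ->
  Cmod (f z) <= M * (r / (r - Cmod z)).
Proof.
  intros Hf Hz HM. pose proof (Cmod_ge_0 z).
  rewrite <- (cmean_const (M * (r / (r - Cmod z)))).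
  apply (CInt_cmean_bound (fun t => (f (cir r t) * (cir r t / (cir r t - z)))%C)).
  - intros t. apply continuous_Cmult; [now apply continuous_cir_comp, ent_continuous|].
    apply continuous_Cdiv; [apply continuous_cir | | apply cir_sub_neq_0; lra].
    apply continuous_Cminus; [apply continuous_cir | apply continuous_const].
  - intros t. apply continuous_const.
  - intros t Ht. rewrite Cmod_mult. apply Rmult_le_compat; try apply Cmod_ge_0; auto.
    rewrite Cmod_div by (apply cir_sub_neq_0; lra). rewrite Cmod_cir by lra.
    apply Rmult_le_compat_l; [lra|]. apply Rinv_le_contravar; [lra|].
    apply cir_sub_ge. lra.
  - now apply ent_cauchy.
Qed.

Lemma prodl_upper (l : list C) (z : C) (r : R) :
  (forall a, In a l -> Cmod a <= r) -> Cmod z <= r -> Cmod (prodl l z) <= (2 * r) ^ length l.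
Proof.
  intros Hl Hz. induction l as [|a l IH]; simpl; [rewrite Cmod_1; lra|].
  rewrite Cmod_mult. apply Rmult_le_compat; try apply Cmod_ge_0.
  - eapply Rle_trans; [apply Cmod_triangle_sub|]. specialize (Hl a (or_introl eq_refl)). lra.
  - apply IH. intros b Hb. apply Hl. now right.
Qed.

Lemma prodl_lower (l : list C) (z : C) (r d : R) :
  0 <= d -> (forall a, In a l -> Cmod a <= r) -> r + d <= Cmod z -> d ^ length l <= Cmod (prodl l z).
Proof.
  intros Hd Hl Hz. induction l as [|a l IH]; simpl; [rewrite Cmod_1; lra|].
  rewrite Cmod_mult. apply Rmult_le_compat; [exact Hd | now apply pow_le | |].
  - pose proof (Cmod_triangle_rev z a). specialize (Hl a (or_introl eq_refl)). lra.
  - apply IH. intros b Hb. apply Hl. now right.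
Qed.

(** On the circle of radius [5 * s] every linear factor is at least [4 * s], while at [z0] it is at
    most [2 * s]. Each zero divided out therefore halves the bound on [G z0], and too many would
    force [G z0 = 0]. *)
Lemma factor_bound (G : C -> C) (z0 : C) (r : R) :
  ent G -> G z0 <> 0%C ->
  exists N, forall l G1, ent G1 -> (forall z, G z = (prodl l z * G1 z)%C) ->
    (forall a, In a l -> Cmod a <= r) -> (length l < N)%nat.
Proof.
  intros HG Hz0.
  set (s := Rmax r (Cmod z0 + 1)).
  assert (Hs1 : r <= s) by apply Rmax_l.
  assert (Hs2 : Cmod z0 + 1 <= s) by apply Rmax_r.
  pose proof (Cmod_ge_0 z0) as Hz.
  destruct (circle_bound G (5 * s) HG) as [M [HM0 HM]].
  apply Cmod_gt_0 in Hz0.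
  destruct (pow_half_small (5 / 4 * M) (Cmod (G z0)) Hz0) as [N HN].
  exists N. intros l G1 HG1 E Hl. apply Nat.nle_gt. intros Hlen.
  set (n := length l) in *.
  assert (Hl' : forall a, In a l -> Cmod a <= s) by (intros a Ha; specialize (Hl a Ha); lra).
  assert (Hp4 : 0 < (4 * s) ^ n) by (apply pow_lt; lra).
  assert (B1 : forall t, 0 <= t <= 2 * PI -> Cmod (G1 (cir (5 * s) t)) <= M / (4 * s) ^ n).
  { intros t Ht. specialize (HM t Ht). rewrite E, Cmod_mult in HM.
    assert (L : (4 * s) ^ n <= Cmod (prodl l (cir (5 * s) t))).
    { apply (prodl_lower l _ s); [lra | exact Hl'|]. rewrite Cmod_cir; lra. }
    apply Rmult_le_reg_r with ((4 * s) ^ n); [exact Hp4|].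
    unfold Rdiv. rewrite Rmult_assoc, Rinv_l, Rmult_1_r by lra.
    pose proof (Cmod_ge_0 (G1 (cir (5 * s) t))). nra. }
  pose proof (ent_bound_inside G1 (5 * s) _ z0 HG1 ltac:(lra) B1) as B2.
  assert (B3 : 5 * s / (5 * s - Cmod z0) <= 5 / 4).
  { apply Rmult_le_reg_r with (5 * s - Cmod z0); [lra|].
    unfold Rdiv at 1. rewrite Rmult_assoc, Rinv_l by lra. lra. }
  assert (B4 : Cmod (prodl l z0) <= (2 * s) ^ n) by (apply prodl_upper; [exact Hl' | lra]).
  assert (B5 : Cmod (G z0) <= 5 / 4 * M / 2 ^ n).
  { rewrite E, Cmod_mult.
    apply Rle_trans with ((2 * s) ^ n * (M / (4 * s) ^ n * (5 / 4))).
    - apply Rmult_le_compat; try apply Cmod_ge_0; trivial.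
      eapply Rle_trans; [exact B2|]. apply Rmult_le_compat_l; [|exact B3].
      apply Rlt_le, Rdiv_lt_0_compat; lra.
    - replace (4 * s) with (2 * (2 * s)) by ring. rewrite (Rpow_mult_distr 2 (2 * s)).
      right. field. split; apply pow_nonzero; lra. }
  assert (B6 : 5 / 4 * M / 2 ^ n <= 5 / 4 * M / 2 ^ N).
  { apply Rmult_le_compat_l; [lra|]. apply Rinv_le_contravar; [apply pow_lt; lra|].
    apply Rle_pow; [lra | exact Hlen]. }
  lra.
Qed.

(** Zeros in [P] are divided out one at a time; [factor_bound] limits the number of steps. This
    gives finiteness of zeros and their orders at once. [P] will be a closed disk or a single
    point. *)
Lemma factor_exists (G : C -> C) (z0 : C) (P : C -> Prop) (r : R) :
  ent G -> G z0 <> 0%C -> (forall a, P a -> Cmod a <= r) ->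
  exists l G1, ent G1 /\ (forall z, G z = (prodl l z * G1 z)%C) /\
    (forall a, In a l -> P a) /\ (forall a, P a -> G1 a <> 0%C).
Proof.
  intros HG Hz0 HP. destruct (factor_bound G z0 r HG Hz0) as [N HN].
  assert (H : forall m l G1, ent G1 -> (forall z, G z = (prodl l z * G1 z)%C) ->
    (forall a, In a l -> P a) -> (N <= length l + m)%nat ->
    exists l G1, ent G1 /\ (forall z, G z = (prodl l z * G1 z)%C) /\
    (forall a, In a l -> P a) /\ (forall a, P a -> G1 a <> 0%C)).
  { induction m as [|m IH]; intros l G1 HG1 E Hl Hlen.
    - exfalso. specialize (HN l G1 HG1 E (fun a Ha => HP a (Hl a Ha))). lia.
    - destruct (classic (exists a, P a /\ G1 a = 0%C)) as [[a [Ha E0]]|Hno].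
      + destruct (ent_divide G1 a HG1) as [G2 [HG2 E2]].
        apply (IH (a :: l) G2); trivial.
        * intros z. rewrite E, E2, E0. simpl. ring.
        * intros b [<-|Hb]; auto.
        * simpl. lia.
      + exists l, G1. split; [exact HG1|]. split; [exact E|]. split; [exact Hl|].
        intros a Ha E0. apply Hno. now exists a. }
  apply (H N nil G); [exact HG | intros; simpl; ring | intros a [] | simpl; lia].
Qed.

Lemma list_gap (l : list C) (r s : R) :
  r < s -> (forall a, In a l -> r < Cmod a) ->
  exists r0, r < r0 /\ r0 <= s /\ forall a, In a l -> r0 <= Cmod a.
Proof.
  intros Hs. induction l as [|a l IH]; intros Hl.
  - exists s. split; [exact Hs | split; [lra | intros a []]].
  - destruct IH as [r0 [H1 [H2 H3]]]; [intros b Hb; apply Hl; now right|].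
    pose proof (Hl a (or_introl eq_refl)) as Ha.
    exists (Rmin r0 (Cmod a)). split; [now apply Rmin_glb_lt|]. split.
    + eapply Rle_trans; [apply Rmin_l | exact H2].
    + intros b [<-|Hb]; [apply Rmin_r|]. eapply Rle_trans; [apply Rmin_l | auto].
Qed.

(** A logarithm is needed slightly beyond the circle; the finitely many zeros in the disk of twice
    the radius leave a gap. *)
Lemma zero_free_larger (Y : C -> C) (r : R) :
  ent Y -> 0 < r -> (forall z, Cmod z <= r -> Y z <> 0%C) ->
  exists r0, r < r0 /\ forall z, Cmod z < r0 -> Y z <> 0%C.
Proof.
  intros HY Hr H.
  destruct (factor_exists Y 0%C (fun a => Cmod a <= 2 * r) (2 * r) HY) as [l [Y1 [HY1 [E [Hl Hn]]]]].
  - apply H. rewrite Cmod_0. lra.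
  - auto.
  - destruct (list_gap l r (2 * r)) as [r0 [H1 [H2 H3]]]; [lra | |].
    + intros a Ha. apply Rnot_le_lt. intros Hle. apply (H a Hle). rewrite E.
      rewrite (proj2 (prodl_eq_0 l a) Ha). ring.
    + exists r0. split; [exact H1|]. intros z Hz. rewrite E. apply Cmult_neq_0.
      * intros E0. apply prodl_eq_0 in E0. specialize (H3 z E0). lra.
      * apply Hn. lra.
Qed.

(* The Blaschke factors [(z - a) / blf r a z] have modulus 1 on [|z| = r]. *)
Definition blf (r : R) (a z : C) : C := ((RtoC (r ^ 2) - Cconj a * z) / RtoC r)%C.

Fixpoint blp (r : R) (l : list C) (z : C) : C :=
  match l with nil => 1%C | a :: l => (blf r a z * blp r l z)%C end.

Lemma Cd_blf (r : R) (a z : C) : Cd (blf r a) z (- Cconj a / RtoC r)%C.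
Proof.
  unfold blf, Cdiv. eapply Cd_eq.
  - apply Cd_mult; [|apply Cd_const]. apply Cd_minus; [apply Cd_const | apply Cd_scal, Cd_id].
  - cbv beta. ring.
Qed.

Lemma ent_blp (r : R) (l : list C) : ent (blp r l).
Proof.
  induction l as [|a l IH]; simpl; [apply ent_const|].
  apply (ent_mult (blf r a)); [|exact IH]. intros z. eexists. apply Cd_blf.
Qed.

Lemma Cmod_blf_cir (r : R) (a : C) (t : R) :
  0 < r -> Cmod (blf r a (cir r t)) = Cmod (cir r t - a).
Proof.
  intros Hr. unfold blf.
  assert (Hc0 : cir r t <> 0%C).
  { intros E. pose proof (Cmod_cir r t (Rlt_le _ _ Hr)) as E1. rewrite E, Cmod_0 in E1. lra. }
  rewrite Cmod_div by (apply RtoC_neq_0; lra).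
  replace (RtoC (r ^ 2) - Cconj a * cir r t)%C with (Cconj (cir r t - a) * cir r t)%C.
  - rewrite Cmod_mult, Cmod_conj, Cmod_cir, Cmod_R, Rabs_pos_eq by lra. field. lra.
  - rewrite Cminus_conj, Cconj_cir by lra. field. exact Hc0.
Qed.

Lemma Cmod_sqr (z : C) : Cmod z ^ 2 = fst z ^ 2 + snd z ^ 2.
Proof. apply Cmod2_alt. Qed.

(** After scaling by [r], the difference of the squares of the two sides is (r^2 - |a|^2)(r^2 -
    |z|^2). *)
Lemma Cmod_blf_ge (r : R) (a z : C) :
  0 < r -> Cmod a <= r -> Cmod z <= r -> Cmod (z - a) <= Cmod (blf r a z).
Proof.
  intros Hr Ha Hz. unfold blf. rewrite Cmod_div by (apply RtoC_neq_0; lra).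
  rewrite Cmod_R, Rabs_pos_eq by lra.
  apply Rmult_le_reg_r with r; [exact Hr|].
  unfold Rdiv. rewrite Rmult_assoc, Rinv_l, Rmult_1_r by lra.
  apply Rsqr_incr_0; [| pose proof (Cmod_ge_0 (z - a)); nra | apply Cmod_ge_0].
  rewrite Rsqr_mult. rewrite !Rsqr_pow2, !Cmod_sqr.
  pose proof (Cmod_sqr a) as Ea. pose proof (Cmod_sqr z) as Ez.
  pose proof (Cmod_ge_0 a). pose proof (Cmod_ge_0 z).
  assert (P : 0 <= (r ^ 2 - Cmod a ^ 2) * (r ^ 2 - Cmod z ^ 2)).
  { apply Rmult_le_pos; nra. }
  rewrite Ea, Ez in P. destruct a as [a1 a2]. destruct z as [z1 z2].
  unfold RtoC, Cconj, Cminus, Cmult, Cplus, Copp in *; simpl fst in *; simpl snd in *.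
  nra.
Qed.

Lemma blf_neq_0 (r : R) (a z : C) :
  0 < r -> Cmod a < r -> Cmod z <= r -> blf r a z <> 0%C.
Proof.
  intros Hr Ha Hz. unfold blf. unfold Cdiv. apply Cmult_neq_0.
  - apply Cminus_neq_0_Cmod. rewrite Cmod_conj_mult, Cmod_R, Rabs_pos_eq by (apply pow_le; lra).
    pose proof (Cmod_ge_0 z). pose proof (Cmod_ge_0 a). nra.
  - rewrite <- RtoC_inv by lra. apply RtoC_neq_0, Rinv_neq_0_compat. lra.
Qed.

Lemma blp_neq_0 (r : R) (l : list C) (z : C) :
  0 < r -> (forall a, In a l -> Cmod a < r) -> Cmod z <= r -> blp r l z <> 0%C.
Proof.
  intros Hr Hl Hz. induction l as [|a l IH]; simpl; [apply C1_nz|].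
  apply Cmult_neq_0.
  - apply blf_neq_0; trivial. apply Hl. now left.
  - apply IH. intros b Hb. apply Hl. now right.
Qed.

Lemma Cmod_blp_cir (r : R) (l : list C) (t : R) :
  0 < r -> Cmod (blp r l (cir r t)) = Cmod (prodl l (cir r t)).
Proof.
  intros Hr. induction l as [|a l IH]; simpl; [reflexivity|].
  now rewrite !Cmod_mult, IH, Cmod_blf_cir.
Qed.

Lemma Cmod_blp_ge (r : R) (l : list C) (z : C) :
  0 < r -> (forall a, In a l -> Cmod a <= r) -> Cmod z <= r ->
  Cmod (prodl l z) <= Cmod (blp r l z).
Proof.
  intros Hr Hl Hz. induction l as [|a l IH]; simpl; [lra|].
  rewrite !Cmod_mult. apply Rmult_le_compat; try apply Cmod_ge_0.
  - apply Cmod_blf_ge; trivial. apply Hl. now left.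
  - apply IH. intros b Hb. apply Hl. now right.
Qed.

Lemma Cmod_blp_0 (r : R) (l : list C) : 0 < r -> Cmod (blp r l 0%C) = r ^ length l.
Proof.
  intros Hr. induction l as [|a l IH]; simpl; [apply Cmod_1|].
  rewrite Cmod_mult, IH. f_equal. unfold blf. rewrite Cmult_0_r.
  replace ((RtoC (r ^ 2) - 0) / RtoC r)%C with (RtoC r).
  - rewrite Cmod_R. apply Rabs_pos_eq. lra.
  - simpl pow. rewrite Rmult_1_r, RtoC_mult. field. apply RtoC_neq_0. lra.
Qed.

(** * Jensen's formula and logarithmic derivatives *)

Definition factors (G : C -> C) (r : R) (l : list C) (G1 : C -> C) : Prop :=
  ent G1 /\ (forall z, G z = (prodl l z * G1 z)%C) /\
  (forall a, In a l -> Cmod a < r) /\ (forall z, Cmod z <= r -> G1 z <> 0%C).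

Lemma factors_exist (G : C -> C) (z0 : C) (r : R) :
  ent G -> G z0 <> 0%C -> (forall z, Cmod z = r -> G z <> 0%C) ->
  exists l G1, factors G r l G1.
Proof.
  intros HG Hz0 Hr.
  destruct (factor_exists G z0 (fun a => Cmod a <= r) r HG Hz0) as [l [G1 [H1 [H2 [H3 H4]]]]]; [auto|].
  exists l, G1. split; [exact H1|]. split; [exact H2|]. split; [|exact H4].
  intros a Ha. destruct (Rle_lt_or_eq_dec _ _ (H3 a Ha)) as [E|E]; [exact E|].
  exfalso. apply (Hr a E). rewrite H2, (proj2 (prodl_eq_0 l a) Ha). ring.
Qed.

Lemma factors_cir_neq_0 (G : C -> C) (r t : R) (l : list C) (G1 : C -> C) :
  0 <= r -> factors G r l G1 -> G (cir r t) <> 0%C.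
Proof.
  intros Hr [H1 [H2 [H3 H4]]]. rewrite H2. apply Cmult_neq_0.
  - intros E. apply prodl_eq_0 in E. specialize (H3 _ E). rewrite Cmod_cir in H3; lra.
  - apply H4. rewrite Cmod_cir; lra.
Qed.

Lemma ln_0 : ln 0 = 0.
Proof. unfold ln. destruct (Rlt_dec 0 0); [exfalso; lra | reflexivity]. Qed.

Lemma ln_Cmod_le (a : C) (r : R) : 1 <= r -> Cmod a <= r -> ln (Cmod a) <= ln r.
Proof.
  intros Hr Ha. pose proof (Cmod_ge_0 a) as [H|H].
  - now apply ln_le.
  - rewrite <- H, ln_0, <- ln_1. apply ln_le; lra.
Qed.

Lemma continuous_ln_Cmod {U : UniformSpace} (f : U -> C) (x : U) :
  continuous f x -> f x <> 0%C -> continuous (fun t => ln (Cmod (f t))) x.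
Proof.
  intros Hf H0. apply (continuous_comp (fun t => Cmod (f t)) ln).
  - now apply continuous_Cmod_comp.
  - apply continuous_ln. now apply Cmod_gt_0.
Qed.

Lemma continuous_ln_cir (G : C -> C) (r t : R) :
  ent G -> G (cir r t) <> 0%C -> continuous (fun t => ln (Cmod (G (cir r t)))) t.
Proof.
  intros HG H0. apply (continuous_ln_Cmod (fun t => G (cir r t))); [|exact H0].
  now apply continuous_cir_comp, ent_continuous.
Qed.

(** Trading each linear factor for its Blaschke partner keeps the modulus on the circle and removes
    all zeros from the closed disk, so a logarithm [q] exists. Interior information on [G] is read
    off [q] and the finite products. *)
Lemma factors_blaschke (G : C -> C) (r : R) (l : list C) (G1 : C -> C) :
  0 < r -> factors G r l G1 ->
  exists q q' r0, r < r0 /\ (forall w, Cmod w < r0 -> Cd q w (q' w)) /\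
    (forall w, Cmod w < r0 -> continuous q' w) /\
    (forall w, Cmod w < r0 -> fst (q w) = ln (Cmod (blp r l w * G1 w))) /\
    (forall w, Cmod w < r0 -> Cd (fun w => blp r l w * G1 w)%C w (q' w * (blp r l w * G1 w))%C) /\
    (forall t, fst (q (cir r t)) = ln (Cmod (G (cir r t)))).
Proof.
  intros Hr [H1 [H2 [H3 H4]]].
  set (Y := fun w => (blp r l w * G1 w)%C).
  assert (HY : ent Y) by (apply ent_mult; [apply ent_blp | exact H1]).
  destruct (zero_free_larger Y r HY Hr) as [r0 [Hr0 Hn]].
  { intros z Hz. apply Cmult_neq_0; [now apply blp_neq_0 | now apply H4]. }
  destruct (log_branch Y r0 ltac:(lra) HY Hn) as [q [Hq [Hcq Hln]]].
  exists q, (fun w => C_derive Y w / Y w)%C, r0.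
  split; [exact Hr0|]. split; [exact Hq|]. split; [exact Hcq|]. split; [exact Hln|]. split.
  - intros w Hw. eapply Cd_eq; [now apply ent_Cd|]. change (blp r l w * G1 w)%C with (Y w).
    field. now apply Hn.
  - intros t. rewrite Hln by (rewrite Cmod_cir; lra). unfold Y.
    now rewrite H2, !Cmod_mult, Cmod_blp_cir.
Qed.

(** The logarithm of the modulus of the leading Taylor coefficient at 0 of the product: as
    [ln 0 = 0], zeros at the origin contribute nothing, and any other factor [z - a] contributes
    |a|. *)
Definition lead (l : list C) (G1 : C -> C) : R :=
  ln (Cmod (G1 0%C)) + sumR (fun a => ln (Cmod a)) l.

Lemma cmean_real_part (q q' : C -> C) (r0 r : R) :
  0 < r -> r < r0 -> (forall w, Cmod w < r0 -> Cd q w (q' w)) ->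
  (forall w, Cmod w < r0 -> continuous q' w) ->
  cmean (fun t => fst (q (cir r t))) = fst (q 0%C).
Proof.
  intros Hr Hr0 Hd Hc.
  rewrite (cmean_ext _ (fun t => fst (q (cir r t) * (cir r t / (cir r t - 0)))%C)).
  - apply CInt_cmean. apply (cauchy_formula q q' r0); trivial. now rewrite Cmod_0.
  - intros t. f_equal.
    assert (Hne : (cir r t - 0)%C <> 0%C) by (apply cir_sub_neq_0; [lra | rewrite Cmod_0; lra]).
    assert (E : (cir r t - 0)%C = cir r t) by ring. rewrite E in *. field. exact Hne.
Qed.

(** On the circle ln |G| is the real part of [q], whose mean is its value at 0; there each Blaschke
    factor has modulus [r]. A zero at the origin contributes [ln r], in line with [ln 0 = 0]. *)
Lemma jensen (G : C -> C) (r : R) (l : list C) (G1 : C -> C) :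
  0 < r -> factors G r l G1 ->
  cmean (fun t => ln (Cmod (G (cir r t)))) = lead l G1 + sumR (fun a => ln r - ln (Cmod a)) l.
Proof.
  intros Hr HF. destruct (factors_blaschke G r l G1 Hr HF) as [q [q' [r0 [Hr0 [Hq [Hc [Hln [_ Hcir]]]]]]]].
  destruct HF as [H1 [H2 [H3 H4]]].
  rewrite (cmean_ext _ (fun t => fst (q (cir r t)))) by (intros; now rewrite Hcir).
  rewrite (cmean_real_part q q' r0 r Hr Hr0 Hq Hc).
  rewrite Hln by (rewrite Cmod_0; lra).
  assert (HG1 : 0 < Cmod (G1 0%C)).
  { apply Cmod_gt_0, H4. rewrite Cmod_0. lra. }
  rewrite Cmod_mult, Cmod_blp_0 by exact Hr.
  rewrite ln_mult by (trivial; now apply pow_lt).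
  rewrite ln_pow by exact Hr. rewrite sumR_minus, sumR_const. unfold lead. ring.
Qed.

Lemma continuous_zero_off_point (f : C -> C) (z : C) :
  continuous f z -> (forall w, w <> z -> f w = 0%C) -> f z = 0%C.
Proof.
  intros Hc H. apply Cmod_eq_0. apply Rle_antisym; [|apply Cmod_ge_0].
  apply Rnot_lt_le. intros H0.
  destruct (proj1 (continuous_C_eps f z) Hc _ H0) as [d [Hd Hb]].
  specialize (Hb (z + RtoC (d / 2))%C).
  replace (z + RtoC (d / 2) - z)%C with (RtoC (d / 2)) in Hb by ring.
  rewrite Cmod_R, Rabs_pos_eq in Hb by lra. specialize (Hb ltac:(lra)).
  rewrite (H (z + RtoC (d / 2))%C) in Hb.
  - rewrite Cmod_sub_sym in Hb. replace (f z - 0)%C with (f z) in Hb by ring. lra.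
  - intros E. apply (RtoC_neq_0 (d / 2)); [lra|].
    replace (RtoC (d / 2)) with (z + RtoC (d / 2) - z)%C by ring. rewrite E. ring.
Qed.

(** The smaller power cancels away from [b], and continuity extends the identity to [b], where a
    leftover power would vanish. *)
Lemma order_unique (X X' : C -> C) (b : C) (m m' : nat) :
  continuous X b -> continuous X' b -> X b <> 0%C -> X' b <> 0%C ->
  (forall z, ((z - b) ^ m * X z)%C = ((z - b) ^ m' * X' z)%C) -> m = m' /\ X b = X' b.
Proof.
  assert (H : forall X X' m k, continuous X b -> continuous X' b ->
    (forall z, ((z - b) ^ m * X z)%C = ((z - b) ^ (m + k) * X' z)%C) -> X b = (0 ^ k * X' b)%C).
  { intros Y Y' n k HY HY' E. apply Ceq_minus.
    replace (Y b - 0 ^ k * Y' b)%C with (Y b - (b - b) ^ k * Y' b)%C by now rewrite Cminus_diag.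
    apply (continuous_zero_off_point (fun z => Y z - (z - b) ^ k * Y' z)%C).
    - apply continuous_Cminus; [exact HY|]. apply continuous_Cmult; [|exact HY'].
      apply continuous_Cpow, continuous_Cminus; [apply continuous_id | apply continuous_const].
    - intros w Hw.
      assert (Hp : ((w - b) ^ n)%C <> 0%C).
      { apply Cpow_nz. intros E0. apply Hw. replace w with (w - b + b)%C by ring. rewrite E0. ring. }
      specialize (E w). rewrite Cpow_add_r in E.
      assert (E2 : ((w - b) ^ n * (Y w - (w - b) ^ k * Y' w))%C = 0%C).
      { transitivity ((w - b) ^ n * Y w - (w - b) ^ n * (w - b) ^ k * Y' w)%C; [ring|].
        rewrite E. ring. }
      destruct (Ceq_dec (Y w - (w - b) ^ k * Y' w)%C 0%C) as [H0|H0]; [exact H0|].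
      exfalso. revert E2. now apply Cmult_neq_0. }
  intros HX HX' H0 H0' E.
  destruct (Nat.le_ge_cases m m') as [Hm|Hm].
  - replace m' with (m + (m' - m))%nat in E by lia.
    pose proof (H X X' m (m' - m)%nat HX HX' E) as E1.
    destruct (m' - m)%nat as [|k] eqn:Ek.
    + split; [lia|]. rewrite E1. simpl. ring.
    + exfalso. apply H0. rewrite E1. simpl. ring.
  - replace m with (m' + (m - m'))%nat in E by lia.
    pose proof (H X' X m' (m - m')%nat HX' HX (fun z => eq_sym (E z))) as E1.
    destruct (m - m')%nat as [|k] eqn:Ek.
    + split; [lia|]. rewrite E1. simpl. ring.
    + exfalso. apply H0'. rewrite E1. simpl. ring.
Qed.

Lemma lead_split (l : list C) (G1 : C -> C) :
  ent G1 -> G1 0%C <> 0%C ->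
  exists m X, ent X /\ X 0%C <> 0%C /\ (forall z, (prodl l z * G1 z)%C = ((z - 0) ^ m * X z)%C) /\
    ln (Cmod (X 0%C)) = lead l G1.
Proof.
  intros HG1 H0. induction l as [|a l [m [X [HX [HX0 [E Eln]]]]]].
  - exists 0%nat, G1. split; [exact HG1|]. split; [exact H0|]. split.
    + intros z. simpl. ring.
    + unfold lead. simpl. ring.
  - destruct (Ceq_dec a 0%C) as [->|Ha].
    + exists (S m), X. split; [exact HX|]. split; [exact HX0|]. split.
      * intros z. simpl prodl. rewrite <- Cmult_assoc, E. simpl. ring.
      * rewrite Eln. unfold lead. simpl. rewrite Cmod_0, ln_0. ring.
    + exists m, (fun z => ((z - a) * X z)%C). split; [|split; [|split]].
      * apply (ent_mult (fun z => z - a)%C); [|exact HX]. apply ent_minus; [apply ent_id | apply ent_const].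
      * apply Cmult_neq_0; [|exact HX0]. intros E0. apply Ha.
        replace a with (0 - (0 - a))%C by ring. rewrite E0. ring.
      * intros z. simpl prodl. rewrite <- Cmult_assoc, E. ring.
      * rewrite Cmod_mult. replace (0 - a)%C with (- a)%C by ring. rewrite Cmod_opp.
        rewrite ln_mult by now apply Cmod_gt_0. rewrite Eln. unfold lead. simpl. ring.
Qed.

Lemma lead_unique (l l' : list C) (G1 G1' : C -> C) :
  ent G1 -> ent G1' -> G1 0%C <> 0%C -> G1' 0%C <> 0%C ->
  (forall z, (prodl l z * G1 z)%C = (prodl l' z * G1' z)%C) -> lead l G1 = lead l' G1'.
Proof.
  intros H1 H1' H0 H0' E.
  destruct (lead_split l G1 H1 H0) as [m [X [HX [HX0 [EX <-]]]]].
  destruct (lead_split l' G1' H1' H0') as [m' [X' [HX' [HX0' [EX' <-]]]]].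
  destruct (order_unique X X' 0%C m m') as [_ Eq]; trivial.
  - now apply ent_continuous.
  - now apply ent_continuous.
  - intros z. now rewrite <- EX, <- EX'.
  - now rewrite Eq.
Qed.

(** Factorizations for different radii differ, but the leading coefficient at 0 does not. This is
    what makes the O(1) in Jensen's formula independent of [r]. *)
Lemma lead_constant (G : C -> C) (z0 : C) :
  ent G -> G z0 <> 0%C ->
  exists c, forall r l G1, 0 < r -> factors G r l G1 -> lead l G1 = c.
Proof.
  intros HG Hz0.
  destruct (factor_exists G z0 (fun a => a = 0%C) 0 HG Hz0) as [l [G1 [H1 [H2 [H3 H4]]]]].
  { intros a ->. rewrite Cmod_0. lra. }
  exists (lead l G1). intros r l' G1' Hr [H1' [H2' [H3' H4']]].
  apply lead_unique; trivial.
  - apply H4'. rewrite Cmod_0. lra.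
  - now apply H4.
  - intros z. now rewrite <- H2, <- H2'.
Qed.

Lemma lead_le_cmean (G : C -> C) (r : R) (l : list C) (G1 : C -> C) :
  1 <= r -> factors G r l G1 -> lead l G1 <= cmean (fun t => ln (Cmod (G (cir r t)))).
Proof.
  intros Hr HF. rewrite (jensen G r l G1) by (trivial; lra).
  assert (0 <= sumR (fun a => ln r - ln (Cmod a)) l); [|lra].
  replace 0 with (sumR (fun _ => 0) l) by (rewrite sumR_const; ring).
  apply sumR_le. intros a Ha. destruct HF as [_ [_ [H3 _]]]. specialize (H3 a Ha).
  pose proof (ln_Cmod_le a r Hr ltac:(lra)). lra.
Qed.

(** [G] may vanish on the circle of radius [s], so Jensen's formula is not applied there. Instead
    the zeros in the smaller disk are replaced by Blaschke factors for radius [s], and the value at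
    0 is bounded by the maximum on the circle. *)
Lemma zero_count_bound (G : C -> C) (r s A : R) (l : list C) (G1 : C -> C) :
  1 <= r -> r < s -> factors G r l G1 -> (forall t, Cmod (G (cir s t)) <= exp A) ->
  INR (length l) * (ln s - ln r) <= A - lead l G1.
Proof.
  intros Hr Hs [H1 [H2 [H3 H4]]] HA.
  set (Y := fun w => (blp s l w * G1 w)%C).
  assert (HY : ent Y) by (apply ent_mult; [apply ent_blp | exact H1]).
  assert (B : Cmod (Y 0%C) <= exp A * (s / (s - Cmod 0))).
  { apply ent_bound_inside; [exact HY | rewrite Cmod_0; lra|].
    intros t _. unfold Y. rewrite Cmod_mult, Cmod_blp_cir, <- Cmod_mult, <- H2 by lra. apply HA. }
  rewrite Cmod_0 in B. replace (s / (s - 0)) with 1 in B by (field; lra). rewrite Rmult_1_r in B.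
  assert (HG1 : 0 < Cmod (G1 0%C)).
  { apply Cmod_gt_0, H4. rewrite Cmod_0. lra. }
  unfold Y in B. rewrite Cmod_mult, Cmod_blp_0 in B by lra.
  assert (Hsp : 0 < s ^ length l) by (apply pow_lt; lra).
  apply ln_le in B; [|now apply Rmult_lt_0_compat].
  rewrite ln_exp, ln_mult, ln_pow in B by (trivial; lra).
  assert (sumR (fun a => ln (Cmod a)) l <= INR (length l) * ln r); [|unfold lead; lra].
  rewrite <- sumR_const. apply sumR_le. intros a Ha. apply ln_Cmod_le; [exact Hr|].
  specialize (H3 a Ha). lra.
Qed.

(** * The positive logarithm and bounds inside a zero-free circle *)

Lemma log_plus_ln (x : R) : log_plus x = ln (Rmax 1 x).
Proof.
  unfold log_plus. unfold Rmax at 2. destruct (Rle_dec 1 x) as [H|H].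
  - apply Rmax_right. rewrite <- ln_1. apply ln_le; lra.
  - rewrite ln_1. apply Rmax_left. destruct (Rle_dec x 0) as [H0|H0].
    + unfold ln. destruct (Rlt_dec 0 x); [exfalso; lra | lra].
    + rewrite <- ln_1. apply ln_le; lra.
Qed.

Lemma continuous_Rmax_const {U : UniformSpace} (k : R) (f : U -> R) (x : U) :
  continuous f x -> continuous (fun t => Rmax k (f t)) x.
Proof.
  intros H. apply (continuous_ext (fun t => / 2 * (k + f t + Rabs (f t + - k)))).
  - intros t. unfold Rmax, Rabs. destruct (Rle_dec k (f t)), (Rcase_abs (f t + - k)); lra.
  - apply continuous_Rmult; [apply continuous_const|]. apply continuous_Rplus.
    + apply continuous_Rplus; [apply continuous_const | exact H].
    + apply (continuous_Rabs_of (fun t => f t + - k)), continuous_Rplus; [exact H | apply continuous_const].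
Qed.

Lemma continuous_log_plus_comp {U : UniformSpace} (f : U -> R) (x : U) :
  continuous f x -> continuous (fun t => log_plus (f t)) x.
Proof.
  intros H. apply (continuous_ext (fun t => ln (Rmax 1 (f t)))); [intros; now rewrite log_plus_ln|].
  apply (continuous_comp (fun t => Rmax 1 (f t)) ln); [now apply continuous_Rmax_const|].
  apply continuous_ln. eapply Rlt_le_trans; [apply Rlt_0_1 | apply Rmax_l].
Qed.

Lemma continuous_log_plus_cir (G : C -> C) (r t : R) :
  ent G -> continuous (fun t => log_plus (Cmod (G (cir r t)))) t.
Proof.
  intros HG. apply (continuous_log_plus_comp (fun t => Cmod (G (cir r t)))).
  apply (continuous_Cmod_comp (fun t => G (cir r t))). now apply continuous_cir_comp, ent_continuous.
Qed.

Lemma log_plus_ge_0 (x : R) : 0 <= log_plus x.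
Proof. apply Rmax_l. Qed.

Lemma log_plus_ge_ln (x : R) : ln x <= log_plus x.
Proof. apply Rmax_r. Qed.

Lemma log_plus_le (x y : R) : x <= y -> log_plus x <= log_plus y.
Proof.
  intros H. rewrite !log_plus_ln. apply ln_le.
  - eapply Rlt_le_trans; [apply Rlt_0_1 | apply Rmax_l].
  - apply Rle_max_compat_l, H.
Qed.

Lemma exp_log_plus (x : R) : x <= exp (log_plus x).
Proof.
  rewrite log_plus_ln, exp_ln; [apply Rmax_r|].
  eapply Rlt_le_trans; [apply Rlt_0_1 | apply Rmax_l].
Qed.

Lemma cmean_log_plus_ge_0 (G : C -> C) (r : R) :
  ent G -> 0 <= cmean (fun t => log_plus (Cmod (G (cir r t)))).
Proof.
  intros HG. rewrite <- (cmean_const 0). apply cmean_le.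
  - intros; apply continuous_const.
  - intros; now apply continuous_log_plus_cir.
  - intros; apply log_plus_ge_0.
Qed.

(** |x| is twice the positive part minus x, and for [r >= 1] the mean of ln |G| is at least
    [lead l G1] because the terms of the zeros in Jensen's formula are nonnegative. *)
Lemma cmean_abs_ln (G : C -> C) (r : R) (l : list C) (G1 : C -> C) :
  1 <= r -> ent G -> factors G r l G1 ->
  cmean (fun t => Rabs (ln (Cmod (G (cir r t)))))
  <= 2 * cmean (fun t => log_plus (Cmod (G (cir r t)))) - lead l G1.
Proof.
  intros Hr HG HF. pose proof (lead_le_cmean G r l G1 Hr HF) as HL.
  assert (Hc : forall t, continuous (fun t => ln (Cmod (G (cir r t)))) t).
  { intros t. apply continuous_ln_cir; [exact HG|]. apply (factors_cir_neq_0 G r t l G1); [lra | exact HF]. }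
  assert (Hcp : forall t, continuous (fun t => log_plus (Cmod (G (cir r t)))) t).
  { intros t. now apply continuous_log_plus_cir. }
  rewrite (cmean_ext _ (fun t => 2 * log_plus (Cmod (G (cir r t))) + -1 * ln (Cmod (G (cir r t))))).
  - rewrite cmean_plus.
    + rewrite !cmean_scal by assumption. lra.
    + intros t. apply continuous_Rmult; [apply continuous_const | apply Hcp].
    + intros t. apply continuous_Rmult; [apply continuous_const | apply Hc].
  - intros t. unfold log_plus. set (x := ln (Cmod (G (cir r t)))).
    unfold Rmax, Rabs. destruct (Rle_dec 0 x), (Rcase_abs x); lra.
Qed.

Lemma factors_q_bound (G : C -> C) (r : R) (l : list C) (G1 : C -> C) (q q' : C -> C) (r0 : R) :
  1 <= r -> ent G -> factors G r l G1 -> r < r0 ->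
  (forall w, Cmod w < r0 -> Cd q w (q' w)) -> (forall w, Cmod w < r0 -> continuous q' w) ->
  (forall t, fst (q (cir r t)) = ln (Cmod (G (cir r t)))) ->
  forall z, Cmod z < r -> Cmod (q' z) <=
    2 * r / (r - Cmod z) ^ 2 * (2 * cmean (fun t => log_plus (Cmod (G (cir r t)))) - lead l G1).
Proof.
  intros Hr HG HF Hr0 Hq Hc Hcir z Hz.
  eapply Rle_trans; [apply (derive_bound_by_real_part q q' r0 r z Hz Hr0 Hq Hc)|].
  apply Rmult_le_compat_l.
  - apply Rmult_le_pos; [lra|]. apply Rlt_le, Rinv_0_lt_compat, pow_lt. lra.
  - rewrite (cmean_ext _ (fun t => Rabs (ln (Cmod (G (cir r t)))))) by (intros; now rewrite Hcir).
    now apply cmean_abs_ln.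
Qed.

Lemma Cd_prodl_bound (l : list C) (z : C) (e : R) :
  0 < e -> (forall a, In a l -> e <= Cmod (z - a)) ->
  exists d, Cd (prodl l) z d /\ Cmod d <= INR (length l) / e * Cmod (prodl l z).
Proof.
  intros He. induction l as [|a l IH]; intros Hl.
  - exists 0%C. split; [apply Cd_const|]. simpl. rewrite Cmod_0. lra.
  - destruct IH as [d [Hd Hb]]; [intros b Hb; apply Hl; now right|].
    exists (1 * prodl l z + (z - a) * d)%C. split.
    + eapply Cd_eq.
      * apply (Cd_mult (fun z => z - a)%C (prodl l)); [apply Cd_minus; [apply Cd_id | apply Cd_const] | exact Hd].
      * ring.
    + simpl length. rewrite S_INR. simpl prodl. rewrite Cmod_mult, Cmult_1_l.
      eapply Rle_trans; [apply Cmod_triangle|]. rewrite Cmod_mult.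
      specialize (Hl a (or_introl eq_refl)). pose proof (Cmod_ge_0 (prodl l z)) as Hp.
      replace ((INR (length l) + 1) / e * (Cmod (z - a) * Cmod (prodl l z)))
        with (Cmod (z - a) / e * Cmod (prodl l z) + Cmod (z - a) * (INR (length l) / e * Cmod (prodl l z)))
        by (field; lra).
      apply Rplus_le_compat.
      * rewrite <- (Rmult_1_l (Cmod (prodl l z))) at 1. apply Rmult_le_compat_r; [exact Hp|].
        apply Rmult_le_reg_r with e; [exact He|]. unfold Rdiv. rewrite Rmult_assoc, Rinv_l; lra.
      * apply Rmult_le_compat_l; [apply Cmod_ge_0 | exact Hb].
Qed.

Lemma Cd_blp_bound (r : R) (l : list C) (z : C) :
  Cmod z < r -> (forall a, In a l -> Cmod a < r) ->
  exists d, Cd (blp r l) z d /\ Cmod d <= INR (length l) / (r - Cmod z) * Cmod (blp r l z).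
Proof.
  intros Hz. pose proof (Cmod_ge_0 z) as Hz0. induction l as [|a l IH]; intros Hl.
  - exists 0%C. split; [apply Cd_const|]. simpl. rewrite Cmod_0. lra.
  - destruct IH as [d [Hd Hb]]; [intros b Hb; apply Hl; now right|].
    exists (- Cconj a / RtoC r * blp r l z + blf r a z * d)%C. split.
    + apply (Cd_mult (blf r a) (blp r l)); [apply Cd_blf | exact Hd].
    + simpl length. rewrite S_INR. simpl blp. rewrite Cmod_mult.
      eapply Rle_trans; [apply Cmod_triangle|]. rewrite !Cmod_mult.
      specialize (Hl a (or_introl eq_refl)). pose proof (Cmod_ge_0 (blp r l z)) as Hp.
      pose proof (Cmod_ge_0 a) as Ha0.
      assert (H1 : Cmod (- Cconj a / RtoC r) <= 1).
      { rewrite Cmod_div by (apply RtoC_neq_0; lra).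
        rewrite Cmod_opp, Cmod_conj, Cmod_R, Rabs_pos_eq by lra.
        apply Rmult_le_reg_r with r; [lra|]. unfold Rdiv. rewrite Rmult_assoc, Rinv_l; lra. }
      assert (H2 : r - Cmod z <= Cmod (blf r a z)).
      { unfold blf. rewrite Cmod_div by (apply RtoC_neq_0; lra).
        rewrite Cmod_R, Rabs_pos_eq by lra.
        apply Rmult_le_reg_r with r; [lra|]. unfold Rdiv. rewrite Rmult_assoc, Rinv_l, Rmult_1_r by lra.
        pose proof (Cmod_triangle_rev (RtoC (r ^ 2)) (Cconj a * z)) as T.
        rewrite Cmod_conj_mult, Cmod_R, Rabs_pos_eq in T by (apply pow_le; lra). nra. }
      replace ((INR (length l) + 1) / (r - Cmod z) * (Cmod (blf r a z) * Cmod (blp r l z)))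
        with (Cmod (blf r a z) / (r - Cmod z) * Cmod (blp r l z)
          + Cmod (blf r a z) * (INR (length l) / (r - Cmod z) * Cmod (blp r l z)))
        by (field; lra).
      apply Rplus_le_compat.
      * apply Rmult_le_compat_r; [exact Hp|]. eapply Rle_trans; [exact H1|].
        apply Rmult_le_reg_r with (r - Cmod z); [lra|]. unfold Rdiv. rewrite Rmult_assoc, Rinv_l; lra.
      * apply Rmult_le_compat_l; [apply Cmod_ge_0 | exact Hb].
Qed.

(** G'/G has three parts: q' from the zero-free quotient, one term of size at most 1/e for each
    zero, and one of size at most 1/(r - |z|) for each Blaschke denominator. *)
Lemma log_derivative_bound (G : C -> C) (r e : R) (l : list C) (G1 : C -> C) (z : C) :
  1 <= r -> ent G -> factors G r l G1 -> Cmod z < r -> 0 < e ->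
  (forall a, In a l -> e <= Cmod (z - a)) ->
  Cmod (C_derive G z) <=
    (2 * r / (r - Cmod z) ^ 2 * (2 * cmean (fun t => log_plus (Cmod (G (cir r t)))) - lead l G1)
     + INR (length l) * (/ e + / (r - Cmod z))) * Cmod (G z).
Proof.
  intros Hr HG HF Hz He Hl.
  destruct (factors_blaschke G r l G1 ltac:(lra) HF) as [q [q' [r0 [Hr0 [Hq [Hc [_ [HY Hcir]]]]]]]].
  pose proof (factors_q_bound G r l G1 q q' r0 Hr HG HF Hr0 Hq Hc Hcir z Hz) as Hb.
  destruct HF as [H1 [H2 [H3 H4]]].
  set (K := 2 * r / (r - Cmod z) ^ 2 * (2 * cmean (fun t => log_plus (Cmod (G (cir r t)))) - lead l G1)) in *.
  destruct (Cd_prodl_bound l z e He Hl) as [dp [Hdp Bp]].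
  destruct (Cd_blp_bound r l z Hz H3) as [db [Hdb Bb]].
  pose proof (ent_Cd G1 z H1) as HdG.
  set (g := G1 z) in *. set (g' := C_derive G1 z) in *.
  set (p := prodl l z) in *. set (b := blp r l z) in *.
  assert (Hb0 : b <> 0%C) by (apply blp_neq_0; trivial; lra).
  assert (E1 : (db * g + b * g')%C = (q' z * (b * g))%C).
  { apply (Cd_unique (fun w => blp r l w * G1 w)%C z).
    - now apply (Cd_mult (blp r l) G1).
    - apply HY. lra. }
  assert (E2 : C_derive G z = (dp * g + p * g')%C).
  { apply Cd_C_derive. apply Cd_ext with (fun w => prodl l w * G1 w)%C; [intros; now rewrite H2|].
    now apply (Cd_mult (prodl l) G1). }
  assert (B1 : Cmod g' <= (K + INR (length l) / (r - Cmod z)) * Cmod g).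
  { replace g' with (q' z * g - db / b * g)%C.
    2:{ replace (q' z * g)%C with (q' z * (b * g) / b)%C by (field; exact Hb0).
        rewrite <- E1. field. exact Hb0. }
    eapply Rle_trans; [apply Cmod_triangle_sub|].
    rewrite !Cmod_mult, Rmult_plus_distr_r. pose proof (Cmod_ge_0 g).
    apply Rplus_le_compat; (apply Rmult_le_compat_r; [lra|]); [exact Hb|].
    rewrite Cmod_div by exact Hb0. apply Cmod_gt_0 in Hb0.
    apply Rmult_le_reg_r with (Cmod b); [exact Hb0|]. unfold Rdiv at 1.
    rewrite Rmult_assoc, Rinv_l, Rmult_1_r by lra. exact Bb. }
  rewrite E2, H2. fold p. fold g. rewrite Cmod_mult.
  eapply Rle_trans; [apply Cmod_triangle|]. rewrite !Cmod_mult.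
  pose proof (Cmod_ge_0 g). pose proof (Cmod_ge_0 p).
  replace ((K + INR (length l) * (/ e + / (r - Cmod z))) * (Cmod p * Cmod g))
    with (INR (length l) / e * Cmod p * Cmod g + Cmod p * ((K + INR (length l) / (r - Cmod z)) * Cmod g))
    by (field; lra).
  apply Rplus_le_compat.
  - apply Rmult_le_compat_r; [lra | exact Bp].
  - apply Rmult_le_compat_l; [lra | exact B1].
Qed.

(** A weak Poisson-Jensen inequality: inside the circle |G| is at most exp(Re q), at 0 the real part
    of q is at most the mean of log+ |G|, and the increment from 0 to [z] is controlled by q'. *)
Lemma log_plus_bound_inside (G : C -> C) (r : R) (l : list C) (G1 : C -> C) (z : C) :
  1 <= r -> ent G -> factors G r l G1 -> Cmod z < r ->
  log_plus (Cmod (G z)) <=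
    (1 + 32 * r ^ 2 / (r - Cmod z) ^ 2)
    * (2 * cmean (fun t => log_plus (Cmod (G (cir r t)))) + Rabs (lead l G1)).
Proof.
  intros Hr HG HF Hz.
  destruct (factors_blaschke G r l G1 ltac:(lra) HF) as [q [q' [r0 [Hr0 [Hq [Hc [Hln [_ Hcir]]]]]]]].
  pose proof (factors_q_bound G r l G1 q q' r0 Hr HG HF Hr0 Hq Hc Hcir) as Hb.
  pose proof (cmean_real_part q q' r0 r ltac:(lra) Hr0 Hq Hc) as H0.
  pose proof (factors_cir_neq_0 G r) as Hnz.
  pose proof (cmean_log_plus_ge_0 G r HG) as Hm0.
  set (m := cmean (fun t => log_plus (Cmod (G (cir r t))))) in *.
  assert (Hq0 : fst (q 0%C) <= m).
  { rewrite <- H0. unfold m. apply cmean_le.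
    - intros t. apply continuous_Re, continuous_cir_comp. eapply Cd_continuous, Hq. rewrite Cmod_cir; lra.
    - intros t. now apply continuous_log_plus_cir.
    - intros t. rewrite Hcir. apply log_plus_ge_ln. }
  pose proof (Cmod_ge_0 z) as Hz0.
  (* Halfway between |z| and [r]: the disk contains [z] and stays at distance [(r - Cmod z) / 2]
     from the circle, which costs a factor 4 in the bound on q'. *)
  set (rho := (r + Cmod z) / 2).
  set (D := 2 * m + Rabs (lead l G1)).
  pose proof (Rabs_pos (lead l G1)) as HL0. pose proof (Rle_abs (- lead l G1)) as HL1.
  rewrite Rabs_Ropp in HL1.
  assert (HP : 0 < (r - Cmod z) ^ 2) by (apply pow_lt; lra).
  assert (Hd : Cmod (q z - q 0 - 0 * (z - 0)) <= 2 * (8 * r / (r - Cmod z) ^ 2 * D) * Cmod (z - 0)).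
  { apply (Cd_mean_value q q' 0%C 0%C rho).
    - intros w Hw. replace (w - 0)%C with w in Hw by ring. unfold rho in Hw. split; [apply Hq; lra|].
      replace (q' w - 0)%C with (q' w) by ring.
      eapply Rle_trans; [apply Hb; lra|].
      assert (Hw2 : (r - Cmod z) / 2 <= r - Cmod w) by lra.
      assert (Hw3 : ((r - Cmod z) / 2) ^ 2 <= (r - Cmod w) ^ 2) by (apply pow_incr; lra).
      apply Rle_trans with (2 * r / (r - Cmod w) ^ 2 * D).
      + apply Rmult_le_compat_l; [|unfold D; lra].
        apply Rmult_le_pos; [lra|]. apply Rlt_le, Rinv_0_lt_compat, pow_lt. lra.
      + apply Rmult_le_compat_r; [unfold D; lra|].
        replace (8 * r / (r - Cmod z) ^ 2) with (2 * r / ((r - Cmod z) / 2) ^ 2) by (field; lra).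
        apply Rmult_le_compat_l; [lra|]. apply Rinv_le_contravar; [apply pow_lt; lra | exact Hw3].
    - replace (z - 0)%C with z by ring. unfold rho. lra. }
  replace (q z - q 0 - 0 * (z - 0))%C with (q z - q 0)%C in Hd by ring.
  replace (z - 0)%C with z in Hd by ring.
  assert (HqR : fst (q z) <= m + 16 * r ^ 2 / (r - Cmod z) ^ 2 * D).
  { assert (Hf : fst (q z) - fst (q 0%C) <= Cmod (q z - q 0)).
    { eapply Rle_trans; [apply Rle_abs|]. apply (Cmod_fst (q z - q 0)%C). }
    assert (Hg : 2 * (8 * r / (r - Cmod z) ^ 2 * D) * Cmod z <= 16 * r ^ 2 / (r - Cmod z) ^ 2 * D).
    { replace (16 * r ^ 2 / (r - Cmod z) ^ 2 * D) with (2 * (8 * r / (r - Cmod z) ^ 2 * D) * r) by (field; lra).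
      apply Rmult_le_compat_l; [|lra]. apply Rmult_le_pos; [lra|]. apply Rmult_le_pos; [|unfold D; lra].
      apply Rmult_le_pos; [lra|]. apply Rlt_le, Rinv_0_lt_compat, HP. }
    lra. }
  assert (HD0 : 0 <= 16 * r ^ 2 / (r - Cmod z) ^ 2 * D).
  { apply Rmult_le_pos; [|unfold D; lra]. apply Rmult_le_pos; [nra|].
    apply Rlt_le, Rinv_0_lt_compat, HP. }
  replace (32 * r ^ 2 / (r - Cmod z) ^ 2) with (2 * (16 * r ^ 2 / (r - Cmod z) ^ 2)) by (field; lra).
  fold D. apply Rmax_lub; [unfold D in *; nra|].
  destruct (Ceq_dec (G z) 0%C) as [E|E].
  - rewrite E, Cmod_0, ln_0. unfold D in *; nra.
  - apply Rle_trans with (fst (q z)); [|unfold D in *; nra].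
    rewrite Hln by lra. destruct HF as [H1 [H2 [H3 H4]]].
    apply ln_le; [now apply Cmod_gt_0|]. rewrite H2, !Cmod_mult.
    apply Rmult_le_compat_r; [apply Cmod_ge_0|]. apply Cmod_blp_ge; try lra.
    intros a Ha. specialize (H3 a Ha). lra.
Qed.

(** * Growth, derivatives and counting functions *)

(** The intervals of radius [e] about the points of [l] are too short in total to cover. If a point
    lies within [e] of [a], the sweep moves on to [a + 2 * e], beyond its reach, and drops it. *)
Lemma gap_point (l : list R) (e a b : R) :
  0 < e -> 2 * e * INR (length l) < b - a ->
  exists r, a <= r <= b /\ forall x, In x l -> e <= Rabs (x - r).
Proof.
  intros He. remember (length l) as n eqn:En. revert l En a b.
  induction n as [|n IH]; intros l En a b Hab.
  - simpl in Hab. exists a. split; [lra|]. destruct l; [intros x [] | discriminate].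
  - rewrite S_INR in Hab. pose proof (pos_INR n) as Hn.
    assert (Hne : 0 <= 2 * e * INR n) by (apply Rmult_le_pos; lra).
    destruct (classic (exists x, In x l /\ Rabs (x - a) < e)) as [[x [Hx Hxa]]|Hno].
    + destruct (in_split x l Hx) as [l1 [l2 El]].
      destruct (IH (l1 ++ l2)) with (a := a + 2 * e) (b := b) as [r [Hr Hl]].
      * subst l. rewrite length_app in En |- *. simpl in En. lia.
      * lra.
      * exists r. split; [lra|]. intros y Hy. subst l. apply in_app_iff in Hy.
        destruct Hy as [Hy|[<-|Hy]].
        -- apply Hl, in_app_iff. now left.
        -- apply Rabs_def2 in Hxa. rewrite Rabs_left; lra.
        -- apply Hl, in_app_iff. now right.
    + exists a. split; [lra|]. intros x Hx. apply Rnot_lt_le. intros Hlt. apply Hno. now exists x.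
Qed.

(** Otherwise iterating s -> s + 1/B(s) doubles [B] each time, while the steps are dominated by a
    geometric series of sum 2; [B (s0 + 2)] would exceed every power of 2. *)
Lemma borel_growth (B : R -> R) (s0 : R) :
  (forall s, s0 <= s -> 1 <= B s) -> (forall s s', s <= s' -> B s <= B s') ->
  exists s, s0 <= s /\ B (s + / B s) <= 2 * B s.
Proof.
  intros H1 Hm. apply NNPP. intros Hno.
  assert (Hg : forall s, s0 <= s -> 2 * B s < B (s + / B s)).
  { intros s Hs. apply Rnot_le_lt. intros Hle. apply Hno. now exists s. }
  set (u := fix u n := match n with O => s0 | S n => u n + / B (u n) end).
  assert (Hu : forall n, s0 <= u n /\ 2 ^ n <= B (u n) /\ u n <= s0 + 2 * (1 - / 2 ^ n)).
  { induction n as [|n [I1 [I2 I3]]].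
    - simpl. pose proof (H1 s0 (Rle_refl _)). lra.
    - pose proof (H1 _ I1) as Hb. specialize (Hg _ I1). simpl u.
      assert (Hp : 0 < 2 ^ n) by (apply pow_lt; lra).
      assert (Hi : / B (u n) <= / 2 ^ n) by (apply Rinv_le_contravar; lra).
      assert (Hi0 : 0 < / B (u n)) by (apply Rinv_0_lt_compat; lra).
      assert (E : / 2 ^ S n = / 2 ^ n / 2) by (simpl; field; lra).
      split; [lra|]. split; [simpl; lra|]. rewrite E. lra. }
  destruct (pow_half_small (B (s0 + 2)) 1 Rlt_0_1) as [n Hn].
  destruct (Hu n) as [I1 [I2 I3]].
  assert (Hp : 0 < 2 ^ n) by (apply pow_lt; lra).
  assert (Hi : 0 < / 2 ^ n) by now apply Rinv_0_lt_compat.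
  pose proof (Hm (u n) (s0 + 2) ltac:(lra)) as Hle.
  apply Rmult_lt_compat_r with (r := 2 ^ n) in Hn; [|exact Hp].
  unfold Rdiv in Hn. rewrite Rmult_assoc, Rinv_l in Hn by lra. lra.
Qed.

Lemma derive_estimate (X : C -> C) (w : C) (d M : R) :
  ent X -> 0 < d -> (forall u, Cmod (u - w) <= d -> Cmod (X u) <= M) -> Cmod (C_derive X w) <= M / d.
Proof.
  intros HX Hd HM.
  set (Y := fun u => X (w + u)%C).
  assert (HY : ent Y).
  { apply (ent_comp X (fun u => w + u)%C); [exact HX|]. apply ent_plus; [apply ent_const | apply ent_id]. }
  assert (E : C_derive Y 0%C = C_derive X w).
  { apply Cd_C_derive. eapply Cd_eq.
    - apply (Cd_comp X (fun u => w + u)%C); [apply Cd_plus; [apply Cd_const | apply Cd_id]|].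
      now apply ent_Cd.
    - replace (w + 0)%C with w by ring. ring. }
  rewrite <- E, <- (cmean_const (M / d)).
  assert (Hne : forall t, (cir d t - 0)%C <> 0%C).
  { intros t. apply cir_sub_neq_0; [lra | rewrite Cmod_0; lra]. }
  apply (CInt_cmean_bound (fun t => (Y (cir d t) * cir d t / (cir d t - 0) ^ 2)%C)).
  - intros t. apply continuous_Cdiv.
    + apply continuous_Cmult; [now apply continuous_cir_comp, ent_continuous | apply continuous_cir].
    + apply continuous_Cpow, continuous_Cminus; [apply continuous_cir | apply continuous_const].
    + now apply Cpow_nz.
  - intros t. apply continuous_const.
  - intros t _. rewrite Cmod_div by now apply Cpow_nz.
    assert (E0 : (cir d t - 0)%C = cir d t) by ring.
    rewrite E0, Cmod_pow, Cmod_mult, Cmod_cir by lra.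
    replace (Cmod (Y (cir d t)) * d / d ^ 2) with (Cmod (Y (cir d t)) / d) by (field; lra).
    apply Rmult_le_compat_r; [apply Rlt_le, Rinv_0_lt_compat, Hd|].
    apply HM. replace (w + cir d t - w)%C with (cir d t) by ring. rewrite Cmod_cir; lra.
  - apply ent_cauchy_derive; [exact HY | rewrite Cmod_0; lra].
Qed.

Lemma C_derive_n_succ (j : nat) (X : C -> C) : C_derive_n (S j) X = C_derive_n j (C_derive X).
Proof. unfold C_derive_n. apply Nat.iter_succ_r. Qed.

Lemma ent_C_derive_n (j : nat) (X : C -> C) : ent X -> ent (C_derive_n j X).
Proof. intros HX. induction j as [|j IH]; [exact HX | now apply ent_C_derive]. Qed.

Lemma derive_n_estimate (j : nat) :
  exists K, 0 < K /\ forall X z e M, ent X -> 0 < e ->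
    (forall w, Cmod (w - z) <= e -> Cmod (X w) <= M) -> Cmod (C_derive_n j X z) <= K * M / e ^ j.
Proof.
  induction j as [|j [K [HK IH]]].
  - exists 1. split; [lra|]. intros X z e M HX He HM. simpl.
    replace (1 * M / 1) with M by field. apply HM. rewrite Cminus_diag, Cmod_0. lra.
  - exists (K * 2 ^ S j). split; [apply Rmult_lt_0_compat; [exact HK | apply pow_lt; lra]|].
    intros X z e M HX He HM. rewrite C_derive_n_succ.
    eapply Rle_trans.
    + apply (IH (C_derive X) z (e / 2) (M / (e / 2))); [now apply ent_C_derive | lra|].
      intros w Hw. apply derive_estimate; [exact HX | lra|].
      intros u Hu. apply HM. replace (u - z)%C with ((u - w) + (w - z))%C by ring.
      eapply Rle_trans; [apply Cmod_triangle | lra].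
    + right. replace ((e / 2) ^ j) with (e ^ j / 2 ^ j)
        by (unfold Rdiv; rewrite Rpow_mult_distr, pow_inv; reflexivity).
      simpl. field. repeat split; try (apply pow_nonzero); lra.
Qed.

(** The squared modulus [p] along the segment is differentiable even where [X] vanishes, and
    [exp (- k * t) * p t] does not increase for [k = 2 * K * D]. *)
Lemma gronwall (X : C -> C) (z w : C) (K : R) :
  ent X -> 0 <= K ->
  (forall u, Cmod (u - z) <= Cmod (w - z) -> Cmod (C_derive X u) <= K * Cmod (X u)) ->
  Cmod (X w) <= exp (K * Cmod (w - z)) * Cmod (X z).
Proof.
  intros HX HK H. set (D := Cmod (w - z)) in *.
  set (g := fun t : R => X (z + RtoC t * (w - z))%C).
  assert (HD : 0 <= D) by apply Cmod_ge_0.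
  set (g' := fun t : R => (C_derive X (z + RtoC t * (w - z)) * (w - z))%C).
  assert (Hg : forall t, Rd g t (g' t)).
  { intros t. apply (Rd_Cd X (fun t => z + RtoC t * (w - z))%C); [now apply ent_Cd | apply Rd_segment]. }
  set (p := fun t => fst (g t) ^ 2 + snd (g t) ^ 2).
  set (p' := fun t => 2 * (fst (g t) * fst (g' t) + snd (g t) * snd (g' t))).
  assert (Hp : forall t, is_derive p t (p' t)).
  { intros t. pose proof (Rd_Re _ _ _ (Hg t)) as H1. pose proof (Rd_Im _ _ _ (Hg t)) as H2.
    unfold p, p'. set (x := fun s => fst (g s)) in *. set (y := fun s => snd (g s)) in *.
    change (is_derive (fun s => x s ^ 2 + y s ^ 2) t (2 * (x t * fst (g' t) + y t * snd (g' t)))).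
    auto_derive.
    - split; [eexists; exact H1 | split; [eexists; exact H2 | trivial]].
    - replace (Derive (fun x0 => x x0) t) with (fst (g' t)) by (symmetry; now apply is_derive_unique).
      replace (Derive (fun x0 => y x0) t) with (snd (g' t)) by (symmetry; now apply is_derive_unique).
      ring. }
  assert (Ep : forall t, p t = Cmod (g t) ^ 2) by (intros t; symmetry; apply Cmod_sqr).
  assert (Hb : forall t, 0 <= t <= 1 -> p' t <= 2 * K * D * p t).
  { intros t Ht. unfold p'.
    assert (B1 : Cmod (g' t) <= K * D * Cmod (g t)).
    { unfold g', g. rewrite Cmod_mult. fold D.
      assert (B : Cmod (C_derive X (z + RtoC t * (w - z))) <= K * Cmod (X (z + RtoC t * (w - z))%C)).
      { apply H. replace (z + RtoC t * (w - z) - z)%C with (RtoC t * (w - z))%C by ring.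
        rewrite Cmod_mult, Cmod_R, Rabs_pos_eq by lra. fold D. nra. }
      nra. }
    assert (B2 : fst (g t) * fst (g' t) + snd (g t) * snd (g' t) <= Cmod (g t) * Cmod (g' t)).
    { replace (fst (g t) * fst (g' t) + snd (g t) * snd (g' t)) with (fst (Cconj (g t) * g' t)%C)
        by (simpl; ring).
      rewrite <- (Cmod_conj (g t)), <- Cmod_mult.
      eapply Rle_trans; [apply Rle_abs | apply (Cmod_fst (Cconj (g t) * g' t)%C)]. }
    rewrite Ep. pose proof (Cmod_ge_0 (g t)). nra. }
  set (k := 2 * K * D) in *.
  set (F := fun t => exp (- k * t) * p t).
  assert (HF : forall t, is_derive F t (exp (- k * t) * (p' t - k * p t))).
  { intros t. unfold F. auto_derive.
    - eexists. apply Hp.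
    - replace (Derive (fun x => p x) t) with (p' t) by (symmetry; now apply is_derive_unique). ring. }
  assert (H10 : F 1 <= F 0).
  { destruct (MVT_gen F 0 1 (fun t => exp (- k * t) * (p' t - k * p t))) as [c [Hc Ec]].
    - intros t _. apply HF.
    - intros t _. apply continuity_pt_filterlim.
      apply (@ex_derive_continuous R_AbsRing R_NormedModule). eexists. apply HF.
    - rewrite Rmin_left, Rmax_right in Hc by lra. specialize (Hb c Hc).
      pose proof (exp_pos (- k * c)). nra. }
  unfold F in H10. rewrite Rmult_0_r, exp_0, Rmult_1_l, Rmult_1_r, !Ep in H10.
  unfold g in H10. replace (z + 1 * (w - z))%C with w in H10 by ring.
  replace (z + 0 * (w - z))%C with z in H10 by ring.
  assert (E2 : exp (- k) * exp (K * D) ^ 2 = 1).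
  { simpl. rewrite Rmult_1_r, <- !exp_plus. replace (- k + (K * D + K * D)) with 0 by (unfold k; ring).
    apply exp_0. }
  pose proof (exp_pos (K * D)) as HE. pose proof (exp_pos (- k)) as HE'.
  apply Rsqr_incr_0; [| apply Cmod_ge_0 | apply Rmult_le_pos; [lra | apply Cmod_ge_0]].
  rewrite !Rsqr_pow2, Rpow_mult_distr.
  apply Rmult_le_reg_l with (exp (- k)); [exact HE'|].
  rewrite <- Rmult_assoc, E2. lra.
Qed.

(** On the disk of radius 1/K the exponent in [gronwall] is at most 1, so |X| is at most e |X z|
    there, and Cauchy's estimate for that disk gives [K ^ j]. A first order bound thus controls
    every order. *)
Lemma derive_n_ratio (j : nat) :
  exists M, 0 < M /\ forall X z K, ent X -> 0 < K ->
    (forall w, Cmod (w - z) <= / K -> Cmod (C_derive X w) <= K * Cmod (X w)) ->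
    Cmod (C_derive_n j X z) <= M * K ^ j * Cmod (X z).
Proof.
  destruct (derive_n_estimate j) as [M0 [HM0 HM]].
  exists (M0 * exp 1). split; [apply Rmult_lt_0_compat; [exact HM0 | apply exp_pos]|].
  intros X z K HX HK H.
  assert (HiK : 0 < / K) by now apply Rinv_0_lt_compat.
  eapply Rle_trans.
  - apply (HM X z (/ K) (exp 1 * Cmod (X z))); trivial.
    intros w Hw. eapply Rle_trans.
    + apply (gronwall X z w K); [exact HX | lra|]. intros u Hu. apply H. lra.
    + apply Rmult_le_compat_r; [apply Cmod_ge_0|].
      assert (Hle : K * Cmod (w - z) <= 1).
      { apply Rmult_le_compat_l with (r := K) in Hw; [|lra]. rewrite Rinv_r in Hw; lra. }
      destruct Hle as [Hle|Hle]; [left; now apply exp_increasing | right; now rewrite Hle].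
  - right. rewrite pow_inv. field. apply pow_nonzero. lra.
Qed.

(** A point repeated m times in [l] occurs once in [d] and m - 1 times in [l']. The derivative of
    the product keeps a zero of order at least m - 1 there, and [Q] is the cofactor. *)
Lemma distinct_split (l : list C) :
  exists d l' Q, NoDup d /\ (forall a, In a d <-> In a l) /\ incl l' l /\
    (forall z, prodl l z = (prodl d z * prodl l' z)%C) /\
    (forall g, sumR g l = sumR g d + sumR g l') /\
    ent Q /\ forall z, Cd (prodl l) z (prodl l' z * Q z)%C.
Proof.
  induction l as [|a l [d [l' [Q [Hd [Hin [Hincl [Hp [Hs [HQ HC]]]]]]]]]].
  - exists nil, nil, (fun _ => 0%C). split; [constructor|]. split; [tauto|].
    split; [intros x []|]. split; [intros; simpl; ring|]. split; [intros; simpl; ring|].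
    split; [apply ent_const|]. intros z. eapply Cd_eq; [apply Cd_const | simpl; ring].
  - assert (HCa : forall z, Cd (prodl (a :: l)) z (prodl l z + (z - a) * (prodl l' z * Q z))%C).
    { intros z. eapply Cd_eq.
      - apply (Cd_mult (fun z => z - a)%C (prodl l));
          [apply Cd_minus; [apply Cd_id | apply Cd_const] | apply HC].
      - ring. }
    destruct (in_dec Ceq_dec a l) as [Ha|Ha].
    + assert (Had : In a d) by now apply Hin.
      destruct (in_split a d Had) as [d1 [d2 Ed]].
      (* [a] already occurs in [d], so [prodl l] contains [z - a] and Leibniz' rule leaves
         [prodl (d1 ++ d2)] times the new repeated part. *)
      exists d, (a :: l'), (fun z => prodl (d1 ++ d2) z + Q z)%C.
      split; [exact Hd|]. split.
      { intros b. rewrite Hin. simpl. split; [tauto|]. intros [<-|Hb]; trivial. }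
      split.
      { intros b [<-|Hb]; [now left | right; now apply Hincl]. }
      split; [intros z; simpl; rewrite Hp; ring|].
      split; [intros g; simpl; rewrite Hs; ring|].
      split; [apply ent_plus; [apply ent_prodl | exact HQ]|].
      intros z. eapply Cd_eq; [apply HCa|].
      rewrite Hp, Ed, !prodl_app. simpl. ring.
    + exists (a :: d), l', (fun z => prodl d z + (z - a) * Q z)%C.
      split; [constructor; [rewrite Hin; exact Ha | exact Hd]|]. split.
      { intros b. simpl. now rewrite Hin. }
      split.
      { intros b Hb. right. now apply Hincl. }
      split; [intros z; simpl; rewrite Hp; ring|].
      split; [intros g; simpl; rewrite Hs; ring|].
      split.
      { apply ent_plus; [apply ent_prodl|]. apply (ent_mult (fun z => z - a)%C); [|exact HQ].
        apply ent_minus; [apply ent_id | apply ent_const]. }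
      intros z. eapply Cd_eq; [apply HCa|]. rewrite Hp. ring.
Qed.

(** * The counting function of distinct zeros *)

Lemma is_sum_over_ones (E : C -> Prop) (l : list C) :
  NoDup l -> (forall z, In z l <-> E z) -> sum_over E (fun _ => 1%nat) = length l.
Proof.
  intros Hl HE.
  assert (Hones : forall l : list C, list_sum (map (fun _ => 1%nat) l) = length l).
  { induction l0 as [|a l0 IH]; simpl; [reflexivity | now rewrite <- IH]. }
  assert (Hex : exists n, is_sum_over E (fun _ => 1%nat) n).
  { exists (length l), l. split; [exact Hl|]. split; [exact HE|]. now rewrite Hones. }
  destruct (epsilon_spec (inhabits 0%nat) (is_sum_over E (fun _ => 1%nat)) Hex) as [l' [H1 [H2 H3]]].
  unfold sum_over. rewrite H3, Hones. apply Permutation_length. apply NoDup_Permutation; trivial.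
  intros x. now rewrite H2, HE.
Qed.

Definition ind (x t : R) : R := if Rle_dec x t then 1 else 0.

Lemma ind_le (x t : R) : x <= t -> ind x t = 1.
Proof. intros H. unfold ind. destruct (Rle_dec x t); [reflexivity | lra]. Qed.

Lemma ind_gt (x t : R) : t < x -> ind x t = 0.
Proof. intros H. unfold ind. destruct (Rle_dec x t); [lra | reflexivity]. Qed.

Lemma length_filter_ind (t : R) (d : list C) :
  INR (length (filter (fun a => if Rle_dec (Cmod a) t then true else false) d))
  = sumR (fun a => ind (Cmod a) t) d.
Proof.
  induction d as [|a d IH]; [reflexivity|]. simpl. unfold ind at 1.
  destruct (Rle_dec (Cmod a) t); [|rewrite IH; ring].
  simpl length. rewrite S_INR, IH. ring.
Qed.

Lemma is_RInt_zero (a b : R) : is_RInt (fun _ => 0) a b 0.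
Proof.
  pose proof (@is_RInt_const R_NormedModule a b 0) as H.
  unfold scal in H; simpl in H. unfold mult in H; simpl in H. now rewrite Rmult_0_r in H.
Qed.

Lemma is_RInt_ind (x r : R) :
  0 <= x <= r -> 0 < r ->
  is_RInt (fun t => (ind x t - ind x 0) / t) 0 r ((1 - ind x 0) * (ln r - ln x)).
Proof.
  intros Hx Hr.
  destruct (Req_EM_T x 0) as [E|E].
  - subst x. rewrite (ind_le 0 0), Rminus_diag, Rmult_0_l by lra.
    apply (is_RInt_ext (fun _ => 0)); [|apply is_RInt_zero].
    intros t Ht. rewrite Rmin_left in Ht by lra.
    rewrite ind_le, Rminus_diag by lra. unfold Rdiv. now rewrite Rmult_0_l.
  - assert (H0 : ind x 0 = 0) by (apply ind_gt; lra).
    rewrite H0. replace ((1 - 0) * (ln r - ln x)) with (plus 0 (ln r - ln x) : R)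
      by (unfold plus; simpl; ring).
    apply (@is_RInt_Chasles R_NormedModule _ 0 x r).
    + apply (is_RInt_ext (fun _ => 0)); [|apply is_RInt_zero].
      intros t Ht. rewrite Rmin_left, Rmax_right in Ht by lra.
      rewrite ind_gt, Rminus_diag by lra. unfold Rdiv. now rewrite Rmult_0_l.
    + apply (is_RInt_ext (fun t => / t)).
      * intros t Ht. rewrite Rmin_left, Rmax_right in Ht by lra.
        rewrite ind_le, Rminus_0_r by lra. unfold Rdiv. now rewrite Rmult_1_l.
      * apply (is_RInt_derive (V := R_CompleteNormedModule) ln (fun t => / t)).
        -- intros t Ht. rewrite Rmin_left in Ht by lra. apply is_derive_ln. lra.
        -- intros t Ht. rewrite Rmin_left in Ht by lra. apply continuous_Rinv. lra.
Qed.

(** A zero at the origin enters only through the term with [ln r], and its summand [ln r - ln 0] is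
    [ln r] by the default value of [ln]. Any other zero integrates 1/t from its modulus to [r]. *)
Lemma Nbar_zeros_formula (f : C -> C) (r : R) (d : list C) :
  0 < r -> NoDup d -> (forall a, In a d <-> Cmod a <= r /\ f a = 0%C) ->
  Nbar_zeros f r = sumR (fun a => ln r - ln (Cmod a)) d.
Proof.
  intros Hr Hd Hin.
  assert (Hn : forall t, t <= r -> INR (nbar_zeros f t) = sumR (fun a => ind (Cmod a) t) d).
  { intros t Ht. rewrite <- length_filter_ind. f_equal.
    apply is_sum_over_ones; [now apply NoDup_filter|].
    intros z. rewrite filter_In, Hin. destruct (Rle_dec (Cmod z) t); intuition; try discriminate; lra. }
  unfold Nbar_zeros, integrated_counting.
  rewrite (@is_RInt_unique R_CompleteNormedModule _ _ _ (sumR (fun a => (1 - ind (Cmod a) 0) * (ln r - ln (Cmod a))) d)).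
  - rewrite Hn by lra.
    clear. induction d as [|a d IH]; simpl; [ring|].
    assert (E : ind (Cmod a) 0 * (ln (Cmod a)) = 0).
    { unfold ind. destruct (Rle_dec (Cmod a) 0) as [H|H]; [|ring].
      replace (Cmod a) with 0; [rewrite ln_0; ring|]. pose proof (Cmod_ge_0 a). lra. }
    lra.
  - apply (is_RInt_ext (fun t => sumR (fun a => (ind (Cmod a) t - ind (Cmod a) 0) / t) d)).
    + intros t Ht. rewrite Rmin_left, Rmax_right in Ht by lra. rewrite !Hn by lra.
      clear. induction d as [|a d IH]; simpl; [unfold Rdiv; ring|]. rewrite IH. unfold Rdiv. ring.
    + assert (Hd' : forall a, In a d -> Cmod a <= r) by (intros a Ha; now apply Hin).
      clear Hin Hn Hd. induction d as [|a d IH]; simpl.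
      * apply is_RInt_zero.
      * apply (@is_RInt_plus R_NormedModule).
        -- apply is_RInt_ind; [|exact Hr]. split; [apply Cmod_ge_0 | apply Hd'; now left].
        -- apply IH. intros b Hb. apply Hd'. now right.
Qed.

(* [F v' - F' v] vanishes at a zero of [F] to at least its order minus one,
   so only the distinct zeros of [F] survive in the difference. *)
Lemma distinct_zeros_lower_bound (F v : C -> C) (zF zW : C) :
  ent F -> ent v -> F zF <> 0%C ->
  (F zW * C_derive v zW - C_derive F zW * v zW)%C <> 0%C ->
  exists c, forall r, 1 <= r -> (forall z, Cmod z = r -> F z <> 0%C) ->
    (forall z, Cmod z = r -> (F z * C_derive v z - C_derive F z * v z)%C <> 0%C) ->
    cmean (fun t => ln (Cmod (F (cir r t))))
    - cmean (fun t => ln (Cmod (F (cir r t) * C_derive v (cir r t) - C_derive F (cir r t) * v (cir r t))%C))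
    <= Nbar_zeros F r + c.
Proof.
  intros HF Hv HF0 HW0. set (W := fun z => (F z * C_derive v z - C_derive F z * v z)%C) in *.
  assert (HW : ent W).
  { apply ent_minus; apply ent_mult; trivial; now apply ent_C_derive. }
  destruct (lead_constant F zF HF HF0) as [cF HcF].
  destruct (lead_constant W zW HW HW0) as [cW HcW].
  exists (cF - cW). intros r Hr HrF HrW.
  assert (Hr0 : 0 < r) by lra.
  destruct (factors_exist F zF r HF HF0 HrF) as [l [F1 HlF]].
  pose proof (jensen F r l F1 Hr0 HlF) as JF. rewrite (HcF r l F1 Hr0 HlF) in JF.
  pose proof HlF as [H1 [H2 [H3 H4]]].
  destruct (distinct_split l) as [d [l' [Q [Hd [Hin [Hincl [Hp [Hs [HQ HC]]]]]]]]].
  (* The Wronskian with the repeated zeros [l'] cancelled: both terms of the original are divisible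
     by [prodl l']. *)
  set (W2 := fun z => (prodl d z * F1 z * C_derive v z
     - (Q z * F1 z + prodl d z * C_derive F1 z) * v z)%C).
  assert (EW : forall z, W z = (prodl l' z * W2 z)%C).
  { intros z. unfold W, W2.
    assert (E : C_derive F z = (prodl l' z * Q z * F1 z + prodl l z * C_derive F1 z)%C).
    { apply Cd_C_derive. apply Cd_ext with (fun w => prodl l w * F1 w)%C; [intros; now rewrite H2|].
      apply (Cd_mult (prodl l) F1); [apply HC | now apply ent_Cd]. }
    rewrite E, H2, Hp. ring. }
  assert (HW2 : ent W2).
  { pose proof (ent_C_derive v Hv). pose proof (ent_C_derive F1 H1). pose proof (ent_prodl d).
    apply ent_minus; apply ent_mult; trivial; [now apply ent_mult|].
    apply ent_plus; now apply ent_mult. }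
  destruct (factors_exist W2 zW r HW2) as [l2 [W3 HlW]].
  { intros E. apply HW0. change (W zW = 0%C). rewrite EW, E. ring. }
  { intros z Hz E. apply (HrW z Hz). change (W z = 0%C). rewrite EW, E. ring. }
  assert (HlW' : factors W r (l' ++ l2) W3).
  { destruct HlW as [K1 [K2 [K3 K4]]]. split; [exact K1|]. split.
    - intros z. rewrite EW, K2, prodl_app. ring.
    - split; [|exact K4]. intros a Ha. apply in_app_iff in Ha. destruct Ha as [Ha|Ha]; auto. }
  pose proof (jensen W r _ W3 Hr0 HlW') as JW. rewrite (HcW r _ W3 Hr0 HlW'), sumR_app in JW.
  assert (P2 : 0 <= sumR (fun a => ln r - ln (Cmod a)) l2).
  { replace 0 with (sumR (fun _ => 0) l2) by (rewrite sumR_const; ring).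
    apply sumR_le. intros a Ha. destruct HlW as [_ [_ [K3 _]]]. specialize (K3 a Ha).
    pose proof (ln_Cmod_le a r Hr ltac:(lra)). lra. }
  rewrite (Nbar_zeros_formula F r d Hr0 Hd).
  - change (cmean (fun t => ln (Cmod (F (cir r t)))) - cmean (fun t => ln (Cmod (W (cir r t))))
      <= sumR (fun a => ln r - ln (Cmod a)) d + (cF - cW)).
    rewrite JF, JW, Hs. lra.
  - intros a. rewrite Hin. split.
    + intros Ha. split; [apply Rlt_le; auto|]. rewrite H2, (proj2 (prodl_eq_0 l a) Ha). ring.
    + intros [Ha E]. apply prodl_eq_0. rewrite H2 in E.
      destruct (Ceq_dec (prodl l a) 0%C) as [E0|E0]; [exact E0|].
      exfalso. revert E. apply Cmult_neq_0; [exact E0 | now apply H4].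
Qed.

(** Values close to 1 along one unbounded sequence of radii already push the upper limit to at least
    1, so the growth lemma may choose its circles. *)
Lemma not_Theta_pos (h : R -> R) :
  (forall e M, 0 < e -> exists r, M < r /\ 1 - e <= h r) ->
  ~ Rbar_lt 0 (Rbar_minus 1 (LimSup_p_infty h)).
Proof.
  intros H.
  assert (HL : Rbar_le 1 (LimSup_p_infty h)).
  { unfold LimSup_p_infty, Rbar_glb.
    match goal with |- context [proj1_sig ?e] => destruct e as [l [Hl1 Hl2]] end. simpl proj1_sig.
    apply Hl2. intros s [M ->].
    destruct (Lub_Rbar_correct (fun y => exists r, M < r /\ y = h r)) as [Hub _].
    destruct (Lub_Rbar (fun y => exists r, M < r /\ y = h r)) as [x| |]; simpl; trivial.
    - apply Rnot_lt_le. intros Hlt. destruct (H ((1 - x) / 2) M ltac:(lra)) as [r [Hr Hh]].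
      specialize (Hub (h r)). simpl in Hub. assert (h r <= x) by (apply Hub; now exists r). lra.
    - destruct (H 1 M Rlt_0_1) as [r [Hr Hh]]. apply (Hub (h r)). now exists r. }
  destruct (LimSup_p_infty h) as [x| |]; simpl in *; try tauto. lra.
Qed.

(** Near [a] the function g - f (z - a)^m vanishes off [a], hence at [a] by continuity, where it
    equals [g a]. The cutoff [k] makes the identity global. *)
Lemma not_is_pole (f : C -> C) (a : C) : continuous f a -> ~ is_pole f a.
Proof.
  intros Hf [m [Hm [g [Hg [Hga Hl]]]]].
  apply locally_singleton in Hg. destruct Hg as [l Hg]. apply is_derive_Cd in Hg.
  apply Cd_continuous in Hg. apply Hga.
  apply locally_Cmod in Hl. destruct Hl as [d [Hd Hl]].
  set (k := fun z => if Rlt_dec (Cmod (z - a)) d then (g z - f z * (z - a) ^ m)%C else 0%C).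
  assert (Hk : k a = g a).
  { unfold k. destruct (Rlt_dec (Cmod (a - a)) d) as [H|H].
    - destruct m as [|m]; [lia|]. simpl. ring.
    - exfalso. apply H. rewrite Cminus_diag, Cmod_0. exact Hd. }
  rewrite <- Hk. apply continuous_zero_off_point.
  - apply continuous_ext_loc with (fun z => g z - f z * (z - a) ^ m)%C.
    + apply locally_Cmod. exists d. split; [exact Hd|]. intros w Hw. unfold k.
      now destruct (Rlt_dec (Cmod (w - a)) d).
    + apply continuous_Cminus; [exact Hg|]. apply continuous_Cmult; [exact Hf|].
      apply continuous_Cpow, continuous_Cminus; [apply continuous_id | apply continuous_const].
  - intros w Hw. unfold k. destruct (Rlt_dec (Cmod (w - a)) d) as [H|H]; [|reflexivity].
    rewrite (Hl w H Hw). field. apply Cpow_nz. now apply Cminus_eq_contra.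
Qed.

Lemma nevanlinna_T_entire (f : C -> C) (r : R) :
  ent f -> nevanlinna_T f r = cmean (fun t => log_plus (Cmod (f (cir r t)))).
Proof.
  intros Hf.
  assert (Hn : forall t, n_poles f t = 0%nat).
  { intros t.
    assert (Hno : forall z, ~ (Cmod z <= t /\ is_pole f z)).
    { intros z [_ Hz]. revert Hz. now apply not_is_pole, ent_continuous. }
    assert (Hex : exists n, is_sum_over (fun z => Cmod z <= t /\ is_pole f z) (pole_order f) n).
    { exists 0%nat, nil. split; [constructor|]. split; [|reflexivity].
      intros z. split; [intros [] | apply Hno]. }
    destruct (epsilon_spec (inhabits 0%nat) _ Hex) as [l [H1 [H2 H3]]].
    unfold n_poles, sum_over. rewrite H3. destruct l as [|z l]; [reflexivity|].
    exfalso. apply (Hno z), H2. now left. }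
  unfold nevanlinna_T, N_poles, integrated_counting. rewrite Hn.
  rewrite (@RInt_ext R_CompleteNormedModule _ (fun _ => 0)).
  - rewrite (@RInt_const R_CompleteNormedModule). unfold scal; simpl. unfold mult; simpl.
    rewrite Rmult_0_r, Rmult_0_l, Rplus_0_r, Rplus_0_r. reflexivity.
  - intros t _. rewrite Hn. simpl. unfold Rdiv. ring.
Qed.

(** * Good circles *)

Lemma lists_union {A B : Type} (P : A -> list B -> Prop) (n : R) (Gs : list A) :
  (forall G, In G Gs -> exists l, P G l /\ INR (length l) <= n) ->
  exists L, INR (length L) <= INR (length Gs) * n /\
    forall G, In G Gs -> exists l, P G l /\ INR (length l) <= n /\ incl l L.
Proof.
  induction Gs as [|G Gs IH]; intros H.
  - exists nil. split; [simpl; lra | intros G []].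
  - destruct IH as [L [HL HG]]; [intros G' HG'; apply H; now right|].
    destruct (H G (or_introl eq_refl)) as [l [Hl Hn]].
    exists (l ++ L). split.
    + rewrite length_app, plus_INR. simpl length. rewrite S_INR. lra.
    + intros G' [<-|HG'].
      * exists l. split; [exact Hl | split; [exact Hn | apply incl_appl, incl_refl]].
      * destruct (HG G' HG') as [l' [H1 [H2 H3]]]. exists l'.
        split; [exact H1 | split; [exact H2 | now apply incl_appr]].
Qed.

Lemma avoid_moduli (L : list C) (a b : R) :
  a < b -> exists r, a <= r <= b /\ forall z, In z L -> Cmod z <> r.
Proof.
  intros Hab. pose proof (pos_INR (length L)) as Hn.
  set (e := (b - a) / (4 * (INR (length L) + 1))).
  assert (He : 0 < e) by (apply Rdiv_lt_0_compat; lra).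
  assert (E : e * (4 * (INR (length L) + 1)) = b - a) by (unfold e; field; lra).
  destruct (gap_point (map Cmod L) e a b He) as [r [Hr Hl]].
  - rewrite length_map. nra.
  - exists r. split; [exact Hr|]. intros z Hz Ez.
    specialize (Hl (Cmod z) (in_map Cmod L z Hz)).
    rewrite Ez, Rminus_diag, Rabs_R0 in Hl. lra.
Qed.

Lemma zeros_in_list (G : C -> C) (z0 : C) (r : R) :
  ent G -> G z0 <> 0%C -> exists l, forall z, Cmod z <= r -> G z = 0%C -> In z l.
Proof.
  intros HG Hz0.
  destruct (factor_exists G z0 (fun a => Cmod a <= r) r HG Hz0) as [l [G1 [H1 [H2 [H3 H4]]]]]; [auto|].
  exists l. intros z Hz E. apply prodl_eq_0. rewrite H2 in E.
  destruct (Ceq_dec (prodl l z) 0%C) as [E0|E0]; [exact E0|].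
  exfalso. revert E. apply Cmult_neq_0; [exact E0 | now apply H4].
Qed.

Lemma zero_free_circle (Gs : list (C -> C)) (a b : R) :
  (forall G, In G Gs -> ent G /\ exists z0, G z0 <> 0%C) -> a < b ->
  exists r, a <= r <= b /\ forall G, In G Gs -> forall z, Cmod z = r -> G z <> 0%C.
Proof.
  intros HG Hab.
  assert (H : exists L : list C, forall G, In G Gs -> forall z, Cmod z <= b -> G z = 0%C -> In z L).
  { induction Gs as [|G Gs IH].
    - exists nil. intros G [].
    - destruct IH as [L HL]; [intros G' HG'; apply HG; now right|].
      destruct (HG G (or_introl eq_refl)) as [Hent [z0 Hz0]].
      destruct (zeros_in_list G z0 b Hent Hz0) as [l Hl].
      exists (l ++ L). intros G' [<-|HG'] z Hz E; apply in_app_iff; [left; auto | right; eauto]. }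
  destruct H as [L HL]. destruct (avoid_moduli L a b Hab) as [r [Hr Hav]].
  exists r. split; [exact Hr|]. intros G HGs z Hz E. apply (Hav z); [|exact Hz].
  apply (HL G HGs); [lra | exact E].
Qed.

Lemma lead_uniform (Gs : list (C -> C)) :
  (forall G, In G Gs -> ent G /\ exists z0, G z0 <> 0%C) ->
  exists c, 0 <= c /\ forall G, In G Gs -> forall r l G1, 0 < r -> factors G r l G1 ->
    Rabs (lead l G1) <= c.
Proof.
  induction Gs as [|G Gs IH]; intros HG.
  - exists 0. split; [lra | intros G []].
  - destruct IH as [c [Hc0 Hc]]; [intros G' HG'; apply HG; now right|].
    destruct (HG G (or_introl eq_refl)) as [Hent [z0 Hz0]].
    destruct (lead_constant G z0 Hent Hz0) as [c' Hc'].
    exists (c + Rabs c'). pose proof (Rabs_pos c'). split; [lra|].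
    intros G' [<-|HG'] r l G1 Hr Hf.
    + rewrite (Hc' r l G1 Hr Hf). lra.
    + pose proof (Hc G' HG' r l G1 Hr Hf). lra.
Qed.

Lemma exp_step (x y : R) : exp x * (1 + y) <= exp (x + y).
Proof.
  rewrite exp_plus. apply Rmult_le_compat_l; [apply Rlt_le, exp_pos|].
  destruct (Req_EM_T y 0) as [->|Hy]; [rewrite exp_0; lra | apply Rlt_le, exp_ineq1; exact Hy].
Qed.

Lemma exp_le_inv_sub (x : R) : x < 1 -> exp x <= / (1 - x).
Proof.
  intros Hx. pose proof (exp_step 0 (- x)) as H. rewrite exp_0, Rplus_0_l, exp_Ropp in H.
  rewrite <- (Rinv_inv (exp x)). apply Rinv_le_contravar; lra.
Qed.

Lemma cmean_log_plus_le (G : C -> C) (r M : R) :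
  ent G -> (forall t, log_plus (Cmod (G (cir r t))) <= M) ->
  cmean (fun t => log_plus (Cmod (G (cir r t)))) <= M.
Proof.
  intros HG HM. rewrite <- (cmean_const M). apply cmean_le.
  - intros t. now apply continuous_log_plus_cir.
  - intros t. apply continuous_const.
  - exact HM.
Qed.

(* Crude powers of [a] suffice: only the logarithm of the bound on the
   logarithmic derivatives enters the final estimate. *)
Lemma good_circle (Gs : list (C -> C)) (Nf : C -> R) (A : R -> R) (c1 : R) :
  (forall G, In G Gs -> ent G /\ exists z0, G z0 <> 0%C) -> 0 <= c1 ->
  (forall G, In G Gs -> forall z, log_plus (Cmod (G z)) <= Nf z + c1) ->
  (forall z r, Cmod z <= r -> Nf z <= A r) ->
  exists c, 3 <= c /\ forall s a, 0 <= s -> c <= a -> A (exp (s + / ln a)) <= a ^ 2 ->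
    exists r e, exp (s + 1 * / ln a / 5) <= r /\ r + 2 * e <= exp (s + 3 * / ln a / 5) /\
      0 < e /\ / (6000 * (INR (length Gs) + 1) * a ^ 7) <= e /\
      forall G, In G Gs -> forall z, r - 2 * e <= Cmod z <= r + 2 * e ->
        G z <> 0%C /\
        Cmod (C_derive G z) <= 6000 * (INR (length Gs) + 1) * a ^ 7 * Cmod (G z).
Proof.
  intros HGs Hc1 HN HA. destruct (lead_uniform Gs HGs) as [cs [Hcs Hlead]].
  exists (2 * (c1 + cs) + 3). split; [lra|]. intros s a Hs Ha HAa.
  set (M := INR (length Gs) + 1).
  assert (HM : 1 <= M) by (unfold M; pose proof (pos_INR (length Gs)); lra).
  assert (HB1 : 1 <= ln a).
  { rewrite <- (ln_exp 1). apply ln_le; [apply exp_pos|]. pose proof exp_le_3. lra. }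
  assert (HBa : ln a <= a).
  { pose proof (exp_step 0 (ln a)) as H. rewrite exp_0, Rplus_0_l, exp_ln in H by lra. lra. }
  set (B := ln a) in *. set (d := / B) in *.
  assert (HdB : d * B = 1) by (unfold d; field; lra).
  assert (Hd0 : 0 < d) by (apply Rinv_0_lt_compat; lra).
  assert (Hd1 : d <= 1) by nra.
  assert (Hda : / a <= d) by (apply Rinv_le_contravar; lra).
  assert (Hia : 0 < / a) by (apply Rinv_0_lt_compat; lra).
  (* Five radii in the band where [A] is at most [a ^ 2]: the circle is found between [e1] and [e2],
     its annulus ends before [e3], the functions are factored on a zero-free circle between [e3] and
     [e4], and [e5] supplies the growth bound for counting zeros. *)
  set (e1 := exp (s + 1 * d / 5)). set (e2 := exp (s + 2 * d / 5)). set (e3 := exp (s + 3 * d / 5)).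
  set (e4 := exp (s + 4 * d / 5)). set (e5 := exp (s + d)) in *.
  assert (Hge1 : forall x, 0 <= x -> 1 <= exp (s + x)).
  { intros x Hx. rewrite <- exp_0. destruct (Rle_lt_or_eq_dec 0 (s + x)) as [H|H]; [lra | |].
    - left. now apply exp_increasing.
    - right. now rewrite H. }
  assert (He1 : 1 <= e1) by (apply Hge1; lra).
  assert (H12 : e1 * (1 + d / 5) <= e2).
  { unfold e1, e2. replace (s + 2 * d / 5) with ((s + 1 * d / 5) + d / 5) by field. apply exp_step. }
  assert (H23 : e2 * (1 + d / 5) <= e3).
  { unfold e2, e3. replace (s + 3 * d / 5) with ((s + 2 * d / 5) + d / 5) by field. apply exp_step. }
  assert (H34 : e3 < e4) by (apply exp_increasing; lra).
  assert (H45 : e4 < e5) by (apply exp_increasing; lra).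
  assert (H24 : e4 <= 2 * e2).
  { unfold e4, e2. replace (s + 4 * d / 5) with ((s + 2 * d / 5) + 2 * d / 5) by field.
    rewrite exp_plus, Rmult_comm. apply Rmult_le_compat_r; [apply Rlt_le, exp_pos|].
    eapply Rle_trans; [apply exp_le_inv_sub; lra|].
    replace 2 with (/ / 2) by (apply Rinv_inv). apply Rinv_le_contravar; lra. }
  assert (He2 : 1 <= e2) by nra.
  assert (He3 : 1 <= e3) by nra.
  destruct (zero_free_circle Gs e3 e4 HGs H34) as [r2 [Hr2 Hfree]].
  assert (Ha2 : c1 + cs <= a ^ 2 / 2) by nra.
  assert (Ha3 : a ^ 2 <= a ^ 3) by (simpl; nra).
  assert (HNe5 : forall G z, In G Gs -> Cmod z <= e5 -> log_plus (Cmod (G z)) <= a ^ 2 + c1).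
  { intros G z HG Hz. specialize (HN G HG z). specialize (HA z e5 Hz). lra. }
  assert (Hfac : forall G, In G Gs -> exists l,
     (exists G1, factors G r2 l G1) /\ INR (length l) <= 10 * a ^ 3).
  { intros G HG. destruct (HGs G HG) as [Hent [z0 Hz0]].
    destruct (factors_exist G z0 r2 Hent Hz0 (Hfree G HG)) as [l [G1 Hf]].
    exists l. split; [now exists G1|].
    pose proof (Hlead G HG r2 l G1 ltac:(lra) Hf) as Hl.
    pose proof (zero_count_bound G r2 e5 (a ^ 2 + c1) l G1 ltac:(lra) ltac:(lra) Hf) as Hcount.
    assert (Hlen : INR (length l) * (ln e5 - ln r2) <= a ^ 2 + c1 - lead l G1).
    { apply Hcount. intros t. eapply Rle_trans; [apply exp_log_plus|].
      assert (Hb : log_plus (Cmod (G (cir e5 t))) <= a ^ 2 + c1).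
      { apply HNe5; [exact HG|]. rewrite Cmod_cir; lra. }
      destruct Hb as [Hb|Hb]; [left; now apply exp_increasing | right; now rewrite Hb]. }
    assert (Hln : d / 5 <= ln e5 - ln r2).
    { assert (ln r2 <= ln e4) by (apply ln_le; lra).
      unfold e5, e4 in *. rewrite !ln_exp in *. lra. }
    pose proof (pos_INR (length l)) as Hn0.
    apply Rabs_le_between in Hl.
    assert (H1 : INR (length l) * (d / 5) <= 2 * a ^ 2).
    { apply Rle_trans with (INR (length l) * (ln e5 - ln r2)); [now apply Rmult_le_compat_l|]. lra. }
    assert (H2 : INR (length l) <= 10 * a ^ 2 * B).
    { replace (INR (length l)) with (INR (length l) * (d / 5) * (5 * B)).
      - replace (10 * a ^ 2 * B) with (2 * a ^ 2 * (5 * B)) by ring.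
        apply Rmult_le_compat_r; lra.
      - transitivity (INR (length l) * (d * B)); [field | rewrite HdB; ring]. }
    assert (H3 : 10 * a ^ 2 * B <= 10 * a ^ 2 * a) by (apply Rmult_le_compat_l; nra).
    simpl in *; lra. }
  destruct (lists_union _ _ Gs Hfac) as [L [HL HGL]].
  assert (Ha0 : 0 < a) by lra.
  assert (Hpa : forall n, 1 <= a ^ n) by (intros n; apply pow_R1_Rle; lra).
  (* All functions together have at most [10 * M * a ^ 3] listed zeros. Forbidding [4 * e] on either
     side of each modulus uses at most 1/(10 a), less than [e2 - e1], which is at least 1/(5 a). *)
  set (e := / (800 * M * a ^ 4)).
  assert (He0 : 0 < e).
  { apply Rinv_0_lt_compat. apply Rmult_lt_0_compat; [lra | apply pow_lt; lra]. }
  assert (He800 : e * (800 * M * a ^ 4) = 1).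
  { unfold e. field. split; lra. }
  assert (Hea : 400 * e <= / a / 2).
  { apply Rmult_le_reg_r with (2 * a); [lra|]. replace (/ a / 2 * (2 * a)) with 1 by (field; lra).
    apply Rle_trans with (e * (800 * M * a ^ 4)); [|lra].
    replace (400 * e * (2 * a)) with (e * (800 * a)) by ring.
    apply Rmult_le_compat_l; [lra|].
    assert (a <= a ^ 4) by (pose proof (Hpa 3%nat); simpl in *; nra). nra. }
  (* A gap of [4 * e] in the moduli leaves distance [2 * e] from the zeros for every point of the
     annulus of half-width [2 * e]. *)
  destruct (gap_point (map Cmod L) (4 * e) e1 e2 ltac:(lra)) as [r [Hr Hgap]].
  { rewrite length_map.
    apply Rle_lt_trans with (/ a / 10).
    - assert (HLM : INR (length L) <= M * (10 * a ^ 3)).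
      { eapply Rle_trans; [exact HL|]. apply Rmult_le_compat_r; [pose proof (Hpa 3%nat); lra | unfold M; lra]. }
      apply Rle_trans with (8 * e * (M * (10 * a ^ 3))).
      + replace (2 * (4 * e)) with (8 * e) by ring. apply Rmult_le_compat_l; lra.
      + right. apply Rmult_eq_reg_r with (10 * a); [|lra].
        replace (/ a / 10 * (10 * a)) with 1 by (field; lra).
        rewrite <- He800. ring.
    - nra. }
  assert (Hre3 : r + 2 * e <= e2 + 2 * e) by lra.
  assert (H23' : e2 * d / 5 <= e3 - e2) by lra.
  assert (He2d : / a / 5 <= e2 * d / 5) by nra.
  exists r, e. split; [lra|]. split; [lra|]. split; [exact He0|]. split.
  { unfold e. apply Rinv_le_contravar.
    - apply Rmult_lt_0_compat; [lra | apply pow_lt; lra].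
    - assert (a ^ 4 <= a ^ 7) by (apply Rle_pow; [lra | lia]).
      assert (800 * M <= 6000 * M) by lra. pose proof (Hpa 4%nat).
      apply Rmult_le_compat; lra. }
  intros G HG z Hz.
  destruct (HGL G HG) as [l [[G1 Hf] [Hlen Hincl]]].
  destruct (HGs G HG) as [Hent _].
  assert (Hdist : forall b, In b l -> 2 * e <= Cmod (z - b)).
  { intros b Hb. specialize (Hgap (Cmod b) (in_map Cmod L b (Hincl b Hb))).
    pose proof (Cmod_triangle_rev z b) as T1. pose proof (Cmod_triangle_rev b z) as T2.
    rewrite (Cmod_sub_sym b z) in T2. unfold Rabs in Hgap. destruct (Rcase_abs (Cmod b - r)); lra. }
  assert (Hgapz : e2 * d / 10 <= r2 - Cmod z) by lra.
  split.
  - pose proof Hf as [_ [F2 [_ F4]]]. rewrite F2. apply Cmult_neq_0.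
    + intros E. apply prodl_eq_0 in E. specialize (Hdist z E). rewrite Cminus_diag, Cmod_0 in Hdist. lra.
    + apply F4. nra.
  - pose proof (log_derivative_bound G r2 (2 * e) l G1 z ltac:(lra) Hent Hf ltac:(nra) ltac:(lra) Hdist) as LD.
    eapply Rle_trans; [exact LD|]. apply Rmult_le_compat_r; [apply Cmod_ge_0|]. clear LD.
    pose proof (Hlead G HG r2 l G1 ltac:(lra) Hf) as Hl. apply Rabs_le_between in Hl.
    assert (Hm : cmean (fun t => log_plus (Cmod (G (cir r2 t)))) <= a ^ 2 + c1).
    { apply cmean_log_plus_le; [exact Hent|]. intros t. apply HNe5; [exact HG|]. rewrite Cmod_cir; lra. }
    pose proof (cmean_log_plus_ge_0 G r2 Hent) as Hm0.
    set (m := cmean (fun t => log_plus (Cmod (G (cir r2 t))))) in *.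
    set (rz := r2 - Cmod z) in *.
    assert (Hrz : e2 / (10 * a) <= rz).
    { eapply Rle_trans; [|exact Hgapz].
      replace (e2 / (10 * a)) with (e2 * / a / 10) by (field; lra). nra. }
    assert (Hrz0 : 0 < e2 / (10 * a)) by (apply Rdiv_lt_0_compat; lra).
    assert (T1 : 2 * r2 / rz ^ 2 <= 400 * a ^ 2).
    { apply Rle_trans with (2 * (2 * e2) / (e2 / (10 * a)) ^ 2).
      - apply Rmult_le_compat; [lra | | lra |].
        + apply Rlt_le, Rinv_0_lt_compat, pow_lt. lra.
        + apply Rinv_le_contravar; [apply pow_lt; lra|]. apply pow_incr. lra.
      - replace (2 * (2 * e2) / (e2 / (10 * a)) ^ 2) with (400 * a ^ 2 * / e2) by (field; lra).
        assert (/ e2 <= 1) by (rewrite <- Rinv_1; apply Rinv_le_contravar; lra).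
        pose proof (Hpa 2%nat). nra. }
    assert (T2 : 2 * r2 / rz ^ 2 * (2 * m - lead l G1) <= 1600 * a ^ 4).
    { apply Rle_trans with (2 * r2 / rz ^ 2 * (4 * a ^ 2)).
      - apply Rmult_le_compat_l; [|lra]. apply Rmult_le_pos; [lra|].
        apply Rlt_le, Rinv_0_lt_compat, pow_lt. lra.
      - replace (1600 * a ^ 4) with (400 * a ^ 2 * (4 * a ^ 2)) by ring.
        apply Rmult_le_compat_r; [pose proof (Hpa 2%nat); lra | exact T1]. }
    assert (T3 : / (2 * e) = 400 * M * a ^ 4).
    { unfold e. field. split; lra. }
    assert (T4 : / rz <= 10 * a).
    { apply Rle_trans with (/ (e2 / (10 * a))); [now apply Rinv_le_contravar|].
      replace (/ (e2 / (10 * a))) with (10 * a * / e2) by (field; lra).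
      assert (/ e2 <= 1) by (rewrite <- Rinv_1; apply Rinv_le_contravar; lra). nra. }
    assert (T5 : INR (length l) * (/ (2 * e) + / rz) <= 10 * a ^ 3 * (400 * M * a ^ 4 + 10 * a)).
    { apply Rmult_le_compat; [apply pos_INR | | exact Hlen | lra].
      apply Rplus_le_le_0_compat; apply Rlt_le, Rinv_0_lt_compat; lra. }
    assert (T6 : a ^ 4 <= a ^ 7) by (apply Rle_pow; [lra | lia]).
    replace (10 * a ^ 3 * (400 * M * a ^ 4 + 10 * a)) with (4000 * M * a ^ 7 + 100 * a ^ 4) in T5 by ring.
    replace (6000 * M * a ^ 7) with (4000 * M * a ^ 7 + 2000 * M * a ^ 7) by ring.
    pose proof (Hpa 7%nat).
    assert (2000 * a ^ 7 <= 2000 * M * a ^ 7) by nra. lra.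
Qed.

(** [A] is 1 plus the supremum, so [1 <= A r]. Attainment is not claimed: a point within 1 of the
    supremum is within 2 of [A r]. *)
Lemma sup_on_disks (N : C -> R) :
  (forall r, exists M, forall z, Cmod z <= r -> N z <= M) -> (forall z, 0 <= N z) ->
  exists A : R -> R, (forall z r, Cmod z <= r -> N z <= A r) /\
    (forall r, 0 <= r -> exists z, Cmod z <= r /\ A r - 2 <= N z) /\
    (forall r r', r <= r' -> A r <= A r') /\ (forall r, 1 <= A r).
Proof.
  intros Hb H0.
  (* [Rmax r 0] keeps the set nonempty for negative [r], so that [A] is monotone on all reals. *)
  set (E := fun r y => exists z, Cmod z <= Rmax r 0 /\ y = N z).
  assert (HE : forall r, {x | is_lub (E r) x}).
  { intros r. apply completeness.
    - destruct (Hb (Rmax r 0)) as [M HM]. exists M. intros y [z [Hz ->]]. now apply HM.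
    - exists (N 0%C), 0%C. split; [rewrite Cmod_0; apply Rmax_r | reflexivity]. }
  exists (fun r => 1 + proj1_sig (HE r)).
  assert (Hub : forall z r, Cmod z <= Rmax r 0 -> N z <= proj1_sig (HE r)).
  { intros z r Hz. destruct (HE r) as [x [Hx1 Hx2]]. simpl. apply Hx1. now exists z. }
  split; [|split; [|split]].
  - intros z r Hz. specialize (Hub z r). pose proof (Rmax_l r 0).
    specialize (Hub ltac:(lra)). lra.
  - intros r Hr. apply NNPP. intros Hno.
    assert (Hle : proj1_sig (HE r) <= proj1_sig (HE r) - 1).
    { destruct (HE r) as [x [Hx1 Hx2]]. simpl in *. apply Hx2. intros y [z [Hz ->]].
      apply Rnot_lt_le. intros Hlt. apply Hno. exists z. rewrite Rmax_left in Hz by exact Hr.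
      split; [exact Hz | lra]. }
    lra.
  - intros r r' Hr. apply Rplus_le_compat_l.
    destruct (HE r) as [x [Hx1 Hx2]]. simpl. apply Hx2. intros y [z [Hz ->]]. apply Hub.
    eapply Rle_trans; [exact Hz | apply Rle_max_compat_r, Hr].
  - intros r. specialize (Hub 0%C r). rewrite Cmod_0 in Hub. specialize (Hub (Rmax_r _ _)).
    pose proof (H0 0%C). lra.
Qed.

(** This compares a = exp b with what [growth_circle] loses: a factor quadratic in [b] from
    interpolation and a linear one from log K. The left side is cubic, and [exp b] is at least
    [(b / 4) ^ 4]; 256 is 4^4. *)
Lemma exp_dominates (p q : R) : 0 <= p -> 0 <= q ->
  exists b0, 1 <= b0 /\ forall b, b0 <= b ->
    (p * b + q) * (2 * (1 + 7200 * b ^ 2)) + 2 <= exp b.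
Proof.
  intros Hp Hq. set (k := 14402 * (p + q) + 2).
  assert (Hk : 2 <= k) by (unfold k; lra).
  exists (256 * k). split; [lra|]. intros b Hb.
  assert (He : (b / 4) ^ 4 <= exp b).
  { replace b with (b / 4 + b / 4 + b / 4 + b / 4) at 2 by field. rewrite !exp_plus.
    pose proof (exp_step 0 (b / 4)) as H. rewrite exp_0, Rplus_0_l in H.
    assert (H1 : 0 <= b / 4 <= exp (b / 4)) by lra.
    set (x := b / 4) in *. set (y := exp x) in *.
    assert (x * x <= y * y) by nra. assert (0 <= x * x) by nra.
    assert ((x * x) * (x * x) <= (y * y) * (y * y)) by nra. simpl. lra. }
  assert (Hb1 : 1 <= b) by lra.
  assert (Hb2 : 1 <= b ^ 2) by (simpl; nra).
  assert (H1 : (p * b + q) * (2 * (1 + 7200 * b ^ 2)) + 2 <= k * b ^ 3).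
  { assert (p * b + q <= (p + q) * b) by nra.
    assert (2 * (1 + 7200 * b ^ 2) <= 14402 * b ^ 2) by lra.
    apply Rle_trans with ((p + q) * b * (14402 * b ^ 2) + 2 * b ^ 3).
    - apply Rplus_le_compat.
      + apply Rmult_le_compat; nra.
      + replace (b ^ 3) with (b * b ^ 2) by ring. nra.
    - unfold k. right. ring. }
  assert (H2 : k * b ^ 3 <= (b / 4) ^ 4).
  { replace ((b / 4) ^ 4) with (b / 256 * b ^ 3) by field.
    apply Rmult_le_compat_r; [apply pow_le; lra | lra]. }
  lra.
Qed.

(** * The estimate for u, v and h *)

Lemma log_plus_scal_le (k x : R) : 1 <= k -> 0 <= x -> log_plus (k * x) <= ln k + log_plus x.
Proof.
  intros Hk Hx. rewrite !log_plus_ln.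
  assert (H1 : 0 < Rmax 1 x) by (eapply Rlt_le_trans; [apply Rlt_0_1 | apply Rmax_l]).
  rewrite <- ln_mult by lra. apply ln_le.
  - eapply Rlt_le_trans; [apply Rlt_0_1 | apply Rmax_l].
  - pose proof (Rmax_l 1 x). pose proof (Rmax_r 1 x). apply Rmax_lub; nra.
Qed.

(** Its circular mean plays the role of a characteristic of the pair. Up to additive constants it
    dominates log+ of |f| and |h| too, so one majorant serves all four functions. *)
Definition logmax (u v : C -> C) (z : C) : R := log_plus (Rmax (Cmod (u z)) (Cmod (v z))).

Lemma continuous_logmax_cir (u v : C -> C) (r t : R) :
  ent u -> ent v -> continuous (fun t => logmax u v (cir r t)) t.
Proof.
  intros Hu Hv. apply (continuous_log_plus_comp (fun t => Rmax (Cmod (u (cir r t))) (Cmod (v (cir r t))))).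
  assert (Hcu : continuous (fun t => Cmod (u (cir r t))) t).
  { apply (continuous_Cmod_comp (fun t => u (cir r t))). now apply continuous_cir_comp, ent_continuous. }
  assert (Hcv : continuous (fun t => Cmod (v (cir r t))) t).
  { apply (continuous_Cmod_comp (fun t => v (cir r t))). now apply continuous_cir_comp, ent_continuous. }
  apply (continuous_ext (fun t => Cmod (u (cir r t)) + Rmax 0 (Cmod (v (cir r t)) + - Cmod (u (cir r t))))).
  - intros s. unfold Rmax. destruct (Rle_dec 0 (Cmod (v (cir r s)) + - Cmod (u (cir r s)))),
      (Rle_dec (Cmod (u (cir r s))) (Cmod (v (cir r s)))); lra.
  - apply continuous_Rplus; [exact Hcu|].
    apply (continuous_Rmax_const 0 (fun t => Cmod (v (cir r t)) + - Cmod (u (cir r t)))).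
    apply continuous_Rplus; [exact Hcv | now apply continuous_Ropp].
Qed.

Lemma ent_bounded_on_disk (f : C -> C) (r : R) :
  ent f -> exists M, forall z, Cmod z <= r -> Cmod (f z) <= M.
Proof.
  intros Hf. destruct (circle_bound f (r + 1) Hf) as [M [HM0 HM]].
  exists (M * (r + 1)). intros z Hz. pose proof (Cmod_ge_0 z).
  eapply Rle_trans; [apply (ent_bound_inside f (r + 1) M z Hf ltac:(lra) HM)|].
  apply Rmult_le_compat_l; [lra|]. unfold Rdiv.
  assert (Hi : / (r + 1 - Cmod z) <= 1) by (rewrite <- Rinv_1; apply Rinv_le_contravar; lra).
  nra.
Qed.

Section Growth.

Variables (f u v h : C -> C) (c0 : R).
Hypotheses (Hu : ent u) (Hv : ent v) (Hh : ent h) (Hf : ent f).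
Hypotheses (Hu0 : exists z, u z <> 0%C) (Hv0 : exists z, v z <> 0%C) (Hh0 : exists z, h z <> 0%C).
Hypothesis Hfuv : forall z, f z = (u z - v z)%C.
Hypothesis Hc0 : 0 <= c0.
Hypothesis Hhuv : forall z, Cmod (h z) <= c0 * Rmax (Cmod (u z)) (Cmod (v z)).
Hypothesis Hunb : forall M, exists z, M < Cmod (f z).

Let T (r : R) : R := cmean (fun t => logmax u v (cir r t)).

(** As [q] is arbitrary, log K is negligible against [T r]. The reason: K is a constant times
    [a ^ 7], so its logarithm is linear in b = ln a, whereas a near-maximal value inside the circle
    forces [T r] to be at least of order a/b^2. [W] only has to avoid zeros, so it may be any
    nonzero entire function. *)
Lemma growth_circle (W : C -> C) (q M : R) :
  ent W -> (exists z, W z <> 0%C) -> 0 <= q ->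
  exists r K, M < r /\ 1 <= r /\ 1 <= K /\ q * ln K + q <= T r /\
    forall z, Cmod z = r -> W z <> 0%C /\
      forall G, In G (u :: v :: f :: h :: nil) -> G z <> 0%C /\
        forall w, Cmod (w - z) <= / K -> Cmod (C_derive G w) <= K * Cmod (G w).
Proof.
  intros HW HW0 Hq. set (Gs := u :: v :: f :: h :: nil).
  assert (HGs : forall G, In G Gs -> ent G /\ exists z0, G z0 <> 0%C).
  { intros G [<-|[<-|[<-|[<-|[]]]]]; split; trivial.
    destruct (Hunb 0) as [z Hz]. exists z. now apply Cmod_gt_0. }
  set (c1 := ln (2 + c0)).
  assert (Hc1 : 0 <= c1) by (unfold c1; rewrite <- ln_1; apply ln_le; lra).
  assert (HN : forall G, In G Gs -> forall z, log_plus (Cmod (G z)) <= logmax u v z + c1).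
  { intros G HG z. unfold logmax. set (x := Rmax (Cmod (u z)) (Cmod (v z))).
    pose proof (Cmod_ge_0 (u z)) as P1. pose proof (Cmod_ge_0 (v z)) as P2.
    assert (X1 : Cmod (u z) <= x) by apply Rmax_l. assert (X2 : Cmod (v z) <= x) by apply Rmax_r.
    apply Rle_trans with (log_plus ((2 + c0) * x)).
    - apply log_plus_le. destruct HG as [<-|[<-|[<-|[<-|[]]]]]; try nra.
      + rewrite Hfuv. eapply Rle_trans; [apply Cmod_triangle_sub|]. nra.
      + eapply Rle_trans; [apply Hhuv|]. fold x. nra.
    - rewrite (Rplus_comm (log_plus x)). apply log_plus_scal_le; lra. }
  destruct (sup_on_disks (logmax u v)) as [A [HA1 [HA2 [HA3 HA4]]]].
  { intros r. destruct (ent_bounded_on_disk u r Hu) as [Mu HMu].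
    destruct (ent_bounded_on_disk v r Hv) as [Mv HMv].
    exists (log_plus (Rmax Mu Mv)). intros z Hz. apply log_plus_le.
    apply Rmax_lub; [eapply Rle_trans; [now apply HMu | apply Rmax_l]
                    | eapply Rle_trans; [now apply HMv | apply Rmax_r]]. }
  { intros z. apply log_plus_ge_0. }
  destruct (good_circle Gs (logmax u v) A c1 HGs Hc1 HN HA1) as [c [Hc Hgood]].
  destruct (lead_uniform Gs HGs) as [cl [Hcl Hlead]].
  assert (H30 : 0 <= ln 30000) by (rewrite <- ln_1; apply ln_le; lra).
  destruct (exp_dominates (7 * q) (q * ln 30000 + q + cl) ltac:(lra) ltac:(nra)) as [b0 [Hb0 Hdom]].
  (* From the radius of [zY] on, [A] is at least [Y]. This makes [a] large enough for [good_circle]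
     and its logarithm at least [b0]. *)
  set (Y := Rmax (exp b0) c).
  destruct (Hunb (2 * exp Y)) as [zY HzY].
  assert (HNY : Y <= logmax u v zY).
  { unfold logmax. rewrite <- (ln_exp Y). eapply Rle_trans; [|apply log_plus_ge_ln].
    apply ln_le; [apply exp_pos|]. rewrite Hfuv in HzY.
    pose proof (Cmod_triangle_sub (u zY) (v zY)).
    pose proof (Rmax_l (Cmod (u zY)) (Cmod (v zY))). pose proof (Rmax_r (Cmod (u zY)) (Cmod (v zY))). lra. }
  set (m0 := Rmax 1 (Rmax (Cmod zY) M)). set (s0 := ln m0).
  assert (Hm0 : 1 <= m0) by apply Rmax_l.
  assert (Hm1 : Cmod zY <= m0) by (eapply Rle_trans; [apply Rmax_l | apply Rmax_r]).
  assert (Hm2 : M <= m0) by (eapply Rle_trans; [apply Rmax_r | apply Rmax_r]).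
  assert (Hs0 : 0 <= s0) by (unfold s0; rewrite <- ln_1; apply ln_le; lra).
  assert (Hexp : forall s s', s <= s' -> exp s <= exp s').
  { intros s s' [H|H]; [left; now apply exp_increasing | right; now rewrite H]. }
  assert (Hes : forall s, s0 <= s -> m0 <= exp s).
  { intros s Hs. rewrite <- (exp_ln m0) by lra. now apply Hexp. }
  assert (HAY : forall s, s0 <= s -> Y <= A (exp s)).
  { intros s Hs. eapply Rle_trans; [exact HNY|]. apply HA1. specialize (Hes s Hs). lra. }
  set (B := fun s => ln (A (exp s))).
  assert (HB0 : forall s, s0 <= s -> b0 <= B s).
  { intros s Hs. unfold B. rewrite <- (ln_exp b0). apply ln_le; [apply exp_pos|].
    eapply Rle_trans; [apply Rmax_l | now apply HAY]. }
  (* [B] is the logarithm of [A] in the variable log r, so doubling [B] means squaring [A]: exactly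
     the growth allowed by [good_circle]. *)
  destruct (borel_growth B s0) as [s [Hs HBs]].
  { intros s Hs. specialize (HB0 s Hs). lra. }
  { intros s s' Hss. unfold B. pose proof (HA4 (exp s)). apply ln_le; [lra|]. now apply HA3, Hexp. }
  set (a := A (exp s)).
  assert (Ha : Y <= a) by now apply HAY.
  assert (Hca : c <= a) by (eapply Rle_trans; [apply Rmax_r | exact Ha]).
  assert (Hlna : B s = ln a) by reflexivity.
  assert (HAa : A (exp (s + / ln a)) <= a ^ 2).
  { rewrite <- Hlna. pose proof (HA4 (exp (s + / B s))).
    rewrite <- (exp_ln (A (exp (s + / B s)))) by lra.
    replace (a ^ 2) with (exp (2 * B s)).
    - apply Hexp. exact HBs.
    - replace (2 * B s) with (B s + B s) by ring. rewrite exp_plus, Hlna, exp_ln by lra. ring. }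
  destruct (Hgood s a ltac:(lra) Hca HAa) as [r1 [e [Hr1 [Hr1e [He0 [HeK Hgs]]]]]].
  replace (INR (length Gs) + 1) with 5 in * by (simpl; ring).
  set (K := 6000 * 5 * a ^ 7) in *.
  assert (Ha7 : 1 <= a ^ 7) by (apply pow_R1_Rle; lra).
  assert (HK1 : 1 <= K) by (unfold K; lra).
  (* One half of the half-width [2 * e] is spent on moving off the zeros of [W], the other on the
     disks of radius 1/K, which is at most [e]. *)
  destruct (zero_free_circle (W :: nil) r1 (r1 + e)) as [r [Hr HWr]].
  { intros G [<-|[]]. now split. }
  { lra. }
  set (b := B s) in *. rewrite <- Hlna in Hr1, Hr1e.
  assert (Hb : b0 <= b) by now apply HB0.
  set (d := / b) in *.
  assert (Hd0 : 0 < d) by (apply Rinv_0_lt_compat; lra).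
  assert (Hdb : d * b = 1) by (unfold d; field; lra).
  assert (Hd1 : d <= 1) by nra.
  set (e0 := exp s) in *.
  assert (He0m : m0 <= e0) by now apply Hes.
  assert (He1 : e0 * (1 + d / 5) <= exp (s + 1 * d / 5)).
  { replace (1 * d / 5) with (d / 5) by field. apply exp_step. }
  assert (He3 : exp (s + 3 * d / 5) <= 3 * e0).
  { rewrite exp_plus, Rmult_comm. apply Rmult_le_compat_r; [lra|].
    eapply Rle_trans; [apply exp_le_inv_sub; lra|].
    replace 3 with (/ / 3) by (apply Rinv_inv). apply Rinv_le_contravar; lra. }
  assert (Hre0 : e0 * (d / 5) <= r - e0) by lra.
  assert (Hrpos : 0 < e0 * (d / 5)) by (apply Rmult_lt_0_compat; lra).
  exists r, K. split; [lra|]. split; [lra|]. split; [exact HK1|]. split.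
  - destruct (HA2 e0 ltac:(lra)) as [z0 [Hz0 Hz0A]]. fold a in Hz0A.
    (* At the near-maximal point one of [u], [v] realizes the maximum, and the interior bound is
       applied to that function alone. *)
    assert (HG : exists G, In G (u :: v :: nil) /\ logmax u v z0 = log_plus (Cmod (G z0))).
    { unfold logmax, Rmax. destruct (Rle_dec (Cmod (u z0)) (Cmod (v z0))).
      - exists v. split; [right; now left | reflexivity].
      - exists u. split; [now left | reflexivity]. }
    destruct HG as [G [HG EG]]. rewrite EG in Hz0A.
    assert (HGG : In G Gs) by (destruct HG as [<-|[<-|[]]]; [now left | right; now left]).
    destruct (HGs G HGG) as [Hent [zG HzG]].
    destruct (factors_exist G zG r Hent HzG) as [l [G1 HF]].
    { intros z Hz. apply (Hgs G HGG). lra. }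
    pose proof (log_plus_bound_inside G r l G1 z0 ltac:(lra) Hent HF ltac:(lra)) as LB.
    pose proof (Hlead G HGG r l G1 ltac:(lra) HF) as HL.
    assert (HmT : cmean (fun t => log_plus (Cmod (G (cir r t)))) <= T r).
    { apply cmean_le.
      - intros t. now apply continuous_log_plus_cir.
      - intros t. now apply continuous_logmax_cir.
      - intros t. apply log_plus_le. destruct HG as [<-|[<-|[]]]; [apply Rmax_l | apply Rmax_r]. }
    pose proof (cmean_log_plus_ge_0 G r Hent) as Hm.
    set (m := cmean (fun t => log_plus (Cmod (G (cir r t))))) in *.
    (* With [r] at most [3 * e0] and [r - Cmod z0] at least [e0 * (d / 5)], the constant is 32 * 9 *
       25 = 7200. *)
    assert (Hratio : 32 * r ^ 2 / (r - Cmod z0) ^ 2 <= 7200 * b ^ 2).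
    { apply Rle_trans with (32 * (3 * e0) ^ 2 / (e0 * (d / 5)) ^ 2).
      - apply Rmult_le_compat.
        + pose proof (pow2_ge_0 r). lra.
        + apply Rlt_le, Rinv_0_lt_compat, pow_lt. lra.
        + apply Rmult_le_compat_l; [lra|]. apply pow_incr. lra.
        + apply Rinv_le_contravar; [apply pow_lt; lra|]. apply pow_incr. lra.
      - right. unfold d. field. lra. }
    specialize (Hdom b Hb).
    assert (Ea : exp b = a) by (rewrite Hlna; apply exp_ln; lra).
    rewrite Ea in Hdom.
    assert (HlnK : ln K = ln 30000 + 7 * b).
    { unfold K. replace (6000 * 5) with 30000 by ring.
      rewrite ln_mult by lra. rewrite ln_pow by lra. rewrite <- Hlna. simpl INR. ring. }
    rewrite HlnK. pose proof (Rabs_pos (lead l G1)) as HL0.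
    assert (Hb2 : 0 <= 7200 * b ^ 2) by (pose proof (pow2_ge_0 b); lra).
    assert (S1 : a - 2 <= (1 + 7200 * b ^ 2) * (2 * T r + cl)).
    { eapply Rle_trans; [exact Hz0A|]. eapply Rle_trans; [exact LB|].
      apply Rmult_le_compat; try lra.
      apply Rplus_le_le_0_compat; [lra|].
      apply Rmult_le_pos; [pose proof (pow2_ge_0 r); lra|].
      apply Rlt_le, Rinv_0_lt_compat, pow_lt. lra. }
    assert (S2 : (7 * q * b + (q * ln 30000 + q + cl)) * 2 <= 2 * T r + cl).
    { apply Rmult_le_reg_l with (1 + 7200 * b ^ 2); lra. }
    lra.
  - intros z Hz. split; [now apply (HWr W (or_introl eq_refl))|].
    intros G HG. split.
    + apply (Hgs G HG). lra.
    + intros w Hw. apply (Hgs G HG).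
      pose proof (Cmod_triangle_rev w z). pose proof (Cmod_triangle_rev z w) as T2.
      rewrite (Cmod_sub_sym z w) in T2. lra.
Qed.

Variables (k : nat) (cL : R).
Hypothesis HcL : 0 < cL.
Hypothesis HL : forall z K, 1 <= K ->
  (forall w, Cmod (w - z) <= / K -> Cmod (C_derive h w) <= K * Cmod (h w)) ->
  Cmod (u z * v z * h z) <= cL * K ^ k * Cmod (h z).

Lemma product_bound (z : C) (K : R) : 1 <= K -> h z <> 0%C ->
  (forall w, Cmod (w - z) <= / K -> Cmod (C_derive h w) <= K * Cmod (h w)) ->
  Cmod (u z) * Cmod (v z) <= cL * K ^ k.
Proof.
  intros HK Hz HG. pose proof (HL z K HK HG) as H. rewrite !Cmod_mult in H.
  apply Cmod_gt_0 in Hz. now apply Rmult_le_reg_r with (Cmod (h z)).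
Qed.

Lemma ln_poly (x K : R) (n : nat) : 0 < x -> 1 <= K -> ln (x * K ^ n) = ln x + INR n * ln K.
Proof.
  intros Hx HK. rewrite ln_mult, ln_pow; trivial; [lra | apply pow_lt; lra].
Qed.

(** If [u] and [v] were proportional, the bound on their product would bound each by a power of K on
    the circle, making [T r] at most a constant plus k log K, against [growth_circle]. *)
Lemma not_proportional (kap : C) : (forall z, u z = (kap * v z)%C) -> False.
Proof.
  intros E.
  assert (Hkap : kap <> 0%C).
  { intros E0. destruct Hu0 as [z Hz]. apply Hz. rewrite E, E0. ring. }
  pose proof (proj1 (Cmod_gt_0 _) Hkap) as Hk.
  set (m := 1 + Cmod kap).
  set (x := m ^ 2 * (1 + / Cmod kap) * (1 + cL)).
  assert (Hik : 0 < / Cmod kap) by now apply Rinv_0_lt_compat.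
  assert (Hx1 : 1 <= x).
  { unfold x. assert (1 <= m ^ 2) by (unfold m; simpl; nra).
    assert (1 <= m ^ 2 * (1 + / Cmod kap)) by nra. nra. }
  assert (Hlx : 0 <= ln x) by (rewrite <- ln_1; apply ln_le; lra).
  pose proof (pos_INR k) as Hkn.
  (* No further function has to avoid zeros here, so the constant 1 fills the place of [W]; [q]
     exceeds both coefficients of the upper bound for [T r]. *)
  destruct (growth_circle (fun _ => 1%C) (ln x + INR k + 1) 0) as [r [K [_ [Hr [HK [HT Hz]]]]]].
  { apply ent_const. }
  { exists 0%C. apply C1_nz. }
  { lra. }
  assert (HlK : 0 <= ln K) by (rewrite <- ln_1; apply ln_le; lra).
  assert (HTr : T r <= ln x + INR k * ln K).
  { rewrite <- (cmean_const (ln x + INR k * ln K)). apply cmean_le.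
    - intros t. now apply continuous_logmax_cir.
    - intros t. apply continuous_const.
    - intros t. destruct (Hz (cir r t)) as [_ HG]; [apply Cmod_cir; lra|].
      destruct (HG h) as [Hh1 Hh2]; [simpl; tauto|].
      pose proof (product_bound _ K HK Hh1 Hh2) as HP. rewrite E, Cmod_mult in HP.
      unfold logmax. rewrite log_plus_ln, E, Cmod_mult. set (y := Cmod (v (cir r t))) in *.
      assert (Hy : 0 <= y) by apply Cmod_ge_0.
      assert (HK0 : 1 <= K ^ k) by now apply pow_R1_Rle.
      rewrite <- ln_poly by lra.
      apply ln_le; [eapply Rlt_le_trans; [apply Rlt_0_1 | apply Rmax_l]|].
      assert (Hy2 : y * y <= / Cmod kap * (cL * K ^ k)).
      { apply Rmult_le_reg_l with (Cmod kap); [exact Hk|].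
        rewrite <- !Rmult_assoc, Rinv_r, Rmult_1_l by lra. lra. }
      set (X := (1 + / Cmod kap) * (1 + cL) * K ^ k).
      assert (HX1 : 1 <= X).
      { unfold X. assert (1 <= (1 + / Cmod kap) * (1 + cL)) by nra. nra. }
      assert (HyX : y * y <= X).
      { eapply Rle_trans; [exact Hy2|]. unfold X. rewrite <- Rmult_assoc.
        apply Rmult_le_compat_r; [lra|]. nra. }
      assert (HyX' : y <= X) by nra.
      replace (x * K ^ k) with (m ^ 2 * X) by (unfold x, X; ring).
      assert (Hm2 : m <= m ^ 2) by (unfold m; simpl; nra).
      assert (HmX : m * X <= m ^ 2 * X) by (apply Rmult_le_compat_r; lra).
      assert (X <= m * X) by (unfold m; nra).
      apply Rmax_lub; [lra|]. apply Rmax_lub; [|lra].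
      eapply Rle_trans; [|exact HmX]. unfold m. nra. }
  nra.
Qed.

(** Suppose it vanishes. Then [X], the combination of [f] and [v] that is zero at [z1], satisfies X
    v' = X' v. If [X] had a zero of finite order there, cancelling one power less than the order
    would leave the order times Y(z1) v(z1) = 0, with both values nonzero. So [X] is identically 0
    and [u], [v] are proportional. *)
Lemma wronskian_nonzero : exists z, (f z * C_derive v z - C_derive f z * v z)%C <> 0%C.
Proof.
  apply NNPP. intros Hno.
  assert (HW : forall z, (f z * C_derive v z)%C = (C_derive f z * v z)%C).
  { intros z. apply Ceq_minus.
    destruct (Ceq_dec (f z * C_derive v z - C_derive f z * v z)%C 0%C) as [E|E]; [exact E|].
    exfalso. apply Hno. now exists z. }
  destruct Hv0 as [z1 Hz1].
  set (kap := (f z1 / v z1)%C). set (X := fun z => (f z - kap * v z)%C).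
  assert (HX : ent X).
  { apply ent_minus; [exact Hf|]. apply ent_mult; [apply ent_const | exact Hv]. }
  assert (HX' : forall z, C_derive X z = (C_derive f z - kap * C_derive v z)%C).
  { intros z. apply Cd_C_derive. apply Cd_minus; [now apply ent_Cd | now apply Cd_scal, ent_Cd]. }
  assert (HX1 : X z1 = 0%C) by (unfold X, kap; field; exact Hz1).
  assert (HXW : forall z, (X z * C_derive v z)%C = (C_derive X z * v z)%C).
  { intros z. rewrite HX'. unfold X.
    transitivity (f z * C_derive v z - kap * v z * C_derive v z)%C; [ring|]. rewrite HW. ring. }
  destruct (classic (exists z, X z <> 0%C)) as [[zX HzX]|HX0].
  - destruct (factor_exists X zX (fun b => b = z1) (Cmod z1) HX HzX) as [l [Y [HY [E [Hl Hn]]]]].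
    { intros b ->. lra. }
    assert (Hpow : forall z, prodl l z = ((z - z1) ^ length l)%C).
    { intros z. clear - Hl. induction l as [|b l IH]; [reflexivity|].
      simpl. rewrite IH by (intros c Hc; apply Hl; now right).
      now rewrite (Hl b (or_introl eq_refl)). }
    destruct (length l) as [|m].
    + apply (Hn z1 eq_refl). rewrite <- HX1, E, Hpow. simpl. ring.
    + apply (Cmult_neq_0 (RtoC (INR (S m)) * Y z1) (v z1)).
      * apply Cmult_neq_0; [|now apply Hn]. apply RtoC_neq_0. apply not_0_INR. lia.
      * exact Hz1.
      * assert (EX' : forall z, C_derive X z =
          (RtoC (INR (S m)) * (z - z1) ^ m * Y z + (z - z1) ^ S m * C_derive Y z)%C).
        { intros z. apply Cd_C_derive.
          apply Cd_ext with (fun z => (z - z1) ^ S m * Y z)%C; [intros; now rewrite E, Hpow|].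
          eapply Cd_eq.
          - apply Cd_mult; [|now apply ent_Cd].
            apply (Cd_comp (fun x => (x ^ S m)%C) (fun z => (z - z1)%C)); [|apply Cd_pow].
            apply Cd_minus; [apply Cd_id | apply Cd_const].
          - cbv beta. ring. }
        transitivity ((fun z => RtoC (INR (S m)) * Y z * v z
          + (z - z1) * (C_derive Y z * v z - Y z * C_derive v z))%C z1).
        { cbv beta. rewrite Cminus_diag. ring. }
        apply (continuous_zero_off_point (fun z => RtoC (INR (S m)) * Y z * v z
          + (z - z1) * (C_derive Y z * v z - Y z * C_derive v z))%C).
        -- pose proof (ent_C_derive Y HY). pose proof (ent_C_derive v Hv).
           apply ent_continuous. apply ent_plus.
           ++ apply ent_mult; [apply (ent_mult (fun _ => RtoC (INR (S m)))); [apply ent_const | exact HY] | exact Hv].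
           ++ apply ent_mult; [apply ent_minus; [apply ent_id | apply ent_const]|].
              apply ent_minus; now apply ent_mult.
        -- intros w Hw. specialize (HXW w). rewrite EX', E, Hpow in HXW.
           assert (Hwz : (w - z1)%C <> 0%C) by now apply Cminus_eq_contra.
           assert (Hp : ((w - z1) ^ m)%C <> 0%C) by now apply Cpow_nz.
           set (R := (RtoC (INR (S m)) * Y w * v w + (w - z1) * (C_derive Y w * v w - Y w * C_derive v w))%C).
           assert (E2 : ((w - z1) ^ m * R)%C = 0%C).
           { unfold R.
             transitivity ((RtoC (INR (S m)) * (w - z1) ^ m * Y w + (w - z1) ^ S m * C_derive Y w) * v w
               - (w - z1) ^ S m * Y w * C_derive v w)%C; [simpl; ring|]. rewrite <- HXW. ring. }
           destruct (Ceq_dec R 0%C) as [E3|E3]; [exact E3|].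
           exfalso. revert E2. now apply Cmult_neq_0.
  - apply (not_proportional (1 + kap)%C). intros z.
    destruct (Ceq_dec (X z) 0%C) as [E|E]; [|exfalso; apply HX0; now exists z].
    unfold X in E. transitivity (f z - kap * v z + (1 + kap) * v z)%C.
    + rewrite Hfuv. ring.
    + rewrite E. ring.
Qed.

Lemma zero_counting_lower_bound (e M : R) :
  0 < e < 1 -> exists r, M < r /\ 2 <= cmean (fun t => log_plus (Cmod (f (cir r t)))) /\
    (1 - e) * cmean (fun t => log_plus (Cmod (f (cir r t)))) <= Nbar_zeros f r.
Proof.
  intros He. destruct wronskian_nonzero as [zW HzW].
  assert (Hf0 : exists z, f z <> 0%C).
  { destruct (Hunb 0) as [z Hz]. exists z. now apply Cmod_gt_0. }
  destruct Hf0 as [zf Hzf].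
  set (W := fun z => (f z * C_derive v z - C_derive f z * v z)%C).
  assert (HW : ent W).
  { apply ent_minus; apply ent_mult; trivial; now apply ent_C_derive. }
  destruct (distinct_zeros_lower_bound f v zf zW Hf Hv Hzf HzW) as [c1 Hdz].
  destruct (lead_constant W zW HW HzW) as [cW HcW].
  set (x := 2 * (1 + cL)).
  assert (Hlx : 0 <= ln x) by (rewrite <- ln_1; apply ln_le; unfold x; lra).
  pose proof (pos_INR (S k)) as Hkn. pose proof (Rabs_pos c1) as Hc1. pose proof (Rabs_pos cW) as HcW0.
  (* All error terms together are at most Q log K + Q; taking [Q / e] as the factor in
     [growth_circle] makes them at most [e * T r]. *)
  set (Q := Rabs c1 + Rabs cW + ln x + INR (S k) + 3).
  assert (Hie : 1 <= / e) by (rewrite <- Rinv_1; apply Rinv_le_contravar; lra).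
  assert (HQ : 0 <= Q) by (unfold Q; lra).
  destruct (growth_circle W (Q * / e) M) as [r [K [HM [Hr [HK [HT Hz]]]]]].
  { exact HW. } { now exists zW. } { nra. }
  assert (HlK : 0 <= ln K) by (rewrite <- ln_1; apply ln_le; lra).
  set (lK := ln x + INR (S k) * ln K).
  assert (HQT : Rabs c1 + Rabs cW + lK + 3 <= e * T r).
  { apply Rmult_le_compat_l with (r := e) in HT; [|lra].
    replace (e * (Q * / e * ln K + Q * / e)) with (Q * ln K + Q) in HT by (field; lra).
    assert (INR (S k) * ln K <= Q * ln K) by (apply Rmult_le_compat_r; [exact HlK | unfold Q; lra]).
    unfold lK. unfold Q in *. lra. }
  assert (HT0 : 0 <= T r).
  { assert (0 <= lK) by (unfold lK; nra). nra. }
  assert (Hon : forall t, f (cir r t) <> 0%C /\ W (cir r t) <> 0%C /\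
     logmax u v (cir r t) + ln (Cmod (W (cir r t))) <= lK + ln (Cmod (f (cir r t)))).
  { intros t. set (z := cir r t). destruct (Hz z) as [HWz HG]; [apply Cmod_cir; lra|].
    assert (HiK : Cmod (z - z) <= / K).
    { rewrite Cminus_diag, Cmod_0. apply Rlt_le, Rinv_0_lt_compat. lra. }
    destruct (HG u) as [_ Du]; [simpl; tauto|]. specialize (Du z HiK).
    destruct (HG v) as [_ Dv]; [simpl; tauto|]. specialize (Dv z HiK).
    destruct (HG f) as [Hfz Df]; [simpl; tauto|]. specialize (Df z HiK).
    destruct (HG h) as [Hhz Dh]; [simpl; tauto|].
    pose proof (product_bound z K HK Hhz Dh) as HP.
    split; [exact Hfz|]. split; [exact HWz|].
    pose proof (Cmod_ge_0 (u z)) as Pu. pose proof (Cmod_ge_0 (v z)) as Pv. pose proof (Cmod_ge_0 (f z)) as Pf.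
    assert (W1 : Cmod (W z) <= 2 * K * (Cmod (f z) * Cmod (v z))).
    { unfold W. eapply Rle_trans; [apply Cmod_triangle_sub|]. rewrite !Cmod_mult. nra. }
    assert (W2 : Cmod (W z) <= 2 * K * (Cmod (f z) * Cmod (u z))).
    (* Because f = u - v, both expressions are the Wronskian of u and v. *)
    { replace (W z) with (f z * C_derive u z - C_derive f z * u z)%C.
      - eapply Rle_trans; [apply Cmod_triangle_sub|]. rewrite !Cmod_mult. nra.
      - assert (Ef : C_derive f z = (C_derive u z - C_derive v z)%C).
        { apply Cd_C_derive. apply Cd_ext with (fun z => u z - v z)%C; [intros; now rewrite Hfuv|].
          apply Cd_minus; now apply ent_Cd. }
        unfold W. rewrite Ef, Hfuv. ring. }
    assert (HKk : 1 <= K ^ k) by now apply pow_R1_Rle.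
    set (P := cL * K ^ k) in *.
    assert (HP0 : 0 <= P) by (unfold P; nra).
    assert (HF2K : 0 <= 2 * K * Cmod (f z)) by nra.
    (* The larger of |u|, |v| is multiplied by the bound on |W| that contains the smaller one, so
       the product uv appears; if neither exceeds 1, the bound [W1] alone is enough. *)
    assert (Hmain : Rmax 1 (Rmax (Cmod (u z)) (Cmod (v z))) * Cmod (W z) <= 2 * K * (1 + P) * Cmod (f z)).
    { set (n := Rmax (Cmod (u z)) (Cmod (v z))).
      pose proof (Cmod_ge_0 (W z)) as PW.
      assert (Hn : n * Cmod (W z) <= 2 * K * Cmod (f z) * P).
      { unfold n, Rmax. destruct (Rle_dec (Cmod (u z)) (Cmod (v z))).
        - apply Rle_trans with (Cmod (v z) * (2 * K * (Cmod (f z) * Cmod (u z)))).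
          + now apply Rmult_le_compat_l.
          + replace (Cmod (v z) * (2 * K * (Cmod (f z) * Cmod (u z))))
              with (2 * K * Cmod (f z) * (Cmod (u z) * Cmod (v z))) by ring.
            now apply Rmult_le_compat_l.
        - apply Rle_trans with (Cmod (u z) * (2 * K * (Cmod (f z) * Cmod (v z)))).
          + now apply Rmult_le_compat_l.
          + replace (Cmod (u z) * (2 * K * (Cmod (f z) * Cmod (v z))))
              with (2 * K * Cmod (f z) * (Cmod (u z) * Cmod (v z))) by ring.
            now apply Rmult_le_compat_l. }
      unfold Rmax at 1. destruct (Rle_dec 1 n) as [H1|H1]; [nra|].
      assert (Hv1 : Cmod (v z) <= 1) by (assert (Cmod (v z) <= n) by apply Rmax_r; lra).
      assert (2 * K * (Cmod (f z) * Cmod (v z)) <= 2 * K * Cmod (f z)).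
      { replace (2 * K * (Cmod (f z) * Cmod (v z))) with (2 * K * Cmod (f z) * Cmod (v z)) by ring.
        rewrite <- (Rmult_1_r (2 * K * Cmod (f z))) at 2. now apply Rmult_le_compat_l. }
      nra. }
    apply Cmod_gt_0 in Hfz. apply Cmod_gt_0 in HWz.
    unfold logmax. rewrite log_plus_ln, <- ln_mult; trivial.
    2:{ eapply Rlt_le_trans; [apply Rlt_0_1 | apply Rmax_l]. }
    assert (Hx0 : 0 < x) by (unfold x; lra).
    unfold lK. rewrite <- ln_poly by assumption.
    assert (Hxk : 0 < x * K ^ S k) by (apply Rmult_lt_0_compat; [exact Hx0 | apply pow_lt; lra]).
    rewrite <- ln_mult by assumption. apply ln_le.
    - apply Rmult_lt_0_compat; [eapply Rlt_le_trans; [apply Rlt_0_1 | apply Rmax_l] | exact HWz].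
    - eapply Rle_trans; [exact Hmain|]. apply Rmult_le_compat_r; [lra|].
      unfold x, P. simpl. nra. }
  assert (Hcf : forall t, continuous (fun t => ln (Cmod (f (cir r t)))) t).
  { intros t. apply continuous_ln_cir; [exact Hf | apply Hon]. }
  assert (HcWc : forall t, continuous (fun t => ln (Cmod (W (cir r t)))) t).
  { intros t. apply continuous_ln_cir; [exact HW | apply Hon]. }
  assert (HcT : forall t, continuous (fun t => logmax u v (cir r t)) t).
  { intros t. now apply continuous_logmax_cir. }
  assert (I1 : T r + cmean (fun t => ln (Cmod (W (cir r t)))) <= lK + cmean (fun t => ln (Cmod (f (cir r t))))).
  { unfold T. rewrite <- (cmean_const lK), <- !cmean_plus; trivial; [|intros; apply continuous_const].
    apply cmean_le.
    - intros t. now apply continuous_Rplus.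
    - intros t. apply continuous_Rplus; [apply continuous_const | apply Hcf].
    - intros t. apply Hon. }
  assert (I2 : - Rabs cW <= cmean (fun t => ln (Cmod (W (cir r t))))).
  { destruct (factors_exist W zW r HW HzW) as [l [W1 HF]].
    { intros z Hzr. destruct (Hz z Hzr) as [HWz _]. exact HWz. }
    eapply Rle_trans; [|apply (lead_le_cmean W r l W1 Hr HF)].
    rewrite (HcW r l W1 ltac:(lra) HF). pose proof (Rle_abs (- cW)). rewrite Rabs_Ropp in *. lra. }
  assert (I3 : cmean (fun t => ln (Cmod (f (cir r t)))) - cmean (fun t => ln (Cmod (W (cir r t))))
     <= Nbar_zeros f r + c1).
  { apply Hdz; [exact Hr | |].
    - intros z Hzr. destruct (Hz z Hzr) as [_ HG]. apply HG. simpl. tauto.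
    - intros z Hzr. destruct (Hz z Hzr) as [HWz _]. exact HWz. }
  assert (I4 : cmean (fun t => ln (Cmod (f (cir r t)))) <= cmean (fun t => log_plus (Cmod (f (cir r t))))).
  { apply cmean_le; [exact Hcf | intros t; now apply continuous_log_plus_cir | intros t; apply log_plus_ge_ln]. }
  assert (I5 : cmean (fun t => log_plus (Cmod (f (cir r t)))) <= ln 2 + T r).
  { unfold T. rewrite <- (cmean_const (ln 2)), <- cmean_plus; trivial; [|intros; apply continuous_const].
    apply cmean_le.
    - intros t. now apply continuous_log_plus_cir.
    - intros t. apply continuous_Rplus; [apply continuous_const | apply HcT].
    - intros t. set (z := cir r t).
      pose proof (Cmod_ge_0 (u z)). pose proof (Rmax_l (Cmod (u z)) (Cmod (v z))).
      pose proof (Rmax_r (Cmod (u z)) (Cmod (v z))).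
      eapply Rle_trans; [|apply (log_plus_scal_le 2 (Rmax (Cmod (u z)) (Cmod (v z)))); lra].
      apply log_plus_le. rewrite Hfuv. eapply Rle_trans; [apply Cmod_triangle_sub|]. lra. }
  assert (Hln2 : ln 2 <= 1).
  { rewrite <- (ln_exp 1). apply ln_le; [lra|]. pose proof (exp_step 0 1) as H. rewrite exp_0, Rplus_0_l in H. lra. }
  pose proof (Rle_abs c1) as Hac1.
  set (Tf := cmean (fun t => log_plus (Cmod (f (cir r t))))) in *.
  assert (HeT : e * T r <= T r) by nra.
  assert (I6 : (1 - e) * Tf <= (1 - e) * (1 + T r)) by (apply Rmult_le_compat_l; lra).
  (* [I1], [I2] and [I4] bound [Tf] from below, which allows division by it later. [I1] and [I3]
     bound [T r] by [Nbar_zeros f r] plus error terms that [e * T r] absorbs, and [I6] passes to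
     [Tf]. *)
  exists r. split; [exact HM|]. fold Tf. split; lra.
Qed.

End Growth.

(** * Periodicity *)

Lemma linear_operator_ratio (a : nat -> C) (k : nat) :
  exists M, 0 < M /\ forall X z K, ent X -> 1 <= K ->
    (forall w, Cmod (w - z) <= / K -> Cmod (C_derive X w) <= K * Cmod (X w)) ->
    Cmod (sum_n_m (fun j => a j * C_derive_n j X z)%C 1 k) <= M * K ^ k * Cmod (X z).
Proof.
  induction k as [|k [M [HM IH]]].
  - exists 1. split; [lra|]. intros X z K HX HK _. rewrite sum_n_m_zero by lia.
    change (Cmod 0 <= 1 * 1 * Cmod (X z)). rewrite Cmod_0. pose proof (Cmod_ge_0 (X z)). lra.
  - destruct (derive_n_ratio (S k)) as [M' [HM' H]].
    pose proof (Cmod_ge_0 (a (S k))) as Ha.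
    exists (M + Cmod (a (S k)) * M'). split; [nra|].
    intros X z K HX HK HG. rewrite sum_n_Sm by lia.
    specialize (IH X z K HX HK HG). specialize (H X z K HX ltac:(lra) HG).
    pose proof (Cmod_ge_0 (X z)) as HX0.
    assert (HKk : K ^ k <= K ^ S k) by (apply Rle_pow; [lra | lia]).
    assert (HK0 : 0 < K ^ k) by (apply pow_lt; lra).
    eapply Rle_trans; [apply Cmod_triangle|]. rewrite Cmod_mult.
    set (Y := K ^ S k) in *. clearbody Y.
    assert (B1 : M * K ^ k * Cmod (X z) <= M * Y * Cmod (X z)).
    { apply Rmult_le_compat_r; [exact HX0|]. apply Rmult_le_compat_l; lra. }
    assert (B2 : Cmod (a (S k)) * Cmod (C_derive_n (S k) X z)
      <= Cmod (a (S k)) * (M' * Y * Cmod (X z))) by now apply Rmult_le_compat_l.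
    lra.
Qed.

Lemma C_derive_n_shift (f : C -> C) (c z : C) (j : nat) :
  ent f -> C_derive_n j (fun z => f (z + c)%C) z = C_derive_n j f (z + c)%C.
Proof.
  intros Hf. revert z. induction j as [|j IH]; intros z; [reflexivity|].
  simpl. apply Cd_C_derive.
  apply Cd_ext with (fun z => C_derive_n j f (z + c)%C); [intros; symmetry; apply IH|].
  eapply Cd_eq.
  - apply (Cd_comp (C_derive_n j f) (fun z => z + c)%C).
    + apply Cd_plus; [apply Cd_id | apply Cd_const].
    + apply ent_Cd. now apply ent_C_derive_n.
  - simpl. ring.
Qed.

Lemma C_derive_n_minus (f g : C -> C) (z : C) (j : nat) :
  ent f -> ent g ->
  C_derive_n j (fun z => f z - g z)%C z = (C_derive_n j f z - C_derive_n j g z)%C.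
Proof.
  intros Hf Hg. revert z. induction j as [|j IH]; intros z; [reflexivity|].
  simpl. apply Cd_C_derive.
  apply Cd_ext with (fun z => C_derive_n j f z - C_derive_n j g z)%C; [intros; symmetry; apply IH|].
  apply Cd_minus; apply ent_Cd; now apply ent_C_derive_n.
Qed.

Lemma sum_n_m_Cminus (x y : nat -> C) (m n : nat) :
  sum_n_m (fun j => x j - y j)%C m n = (sum_n_m x m n - sum_n_m y m n)%C.
Proof.
  pose proof (sum_n_m_plus (fun j => x j - y j)%C y m n) as H.
  rewrite (sum_n_m_ext _ x) in H.
  - rewrite H. assert (E : forall p q : C, p = (p + q - q)%C) by (intros; ring). apply E.
  - intros j. assert (E : forall p q : C, (p - q + q)%C = p) by (intros; ring). apply E.
Qed.

Lemma liouville (f : C -> C) (M : R) :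
  ent f -> (forall z, Cmod (f z) <= M) -> forall z, f z = f 0%C.
Proof.
  intros Hf HM z.
  assert (H0 : forall w, C_derive f w = 0%C).
  { intros w. apply Cmod_eq_0. apply Rle_antisym; [|apply Cmod_ge_0].
    apply Rnot_lt_le. intros Hlt.
    assert (HM0 : 0 <= M) by (eapply Rle_trans; [apply Cmod_ge_0 | apply (HM 0%C)]).
    set (d := (M + 1) / Cmod (C_derive f w)).
    assert (Hd : 0 < d) by (apply Rdiv_lt_0_compat; lra).
    pose proof (derive_estimate f w d M Hf Hd (fun u _ => HM u)) as H.
    assert (E : Cmod (C_derive f w) = (M + 1) / d) by (unfold d; field; lra).
    rewrite E in H. unfold Rdiv in H.
    apply Rmult_le_reg_r in H; [lra | now apply Rinv_0_lt_compat]. }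
  pose proof (Cd_mean_value f (fun _ => 0%C) 0%C 0%C (Cmod z + 1) 0) as H.
  specialize (H ltac:(intros w _; split; [rewrite <- (H0 w); now apply ent_Cd | rewrite Cminus_diag, Cmod_0; lra]) z).
  replace (z - 0)%C with z in H by ring. specialize (H ltac:(lra)).
  replace (f z - f 0 - 0 * z)%C with (f z - f 0)%C in H by ring.
  apply Ceq_minus. apply Cmod_eq_0. apply Rle_antisym; [lra | apply Cmod_ge_0].
Qed.

Lemma transcendental_unbounded (f : C -> C) :
  transcendental_entire f -> forall M, exists z, M < Cmod (f z).
Proof.
  intros [Hf Hnp] M. apply NNPP. intros Hno. apply Hnp.
  exists 0%nat, (fun _ => f 0%C). intros z. rewrite sum_O. simpl. rewrite Cmult_1_r.
  apply (liouville f M); [now apply entire_ent|]. intros w. apply Rnot_lt_le. intros Hlt.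
  apply Hno. now exists w.
Qed.

Theorem theorem4p2 (f : C -> C) (k : nat) (a : nat -> C) (c : C)
  (hf : transcendental_entire f)
  (hk : (1 <= k)%nat)
  (hper : periodic c (fun z =>
     (f z ^ 3 + sum_n_m (fun j => a j * C_derive_n j f z) 1 k)%C))
  (hTheta : Rbar_lt 0 (Theta0 f)) :
  periodic c f \/ periodic (3 * c)%C f.
Proof.
  pose proof (transcendental_unbounded f hf) as Hunb.
  pose proof (entire_ent f (proj1 hf)) as Hf.
  destruct hper as [Hc Hper].
  set (om := (- / 2, sqrt 3 / 2) : C).
  set (om2 := (- / 2, - (sqrt 3 / 2)) : C).
  (* Dividing by [kap] normalises u - v to f; its square is -3, which is the source of the factor
     3. *)
  set (kap := (om2 - om)%C).
  assert (Hs3 : sqrt 3 * sqrt 3 = 3) by (apply sqrt_sqrt; lra).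
  assert (Eom : (om * om)%C = om2).
  { unfold om, om2. apply injective_projections; simpl; nra. }
  assert (Esum : (1 + om + om2)%C = 0%C).
  { unfold om, om2. apply injective_projections; simpl; field. }
  assert (Eom3 : (om * om2)%C = 1%C).
  { unfold om, om2. apply injective_projections; simpl; nra. }
  assert (Ekap : (kap * kap)%C = (- (3))%C).
  { unfold kap, om, om2. apply injective_projections; simpl; nra. }
  assert (Hkap : kap <> 0%C).
  { intros E. rewrite E, Cmult_0_l in Ekap. injection Ekap. lra. }
  set (g := fun z => f (z + c)%C).
  assert (Hg : ent g).
  { apply (ent_comp f (fun z => z + c)%C); [exact Hf|]. apply ent_plus; [apply ent_id | apply ent_const]. }
  set (h := fun z => (g z - f z)%C).
  assert (Hh : ent h) by now apply ent_minus.
  assert (H3c : (3 * c)%C <> 0%C) by (apply Cmult_neq_0; [apply RtoC_neq_0; lra | exact Hc]).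
  assert (Hrot : forall w : C, (w * w * w)%C = 1%C -> (forall z, g z = (w * f z)%C) -> periodic (3 * c)%C f).
  { intros w Hw Hgw. split; [exact H3c|]. intros z.
    replace (z + 3 * c)%C with (z + c + c + c)%C by ring.
    change (f (z + c + c + c)%C) with (g (z + c + c)%C). rewrite Hgw.
    change (f (z + c + c)%C) with (g (z + c)%C). rewrite Hgw.
    change (f (z + c)%C) with (g z). rewrite Hgw.
    transitivity (w * w * w * f z)%C; [ring|]. rewrite Hw. ring. }
  destruct (classic (exists z, h z <> 0%C)) as [Hh0|Hh0].
  2:{ left. split; [exact Hc|]. intros z. apply Ceq_minus.
      destruct (Ceq_dec (h z) 0%C) as [E|E]; [exact E|]. exfalso. apply Hh0. now exists z. }
  destruct (classic (exists z, (g z - om * f z)%C <> 0%C)) as [Hu0|Hu0].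
  2:{ right. apply (Hrot om); [now rewrite Eom, Cmult_comm|]. intros z. apply Ceq_minus.
      destruct (Ceq_dec (g z - om * f z)%C 0%C) as [E|E]; [exact E|]. exfalso. apply Hu0. now exists z. }
  destruct (classic (exists z, (g z - om2 * f z)%C <> 0%C)) as [Hv0|Hv0].
  2:{ right. apply (Hrot om2).
      - rewrite <- Eom at 1. transitivity ((om * om2) * (om * om2))%C; [ring|]. rewrite Eom3. ring.
      - intros z. apply Ceq_minus.
        destruct (Ceq_dec (g z - om2 * f z)%C 0%C) as [E|E]; [exact E|]. exfalso. apply Hv0. now exists z. }
  exfalso. revert hTheta. unfold Theta0. apply not_Theta_pos.
  set (u := fun z => (/ kap * (g z - om * f z))%C).
  set (v := fun z => (/ kap * (g z - om2 * f z))%C).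
  assert (Hik : (/ kap)%C <> 0%C).
  { intros E. apply C1_nz. rewrite <- (Cinv_r kap Hkap), E. ring. }
  assert (Hu : ent u).
  { apply (ent_mult (fun _ => / kap)%C); [apply ent_const|].
    apply ent_minus; [exact Hg|]. apply (ent_mult (fun _ => om)); [apply ent_const | exact Hf]. }
  assert (Hv : ent v).
  { apply (ent_mult (fun _ => / kap)%C); [apply ent_const|].
    apply ent_minus; [exact Hg|]. apply (ent_mult (fun _ => om2)); [apply ent_const | exact Hf]. }
  assert (Hfuv : forall z, f z = (u z - v z)%C).
  { intros z. unfold u, v. transitivity (/ kap * (kap * f z))%C; [field; exact Hkap|].
    unfold kap at 2. ring. }
  assert (Hgu : forall z, g z = (kap * u z + om * f z)%C).
  { intros z. unfold u. field. exact Hkap. }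
  destruct (linear_operator_ratio a k) as [M [HM HL]].
  (* The three linear factors multiply to g^3 - f^3 over [kap * kap]. By periodicity f^3 - g^3 is
     the differential operator applied to g - f, since its coefficients are constant. *)
  assert (Huvh : forall z, (u z * v z * h z)%C =
     (/ 3 * sum_n_m (fun j => a j * C_derive_n j h z)%C 1 k)%C).
  { intros z.
    assert (E1 : sum_n_m (fun j => a j * C_derive_n j h z)%C 1 k
      = (sum_n_m (fun j => a j * C_derive_n j f (z + c))%C 1 k - sum_n_m (fun j => a j * C_derive_n j f z)%C 1 k)%C).
    { rewrite <- sum_n_m_Cminus. apply sum_n_m_ext. intros j. unfold h.
      rewrite C_derive_n_minus by assumption. unfold g. rewrite C_derive_n_shift by exact Hf.
      assert (E : forall p q r : C, (p * (q - r))%C = (p * q - p * r)%C) by (intros; ring). apply E. }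
    specialize (Hper z). cbv beta in Hper. change (f (z + c)%C) with (g z) in Hper.
    assert (E2 : (sum_n_m (fun j => a j * C_derive_n j f (z + c))%C 1 k
       - sum_n_m (fun j => a j * C_derive_n j f z)%C 1 k)%C = (f z ^ 3 - g z ^ 3)%C).
    { set (S1 := sum_n_m (fun j => a j * C_derive_n j f (z + c))%C 1 k) in *.
      set (S0 := sum_n_m (fun j => a j * C_derive_n j f z)%C 1 k) in *.
      transitivity ((g z ^ 3 + S1) - g z ^ 3 - S0)%C; [ring|].
      transitivity ((f z ^ 3 + S0) - g z ^ 3 - S0)%C; [|ring].
      now rewrite <- Hper. }
    rewrite E1, E2. unfold u, v, h.
    transitivity (/ (kap * kap) * ((g z * g z - (om + om2) * (f z * g z) + om * om2 * (f z * f z)) * (g z - f z)))%C;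
      [field; exact Hkap|].
    rewrite Ekap, Eom3. replace (om + om2)%C with (- (1))%C.
    - field.
    - transitivity ((1 + om + om2) - 1 - (1 + om + om2))%C; [ring|]. rewrite Esum at 1.
      transitivity ((1 + om + om2) - 1)%C; [rewrite Esum; ring | ring]. }
  (* From g = kap u + om f it follows that h = kap u + (om - 1)(u - v). *)
  set (c0 := Cmod kap + 2 * Cmod (om - 1)).
  pose proof (Cmod_ge_0 kap) as Pk. pose proof (Cmod_ge_0 (om - 1)) as Po.
  assert (Hhuv : forall z, Cmod (h z) <= c0 * Rmax (Cmod (u z)) (Cmod (v z))).
  { intros z. replace (h z) with (kap * u z + (om - 1) * (u z - v z))%C.
    - eapply Rle_trans; [apply Cmod_triangle|]. rewrite !Cmod_mult.
      pose proof (Cmod_triangle_sub (u z) (v z)) as T1.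
      pose proof (Rmax_l (Cmod (u z)) (Cmod (v z))) as T2. pose proof (Rmax_r (Cmod (u z)) (Cmod (v z))) as T3.
      set (x := Rmax (Cmod (u z)) (Cmod (v z))) in *. unfold c0.
      assert (Cmod kap * Cmod (u z) <= Cmod kap * x) by now apply Rmult_le_compat_l.
      assert (Cmod (om - 1) * Cmod (u z - v z) <= Cmod (om - 1) * (2 * x)) by (apply Rmult_le_compat_l; lra).
      lra.
    - rewrite <- Hfuv. unfold h. rewrite Hgu. ring. }
  assert (HLh : forall z K, 1 <= K ->
    (forall w, Cmod (w - z) <= / K -> Cmod (C_derive h w) <= K * Cmod (h w)) ->
    Cmod (u z * v z * h z) <= M * K ^ k * Cmod (h z)).
  { intros z K HK HG. rewrite Huvh, Cmod_mult.
    specialize (HL h z K Hh HK HG).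
    assert (E3 : Cmod (/ 3) <= 1).
    { rewrite <- RtoC_inv by lra. rewrite Cmod_R, Rabs_pos_eq; lra. }
    pose proof (Cmod_ge_0 (sum_n_m (fun j => a j * C_derive_n j h z)%C 1 k)).
    pose proof (Cmod_ge_0 (/ 3)). nra. }
  intros e m0 He.
  (* The counting estimate is for [e] below 1; shrinking [e] only strengthens its conclusion. *)
  assert (He' : 0 < Rmin e (1 / 2) < 1).
  { split; [apply Rmin_glb_lt; lra|]. pose proof (Rmin_r e (1 / 2)). lra. }
  assert (Hne : forall (x : C -> C), (exists z, x z <> 0%C) -> exists z, (/ kap * x z)%C <> 0%C).
  { intros x [z Hz]. exists z. now apply Cmult_neq_0. }
  destruct (zero_counting_lower_bound f u v h c0 Hu Hv Hh Hf (Hne _ Hu0) (Hne _ Hv0) Hh0 Hfuv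
    ltac:(unfold c0; lra) Hhuv Hunb k M HM HLh (Rmin e (1 / 2)) m0 He') as [r [Hr [HT HN]]].
  exists r. split; [exact Hr|]. rewrite nevanlinna_T_entire by exact Hf.
  pose proof (Rmin_l e (1 / 2)).
  set (T := cmean (fun t => log_plus (Cmod (f (cir r t))))) in *.
  apply Rmult_le_reg_r with T; [lra|]. unfold Rdiv. rewrite Rmult_assoc, Rinv_l by lra. nra.
Qed.
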